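(* Let $\mathbf{k}$ be a perfect field, let $S$ be a non-trivial Severi–Brauer surface over $\mathbf{k}$ and $S^{op}$ its opposite Severi–Brauer surface. Let $\chi,\chi_1,\chi_2,\chi_3: S\dashrightarrow S^{op}$ and $\tau,\tau_1,\tau_2,\tau_3: S^{op}\dashrightarrow S$ be $\mathbf{k}$-Sarkisov links based at $3$-points, such that there are $\alpha_i,\delta_i\in \mathrm{Aut}_{\mathbf{k}}(S)$ and $\beta_i,\gamma_i\in \mathrm{Aut}_{\mathbf{k}}(S^{op})$ ($i=1,2,3$) with $\tau_i=\alpha_i\tau\beta_i$ and $\chi_i=\gamma_i\chi\delta_i$, and such that the base points of $\chi$ and $\tau$ are in general position (jointly, in the sense given in the context). If $\tau_3\chi_3\tau_2\chi_2\tau_1\chi_1=\mathrm{id}$, then $$\prod_{i=1}^3 \det(\alpha_i\delta_i)\,\det(\beta_i\gamma_i)^{-1}=1\quad\text{in }\mathbf{k}^*/(\mathbf{k}^* )^3 .$$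
   Context: A Severi–Brauer surface over $\mathbf{k}$ is a smooth projective surface $S$ with $S_{\bar{\mathbf{k}}}\simeq\mathbb{P}^2_{\bar{\mathbf{k}}}$; it is non-trivial if it is not $\mathbf{k}$-isomorphic to $\mathbb{P}^2_{\mathbf{k}}$ (equivalently, has no $\mathbf{k}$-point). Such surfaces correspond to central simple $\mathbf{k}$-algebras of dimension $9$; $S^{op}$ is the surface corresponding to the opposite algebra of that of $S$. A $d$-point is a Galois orbit of $d$ geometric points (a closed point of degree $d$); these geometric points are its components. A Sarkisov link $\chi:S\dashrightarrow S'$ (with $S,S'$ among these surfaces) is a birational map over $\mathbf{k}$ that is not an isomorphism and is of the form $\chi=\pi'\circ\pi^{-1}$, where $X$ is a smooth projective surface over $\mathbf{k}$ with $-K_X$ ample and Picard rank $2$ over $\mathbf{k}$, and $\pi:X\to S$, $\pi':X\to S'$ are birational morphisms; it is based at the closed point blown up by $\pi$. A link based at a $3$-point is the blow-up of this point followed by the contraction of the strict transforms of the three lines through pairs of its components; its inverse is again a link based at a $3$-point. General position: the condition concerns the joint position of two $3$-points. The base point of $\tau$ and the base point of $\chi^{-1}$ are both $3$-points of $S^{op}$; the base points of $\chi$ and $\tau$ are in general position if the six components of these two $3$-points are six distinct points of $S^{op}_{\bar{\mathbf{k}}}\simeq\mathbb{P}^2_{\bar{\mathbf{k}}}$, no three on a line and not all six on a conic, i.e. blowing up both $3$-points of $S^{op}$ gives a del Pezzo surface of degree $3$. Determinant: let $T\in\{S,S^{op}\}$, $\mathbf{k}\subset \mathbf{L}$ a finite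 Galois extension with an $\mathbf{L}$-isomorphism $\varphi:T_{\mathbf{L}}\to\mathbb{P}^2_{\mathbf{L}}$, and choose $A_g\in \mathrm{GL}_3(\mathbf{L})$ with $\varphi\circ g\circ\varphi^{-1}=[A_g]\circ g$ for $g\in \mathrm{Gal}(\mathbf{L}/\mathbf{k})$. For $\alpha\in \mathrm{Aut}_{\mathbf{k}}(T)$ there is $A\in \mathrm{GL}_3(\mathbf{L})$, unique up to $\mathbf{k}^*$, representing $\varphi\alpha\varphi^{-1}$ with $A^g=A_g^{-1}AA_g$ for all $g$ ($A^g$: apply $g$ to the entries). Then $\det(A)\in\mathbf{k}^*$, and $\det(\alpha)$ is its class in $\mathbf{k}^*/(\mathbf{k}^* )^3$; it does not depend on the choices and $\det:\mathrm{Aut}_{\mathbf{k}}(T)\to\mathbf{k}^*/(\mathbf{k}^* )^3$ is a group homomorphism. *)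

(* Defs.v *)
From HB Require Import structures.
From mathcomp Require Import all_boot all_order all_algebra all_fingroup all_field.
From mathcomp Require Import mpoly.

Set Implicit Arguments.
Unset Strict Implicit.
Unset Printing Implicit Defensive.

Import GRing.Theory.
Local Open Scope ring_scope.

(* Conventions.  [k] is perfect and [iota : k -> K] is an algebraic closure.
   Since [k] is perfect, reduced projective k-schemes are handled through their
   K-points together with equations over [k].  A point of P^n(K) is a nonzero
   column vector of K^(n+1), up to [same_pt]; functions between point sets are
   functions on representatives, and all the notions below only see them up to
   [same_pt]. *)

Definition perfect_field (k : fieldType) : Prop :=
  forall p, p \in [pchar k] -> forall x : k, exists y : k, y ^+ p = x.

Definition is_alg_closure (k : fieldType) (K : closedFieldType)
    (iota : {rmorphism k -> K}) : Prop :=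
  integralRange iota.

Section Projective.

Variable K : closedFieldType.

Definition same_pt (n : nat) (x y : 'cV[K]_n.+1) : Prop :=
  exists2 c : K, c != 0 & y = c *: x.

Definition pset (n : nat) := 'cV[K]_n.+1 -> Prop.

Definition plane : pset 2 := fun x => x != 0.

Section Over.

Variables (E : fieldType) (e : {rmorphism E -> K}).

Definition peval (n : nat) (p : {mpoly E[n.+1]}) (x : 'cV[K]_n.+1) : K :=
  (map_mpoly e p).@[fun i => x i 0].

Definition closed_over (n : nat) (X : pset n) : Prop :=
  exists2 s : seq {mpoly E[n.+1]},
    (forall p, p \in s -> exists d, p \is d.-homog) &
    forall x, X x <-> x != 0 /\ (forall p, p \in s -> peval p x = 0).

Definition ptuple (n m : nat) := 'I_m.+1 -> {mpoly E[n.+1]}.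

Definition homog_tuple (n m : nat) (F : ptuple n m) : Prop :=
  exists d, forall i, F i \is d.-homog.

(* [teval F x = 0] means that the formula [F] is not defined at [x]. *)
Definition teval (n m : nat) (F : ptuple n m) (x : 'cV[K]_n.+1) :
    'cV[K]_m.+1 :=
  \col_i peval (F i) x.

Definition morphism_over (n m : nat) (X : pset n) (Y : pset m)
    (f : 'cV[K]_n.+1 -> 'cV[K]_m.+1) : Prop :=
  forall x, X x -> Y (f x) /\
    exists F : ptuple n m, [/\ homog_tuple F, teval F x != 0 &
      forall y, X y -> teval F y != 0 -> same_pt (f y) (teval F y)].

Definition inverse_isos (n m : nat) (X : pset n) (Y : pset m)
    (f : 'cV[K]_n.+1 -> 'cV[K]_m.+1) (g : 'cV[K]_m.+1 -> 'cV[K]_n.+1) : Prop :=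
  [/\ morphism_over X Y f, morphism_over Y X g,
      forall x, X x -> same_pt (g (f x)) x &
      forall y, Y y -> same_pt (f (g y)) y].

Definition isomorphic_over (n m : nat) (X : pset n) (Y : pset m) : Prop :=
  exists f g, inverse_isos X Y f g.

(* [X] is meant to be irreducible, so that non-empty open sets are dense. *)
Definition rational_inverse (n m : nat) (X : pset n)
    (F : ptuple n m) (G : ptuple m n) : Prop :=
  (exists2 x, X x & teval G (teval F x) != 0 /\ teval F x != 0) /\
  (forall x, X x -> teval F x != 0 -> teval G (teval F x) != 0 ->
     same_pt (teval G (teval F x)) x).

End Over.

(* The sextic del Pezzo surface {(a, b) | a_0 b_0 = a_1 b_1 = a_2 b_2} of
   P^2 x P^2, in its Segre embedding.  Its first projection is the blow-up of
   P^2 in the three coordinate points; the strict transforms of the coordinate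
   lines a_i = 0, that is, of the lines through two of these points, are the
   curves on which b is the i-th coordinate point.  Its second projection is
   the contraction of these three curves. *)
Definition segre (a b : 'cV[K]_3) : 'cV[K]_(3 * 3) := (mxvec (a *m b^T))^T.

Definition incident (a b : 'cV[K]_3) : Prop :=
  [/\ a != 0, b != 0 & forall i j : 'I_3, a i 0 * b i 0 = a j 0 * b j 0].

Definition dP6 : pset 8 := fun w =>
  exists a b, incident a b /\ same_pt (segre a b) w.

(* Six points of P^2, no three on a line and not all on a conic (distinctness
   being included); the conic need not be irreducible. *)
Definition general_six (r : 'I_3 + 'I_3 -> 'cV[K]_3) : Prop :=
  [/\ forall s t, same_pt (r s) (r t) -> s = t,
      forall l : 'rV[K]_3, l != 0 ->
        (#|[set t | l *m r t == 0%R]| <= 2)%N &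
      forall q : {mpoly K[3]}, q != 0 -> q \is 2.-homog ->
        exists t, q.@[fun i => r t i 0] != 0].

End Projective.

Section SeveriBrauer.

Variables (k : fieldType) (K : closedFieldType) (iota : {rmorphism k -> K}).

(* Elements of Gal(K/k): such an endomorphism is bijective, K being algebraic
   over [k]. *)
Definition fixes_base (h : {rmorphism K -> K}) : Prop :=
  forall x, h (iota x) = iota x.

(* Being isomorphic to P^2 over K, such a projective k-variety is a smooth
   (geometrically irreducible) surface. *)
Record sb_surface := SBSurface {
  sb_ambient : nat;
  sb_pts :> 'cV[K]_sb_ambient.+1 -> Prop;
  sb_closed : closed_over iota sb_pts;
  sb_geom : isomorphic_over (idfun : {rmorphism K -> K}) sb_pts (@plane K)
}.

Definition nontrivial (S : sb_surface) : Prop :=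
  ~ isomorphic_over iota S (@plane K).

Definition is_aut (S : sb_surface)
    (f : 'cV[K]_(sb_ambient S).+1 -> 'cV[K]_(sb_ambient S).+1) : Prop :=
  exists g, inverse_isos iota S S f g.

(* The choices entering the definition of the determinant: a finite Galois
   extension L/k (placed inside K by [sp_emb]), an L-isomorphism
   phi : S_L -> P^2_L with inverse [sp_psi], and matrices A_g such that
   phi g phi^-1 = [A_g] g.  The last equality is tested on K-points, where g
   acts through its extensions h to K. *)
Record splitting (S : sb_surface) := Splitting {
  sp_field : splittingFieldType k;
  sp_galois : galois 1%AS {:sp_field};
  sp_emb : {rmorphism sp_field -> K};
  sp_embE : forall x : k, sp_emb x%:A = iota x;
  sp_phi : 'cV[K]_(sb_ambient S).+1 -> 'cV[K]_3;
  sp_psi : 'cV[K]_3 -> 'cV[K]_(sb_ambient S).+1;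
  sp_iso : inverse_isos sp_emb S (@plane K) sp_phi sp_psi;
  sp_mx : gal_of {:sp_field} -> 'M[sp_field]_3;
  sp_mx_unit : forall g, g \in 'Gal({:sp_field} / 1)%g -> sp_mx g \in unitmx;
  sp_mxE : forall g (h : {rmorphism K -> K}),
    g \in 'Gal({:sp_field} / 1)%g -> fixes_base h ->
    (forall z, h (sp_emb z) = sp_emb (g z)) ->
    forall x, plane x ->
      same_pt (sp_phi (map_mx h (sp_psi x)))
              (map_mx sp_emb (sp_mx g) *m map_mx h x)
}.

Arguments sp_mx {S} s g.
Arguments sp_emb {S} s.
Arguments sp_phi {S} s.
Arguments sp_psi {S} s.

(* The condition A^g = A_g^-1 A A_g. *)
Definition twist_fixed (S : sb_surface) (s : splitting S)
    (A : 'M[sp_field s]_3) : Prop :=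
  forall g, g \in 'Gal({:sp_field s} / 1)%g ->
    map_mx (g : sp_field s -> sp_field s) A
      = invmx (sp_mx s g) *m A *m sp_mx s g.

(* The central simple k-algebra of [S] is {A in M_3(L) | A^g = A_g^-1 A A_g};
   [R], with structure map [inR : k -> R], is isomorphic to it over [k]. *)
Definition has_algebra (S : sb_surface) (s : splitting S)
    (R : nzRingType) (inR : k -> R) : Prop :=
  exists rho : {rmorphism R -> 'M[sp_field s]_3},
    [/\ injective rho, forall c, rho (inR c) = (c%:A)%:M &
        forall A, twist_fixed A <-> exists x, rho x = A].

Definition opposite (S T : sb_surface) (s : splitting S) (t : splitting T) :
    Prop :=
  exists2 D : falgType k,
    has_algebra s (in_alg D) & has_algebra t (in_alg D : k -> D^c).

Definition is_det (S : sb_surface) (s : splitting S)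
    (alpha : 'cV[K]_(sb_ambient S).+1 -> 'cV[K]_(sb_ambient S).+1) (d : k) : Prop :=
  exists A : 'M[sp_field s]_3,
    [/\ A \in unitmx,
        forall x, plane x ->
          same_pt (sp_phi s (alpha (sp_psi s x))) (map_mx (sp_emb s) A *m x),
        twist_fixed A & \det A = d%:A].

(* A birational map over [k], given by one pair of polynomial representatives;
   two such data are the same birational map when their graphs agree on their
   common domain. *)
Record birat (S T : sb_surface) := Birat {
  bi_fwd : ptuple k (sb_ambient S) (sb_ambient T);
  bi_bwd : ptuple k (sb_ambient T) (sb_ambient S);
  bi_fwd_homog : homog_tuple bi_fwd;
  bi_bwd_homog : homog_tuple bi_bwd;
  bi_fwd_in : forall x, S x -> teval iota bi_fwd x != 0 ->
    T (teval iota bi_fwd x);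
  bi_bwd_in : forall y, T y -> teval iota bi_bwd y != 0 ->
    S (teval iota bi_bwd y);
  bi_fwdK : rational_inverse iota S bi_fwd bi_bwd;
  bi_bwdK : rational_inverse iota T bi_bwd bi_fwd
}.

Definition birat_inv (S T : sb_surface) (f : birat S T) : birat T S :=
  Birat (bi_bwd_homog f) (bi_fwd_homog f) (bi_bwd_in (b:=f)) (bi_fwd_in (b:=f))
        (bi_bwdK f) (bi_fwdK f).

Definition graph (S T : sb_surface) (f : birat S T)
    (x : 'cV[K]_(sb_ambient S).+1) (y : 'cV[K]_(sb_ambient T).+1) : Prop :=
  [/\ S x, teval iota (bi_fwd f) x != 0 & same_pt (teval iota (bi_fwd f) x) y].

(* f' = a o f o b as rational maps. *)
Definition factors_as (S T : sb_surface) (f' f : birat S T)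
    (a : 'cV[K]_(sb_ambient T).+1 -> 'cV[K]_(sb_ambient T).+1)
    (b : 'cV[K]_(sb_ambient S).+1 -> 'cV[K]_(sb_ambient S).+1) : Prop :=
  forall x y z, graph f' x y -> graph f (b x) z -> same_pt y (a z).

(* A 3-point, given by its three components. *)
Definition three_point (S : sb_surface)
    (p : 'I_3 -> 'cV[K]_(sb_ambient S).+1) : Prop :=
  [/\ forall i, S (p i),
      forall i j, same_pt (p i) (p j) -> i = j,
      forall h : {rmorphism K -> K}, fixes_base h ->
        forall i, exists j, same_pt (map_mx h (p i)) (p j) &
      forall i j, exists2 h : {rmorphism K -> K},
        fixes_base h & same_pt (map_mx h (p i)) (p j)].

(* [f] is a link based at the 3-point [p]: f = pi' o pi^-1, where the k-morphism
   pi : X -> S is the blow-up of [p] and the k-morphism pi' : X -> T is the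
   contraction of the strict transforms of the lines through two components of
   [p].  The blow-up in three non-collinear points and this contraction are
   unique up to isomorphism, and isomorphisms of P^2_K are linear; so this says
   that some K-isomorphism theta : X_K -> dP6 and linear coordinates [P], [Q] on
   S_K, T_K turn pi and pi' into the two projections, with [P] sending the
   coordinate points to [p].  Collinear components are excluded because -K_X
   would not be ample; conversely -K_X is ample here, and X has Picard rank 2
   over [k] as the components of [p] form one Galois orbit. *)
Definition link_at (S T : sb_surface) (s : splitting S) (t : splitting T)
    (f : birat S T) (p : 'I_3 -> 'cV[K]_(sb_ambient S).+1) : Prop :=
  three_point p /\
  exists (N : nat) (X : pset K N) (pi : 'cV[K]_N.+1 -> 'cV[K]_(sb_ambient S).+1)
         (pi' : 'cV[K]_N.+1 -> 'cV[K]_(sb_ambient T).+1),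
    [/\ closed_over iota X, morphism_over iota X S pi,
        morphism_over iota X T pi',
        forall z y, X z -> graph f (pi z) y -> same_pt (pi' z) y &
        exists theta theta', inverse_isos (idfun : {rmorphism K -> K})
                               X (@dP6 K) theta theta' /\
        exists P Q : 'M[K]_3,
          [/\ P \in unitmx, Q \in unitmx,
              forall i, same_pt (sp_phi s (p i)) (col i P) &
              forall z a b, X z -> incident a b ->
                same_pt (theta z) (segre a b) ->
                same_pt (sp_phi s (pi z)) (P *m a) /\
                same_pt (sp_phi t (pi' z)) (Q *m b)]].

Definition three_link (S T : sb_surface) (s : splitting S) (t : splitting T)
    (f : birat S T) : Prop :=
  exists p, link_at s t f p.

Definition general_position (T : sb_surface) (t : splitting T)
    (p q : 'I_3 -> 'cV[K]_(sb_ambient T).+1) : Prop :=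
  general_six (fun u : 'I_3 + 'I_3 =>
    sp_phi t (match u with inl i => p i | inr j => q j end)).

End SeveriBrauer.

Arguments is_aut {k K iota} S f.

(* Equality in k^* / (k^* )^3. *)
Definition eq_mod_cubes (k : fieldType) (a b : k) : Prop :=
  exists2 c : k, c != 0 & a = c ^+ 3 * b.

(* Main.v *)
Require Import Defs.
From HB Require Import structures.
From mathcomp Require Import all_boot all_order all_algebra all_fingroup all_field.
From mathcomp Require Import mpoly.
From mathcomp Require Import zify ring.
From mathcomp Require boolp classical_sets.

Set Implicit Arguments.
Unset Strict Implicit.
Unset Printing Implicit Defensive.

Import GRing.Theory.
Local Open Scope ring_scope.

(* Put the base points of the links at the coordinate points.  Over K, chi and tau become
   Q sig P^-1 and Q' sig P'^-1, where sig (x_0 : x_1 : x_2) = (x_1 x_2 : x_2 x_0 : x_0 x_1).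
   Since tau_i = alpha_i tau beta_i is quadratic too, alpha_i and beta_i are linear, and the
   relation reads sig X_6 ... sig X_1 = id, where the X_j are alternately P^-1 A Q' and
   P'^-1 B Q, with A a matrix of delta_{i+1} alpha_i and B one of beta_i gamma_i.
     Either some X_j is monomial and the word can be shortened, or X_{j+1} J(X_j) is monomial
   for all j, where J inverts all entries.  In both cases there is an explicit nu with
   nu^3 det (X_2 X_4 X_6) = det (X_1 X_3 X_5), and Gal(K/k) acts on nu by the expected scalar:
   this uses that it permutes the components of the base points transitively.  Multiplying nu
   by det (P Q) / det (P' Q') gives an element of K that is fixed by Gal(K/k), hence lies in
   the perfect field k, and whose cube is the product of the theorem. *)

(** * The standard quadratic map *)

(** Every element of [K] has a cube root, so the mere existence of [nu] says nothing: under the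
    Galois group an arbitrary root would pick up uncontrolled cube roots of unity. This is why [nu]
    is given by explicit formulas in the matrices, on which the action can be computed. The
    alternative comes from cutting the cyclic relation into two halves. A word is kept as a vector
    of polynomials, and the common zeros of its coordinates are its base points. If the inverse of
    the first half has only finitely many zeros in the plane, the two halves agree up to a constant,
    so they vanish at the same points, and this forces the letter after the cut to be monomial. When
    neither of the last two letters before the cut is monomial, infinitely many zeros can occur only
    if a line contracted by one [sig] is carried to a base point of the second [sig] after it. By
    transitivity this then happens to all three lines, which is the condition on [X_{j+1} J(X_j)].
    Around a full cycle this condition ties the entries of three consecutive matrices together, and
    [nu] is assembled from their row, column and total products. *)

Lemma ord3P (P : 'I_3 -> Prop) : P 0 -> P 1 -> P 2 -> forall i, P i.
Proof.
move=> P0 P1 P2 [[|[|[|//]]] lt_i].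
- by rewrite (_ : Ordinal lt_i = 0) //; apply: val_inj.
- by rewrite (_ : Ordinal lt_i = 1) //; apply: val_inj.
- by rewrite (_ : Ordinal lt_i = 2) //; apply: val_inj.
Qed.

Lemma ord3_add :
  ((1 + 1 = 2 :> 'I_3)%R * (1 + 2 = 0 :> 'I_3)%R * (2 + 1 = 0 :> 'I_3)%R *
   (2 + 2 = 1 :> 'I_3)%R * (0 + 1 = 1 :> 'I_3)%R * (0 + 2 = 2 :> 'I_3)%R)%type.
Proof. by do !split; apply: val_inj. Qed.

Lemma big_ord3 (T : Type) (idx : T) (op : Monoid.law idx) (F : 'I_3 -> T) :
  \big[op/idx]_i F i = op (op (F 0) (F 1)) (F 2).
Proof.
rewrite !big_ord_recl big_ord0 Monoid.mulm1 Monoid.mulmA.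
by do ?[congr (op _ _)]; congr (F _); apply: val_inj.
Qed.

Section CommutativeRing.

Variable R : comNzRingType.
Implicit Types (x y : 'cV[R]_3) (M : 'M[R]_3).

Definition sig x : 'cV[R]_3 := \col_i (x (i + 1) 0 * x (i + 2) 0).

Definition pi3 x : R := x 0 0 * x 1 0 * x 2 0.

(* Proportionality; everything is proportional to 0, so this is not transitive. *)
Definition par x y := forall i j, x i 0 * y j 0 = x j 0 * y i 0.

(** [fwd] applies each matrix before [sig] and [bwd] after it, so that [bwd (map invmx s)] inverts
    [fwd s] up to a scalar. Both have degree [2 ^ size s], and common factors are never removed: the
    argument lives on the zeros. *)
Definition fwd (s : seq 'M[R]_3) x := foldl (fun v M => sig (M *m v)) x s.

Definition bwd (s : seq 'M[R]_3) x := foldr (fun M v => M *m sig v) x s.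

Lemma neq0_coord n (x : 'cV[R]_n) : x != 0 -> exists i, x i 0 != 0.
Proof.
move=> x0; apply/existsP; apply: contraNT x0; rewrite negb_exists => /forallP x0.
by apply/eqP/colP => i; rewrite mxE; apply/eqP; rewrite -[_ == _]negbK x0.
Qed.

Lemma sig_prod x i : sig x i 0 = \prod_(l | l != i) x l 0.
Proof.
rewrite big_mkcond big_ord3 /= !mxE.
by elim/ord3P: i; rewrite !ord3_add !eqxx ?mulr1 ?mul1r // mulrC.
Qed.

Lemma sig_perm x (s : {perm 'I_3}) i : sig x (s i) 0 = x (s (i + 1)) 0 * x (s (i + 2)) 0.
Proof.
rewrite sig_prod (reindex_inj (@perm_inj _ s)) /=.
transitivity (sig (\col_i x (s i) 0) i 0); last by rewrite !mxE.
by rewrite sig_prod; apply: eq_big => [l|l _]; rewrite ?(inj_eq perm_inj) ?mxE.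
Qed.

Lemma sigK x : sig (sig x) = pi3 x *: x.
Proof.
apply/colP => i; rewrite !mxE /pi3.
by elim/ord3P: i; rewrite !ord3_add; ring.
Qed.

Lemma sigZ c x : sig (c *: x) = c ^+ 2 *: sig x.
Proof. by apply/colP => i; rewrite !mxE; ring. Qed.

Lemma parZl c x y : par x y -> par (c *: x) y.
Proof. by move=> xy i j; rewrite !mxE -!mulrA xy. Qed.

Lemma parC x y : par x y -> par y x.
Proof. by move=> xy i j; rewrite mulrC -xy mulrC. Qed.

Lemma parZr c x y : par x y -> par x (c *: y).
Proof. by move/parC/(parZl c)/parC. Qed.

Lemma par_refl x : par x x.
Proof. by move=> i j; rewrite mulrC. Qed.

Lemma par_mul M x y : par x y -> par (M *m x) (M *m y).
Proof.
move=> xy i j; rewrite !mxE !mulr_suml.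
rewrite (eq_bigr (fun a => \sum_b M i a * M j b * (x a 0 * y b 0))); last first.
  by move=> a _; rewrite mulr_sumr; apply: eq_bigr => b _; ring.
rewrite exchange_big; apply: eq_bigr => b _; rewrite mulr_sumr.
by apply: eq_bigr => a _; rewrite xy; ring.
Qed.

Lemma par_sig x y : par x y -> par (sig x) (sig y).
Proof. by move=> xy i j; rewrite !mxE mulrACA !(xy (i + _)) mulrACA. Qed.

Lemma fwdZ s c x : fwd s (c *: x) = c ^+ (2 ^ size s) *: fwd s x.
Proof.
elim: s c x => [|M s IHs] c x /=; first by rewrite expn0 expr1.
by rewrite -scalemxAr sigZ IHs -exprM expnS.
Qed.

Lemma bwdZ s c x : bwd s (c *: x) = c ^+ (2 ^ size s) *: bwd s x.
Proof.
elim: s => [|M s IHs] /=; first by rewrite expn0 expr1.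
by rewrite IHs sigZ -scalemxAr -exprM expnSr.
Qed.

Lemma fwd_cat s1 s2 x : fwd (s1 ++ s2) x = fwd s2 (fwd s1 x).
Proof. by rewrite /fwd foldl_cat. Qed.

Lemma bwd_cat s1 s2 x : bwd (s1 ++ s2) x = bwd s1 (bwd s2 x).
Proof. by rewrite /bwd foldr_cat. Qed.

End CommutativeRing.

Section Maps.

Variables (R S : comNzRingType) (f : {rmorphism R -> S}).

Lemma map_sig x : map_mx f (sig x) = sig (map_mx f x).
Proof. by apply/colP => i; rewrite !mxE rmorphM. Qed.

Lemma map_fwd s x : map_mx f (fwd s x) = fwd (map (map_mx f) s) (map_mx f x).
Proof. by elim: s x => //= M s IHs x; rewrite IHs map_sig map_mxM. Qed.

Lemma map_bwd s x : map_mx f (bwd s x) = bwd (map (map_mx f) s) (map_mx f x).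
Proof. by elim: s => //= M s IHs; rewrite map_mxM map_sig IHs. Qed.

End Maps.

Section Field.

Variable K : fieldType.
Implicit Types (x y : 'cV[K]_3) (M : 'M[K]_3).

Definition ei (i : 'I_3) : 'cV[K]_3 := delta_mx i 0.

Lemma eiE i j : ei i j 0 = (j == i)%:R.
Proof. by rewrite mxE eqxx andbT. Qed.

Lemma parP x y : x != 0 -> par x y -> exists c, y = c *: x.
Proof.
move=> x0 xy; have [i xi] : exists i, x i 0 != 0.
  apply/existsP; apply: contraNT x0; rewrite negb_exists => /forallP x0.
  by apply/eqP/colP => i; rewrite mxE; apply/eqP; rewrite -[_ == _]negbK x0.
exists (y i 0 / x i 0); apply/colP => j; rewrite mxE; apply: (mulfI xi).
by rewrite xy mulrA [x i 0 * _]mulrC mulfVK // mulrC.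
Qed.

Lemma mulmx_eq0 M x : M \in unitmx -> (M *m x == 0) = (x == 0).
Proof.
move=> uM; apply/eqP/eqP => [Mx0|->]; last by rewrite mulmx0.
by rewrite -(mulKmx uM x) Mx0 mulmx0.
Qed.

Lemma fwd_bwd s x : all (fun M => M \in unitmx) s ->
  exists c, fwd s (bwd (map invmx s) x) = c *: x.
Proof.
elim/last_ind: s x => [|s M IHs] x; first by exists 1; rewrite scale1r.
rewrite all_rcons => /andP[uM us].
rewrite map_rcons -!cats1 fwd_cat bwd_cat /=.
have [c ->] := IHs (invmx M *m sig x) us.
rewrite -scalemxAr mulKVmx // sigZ sigK scalerA.
by eexists.
Qed.

End Field.

(** * Generic points *)

Section Generic.

Variable K : closedFieldType.

(* Polynomial functions, recognized by their restrictions to polynomial curves; this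
   spares the comparison of multivariate polynomials. *)
Definition evmx m n (s : K) (c : 'M[{poly K}]_(m, n)) : 'M[K]_(m, n) :=
  map_mx (horner_eval s) c.

Definition pfun n (q : 'cV[K]_n -> K) :=
  forall c : 'cV[{poly K}]_n, exists p, forall s, q (evmx s c) = p.[s].

(** Truth on a nonempty principal open set; polynomial identities extend from there by
    [generic_eq0]. *)
Definition generic n (P : 'cV[K]_n -> Prop) :=
  exists2 q, pfun q & (exists x, q x != 0) /\ forall x, q x != 0 -> P x.

Lemma poly_nonroot (p : {poly K}) : p != 0 -> exists s, p.[s] != 0.
Proof. by move=> /closed_nonrootP[s ps]; exists s; rewrite -rootE. Qed.

Lemma poly_fun0 (p : {poly K}) : (forall s, p.[s] = 0) -> p = 0.
Proof.
move=> p0; apply/eqP; apply: contraTT isT => /poly_nonroot[s].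
by rewrite p0 eqxx.
Qed.

Definition line n (x v : 'cV[K]_n) : 'cV[{poly K}]_n :=
  map_mx polyC x + 'X *: map_mx polyC v.

Lemma evmx_line n s (x v : 'cV[K]_n) : evmx s (line x v) = x + s *: v.
Proof. by apply/colP => i; rewrite !mxE /horner_eval !hornerE. Qed.

Lemma evmx_polyC m n s (A : 'M[K]_(m, n)) : evmx s (map_mx polyC A) = A.
Proof. by apply/matrixP => i j; rewrite !mxE /horner_eval hornerC. Qed.

Lemma evmx_mul m n p s (A : 'M_(m, n)) (B : 'M_(n, p)) :
  evmx s (A *m B) = evmx s A *m evmx s B.
Proof. exact: map_mxM. Qed.

Lemma evmx_sig s x : evmx s (sig x) = sig (evmx s x).
Proof. exact: map_sig. Qed.

Lemma evmx_fwd s l x :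
  evmx s (fwd (map (map_mx polyC) l) x) = fwd l (evmx s x).
Proof.
rewrite /evmx map_fwd -map_comp; congr fwd.
rewrite -[RHS]map_id; apply: eq_map => M; exact: evmx_polyC.
Qed.

Lemma evmx_bwd s l x :
  evmx s (bwd (map (map_mx polyC) l) x) = bwd l (evmx s x).
Proof.
rewrite /evmx map_bwd -map_comp; congr bwd.
rewrite -[RHS]map_id; apply: eq_map => M; exact: evmx_polyC.
Qed.

Lemma pfun_coord n i : pfun (fun x : 'cV_n => x i 0).
Proof. by move=> c; exists (c i 0) => s; rewrite !mxE. Qed.

Lemma pfun_const n a : pfun (fun _ : 'cV_n => a).
Proof. by move=> c; exists a%:P => s; rewrite hornerC. Qed.

Lemma pfunD n (q r : 'cV_n -> K) : pfun q -> pfun r -> pfun (fun x => q x + r x).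
Proof.
by move=> hq hr c; have [p pE] := hq c; have [p' p'E] := hr c; exists (p + p') => s;
   rewrite hornerD pE p'E.
Qed.

Lemma pfunM n (q r : 'cV_n -> K) : pfun q -> pfun r -> pfun (fun x => q x * r x).
Proof.
by move=> hq hr c; have [p pE] := hq c; have [p' p'E] := hr c; exists (p * p') => s;
   rewrite hornerM pE p'E.
Qed.

Lemma pfunB n (q r : 'cV_n -> K) : pfun q -> pfun r -> pfun (fun x => q x - r x).
Proof.
by move=> hq hr c; have [p pE] := hq c; have [p' p'E] := hr c; exists (p - p') => s;
   rewrite hornerD hornerN pE p'E.
Qed.

Definition pmap n m (f : 'cV[K]_n -> 'cV[K]_m) := forall i, pfun (fun x => f x i 0).

Lemma pfun_comp n m (f : 'cV_n -> 'cV_m) q : pmap f -> pfun q -> pfun (q \o f).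
Proof.
move=> hf hq c.
have /boolp.choice[p pE] : forall i, exists p, forall s, f (evmx s c) i 0 = p.[s].
  by move=> i; apply: hf.
have [r rE] := hq (\col_i p i); exists r => s; rewrite -rE /=; congr q.
by apply/colP => i; rewrite !mxE pE.
Qed.

Lemma pmap_comp n m k (f : 'cV_n -> 'cV_m) (g : 'cV_m -> 'cV_k) :
  pmap f -> pmap g -> pmap (g \o f).
Proof. by move=> hf hg i; apply: (pfun_comp hf (hg i)). Qed.

Lemma pmap_mul n m (M : 'M[K]_(m, n)) : pmap (fun x => M *m x).
Proof.
move=> i c; exists ((map_mx polyC M *m c) i 0) => s.
by rewrite -[M in LHS](evmx_polyC s) -evmx_mul mxE.
Qed.

Lemma pmap_sig : pmap (@sig K).
Proof. by move=> i c; exists (sig c i 0) => s; rewrite -evmx_sig mxE. Qed.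

Lemma pmap_fwd l : pmap (fwd l).
Proof. by move=> i c; eexists => s; rewrite -evmx_fwd mxE; reflexivity. Qed.

Lemma pmap_bwd l : pmap (bwd l).
Proof. by move=> i c; eexists => s; rewrite -evmx_bwd mxE; reflexivity. Qed.

Lemma generic_line n (P : 'cV_n -> Prop) x : generic P ->
  exists v, exists2 p : {poly K}, p != 0 & forall s, p.[s] != 0 -> P (x + s *: v).
Proof.
case=> q hq [[y qy] qP]; exists (y - x); have [p pE] := hq (line x (y - x)).
exists p.
  apply: contraNneq qy => p0.
  by rewrite (_ : y = evmx 1 (line x (y - x))) ?pE ?p0 ?horner0 // evmx_line scale1r subrKC.
by move=> s; rewrite -pE evmx_line => /qP.
Qed.

(** On the line joining a point where [q] is nonzero to one where [r] is nonzero, both restrict to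
    nonzero polynomials in one variable. *)
Lemma genericI n (P Q : 'cV_n -> Prop) :
  generic P -> generic Q -> generic (fun x => P x /\ Q x).
Proof.
move=> gP [r hr [[y ry] rQ]]; case: (gP) => q hq [[x qx] qP].
exists (fun z => q z * r z); first exact: pfunM.
split; last by move=> z; rewrite mulf_eq0 negb_or => /andP[/qP Pz /rQ].
have [p pE] := hq (line x (y - x)); have [p' p'E] := hr (line x (y - x)).
have p_neq0 : p != 0.
  apply: contraNneq qx => p0.
  by rewrite (_ : x = evmx 0 (line x (y - x))) ?pE ?p0 ?horner0 // evmx_line scale0r addr0.
have p'_neq0 : p' != 0.
  apply: contraNneq ry => p0.
  by rewrite (_ : y = evmx 1 (line x (y - x))) ?p'E ?p0 ?horner0 // evmx_line scale1r subrKC.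
have /poly_nonroot[s] : p * p' != 0 by rewrite mulf_neq0.
by rewrite hornerM -pE -p'E => qrs; exists (evmx s (line x (y - x))).
Qed.

Lemma genericW n (P Q : 'cV_n -> Prop) : (forall x, P x -> Q x) -> generic P -> generic Q.
Proof. by move=> PQ [q hq [xq qP]]; exists q => //; split=> // x /qP/PQ. Qed.

Lemma genericT n (P : 'cV_n -> Prop) : (forall x, P x) -> generic P.
Proof.
move=> allP; exists (fun=> 1); first exact: pfun_const.
by split=> //; exists 0; rewrite oner_eq0.
Qed.

Lemma generic_ex n (P : 'cV_n -> Prop) : generic P -> exists x, P x.
Proof. by case=> q _ [[x /[swap] qP /qP Px]]; exists x. Qed.

Lemma generic_pfun n (q : 'cV_n -> K) : pfun q -> (exists x, q x != 0) ->
  generic (fun x => q x != 0).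
Proof. by move=> hq xq; exists q. Qed.

Lemma generic_eq0 n (q : 'cV_n -> K) : pfun q -> generic (fun x => q x = 0) ->
  forall x, q x = 0.
Proof.
move=> hq gq x; have [//|qx] := eqVneq (q x) 0.
have gq' := generic_pfun hq (ex_intro _ x qx).
by have [y [-> /eqP]] := generic_ex (genericI gq gq').
Qed.

Lemma generic_par n (f g : 'cV_n -> 'cV_3) : pmap f -> pmap g ->
  generic (fun x => par (f x) (g x)) -> forall x, par (f x) (g x).
Proof.
move=> hf hg gfg x i j; apply/eqP; rewrite -subr_eq0; apply/eqP.
move: x; apply: generic_eq0; first by apply/pfunB; apply/pfunM.
by apply: genericW gfg => x /(_ i j) ->; rewrite subrr.
Qed.

Lemma generic_mul n (M : 'M[K]_n) (P : 'cV_n -> Prop) :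
  M \in unitmx -> generic P -> generic (fun x => P (M *m x)).
Proof.
move=> uM [q hq [[y qy] qP]]; exists (fun x => q (M *m x)).
  exact: (pfun_comp (pmap_mul M) hq).
by split=> [|x /qP//]; exists (invmx M *m y); rewrite mulKVmx.
Qed.

Lemma generic_coord i : generic (fun x : 'cV[K]_3 => x i 0 != 0).
Proof.
by apply: generic_pfun; [apply: pfun_coord|exists (const_mx 1); rewrite mxE oner_eq0].
Qed.

Lemma generic_pi3 : generic (fun x : 'cV[K]_3 => pi3 x != 0).
Proof.
apply: generic_pfun; first by do 2?apply: pfunM; apply: pfun_coord.
by exists (const_mx 1); rewrite /pi3 !mxE !mulf_neq0 ?oner_eq0.
Qed.

Lemma sqrt_ex (a : K) : exists b, b ^+ 2 = a.
Proof.
have [b] := @solve_monicpoly K 2%N (fun i => if i == 0%N then a else 0) isT.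
by rewrite !big_ord_recl big_ord0 /= mul0r !addr0 expr0 mulr1; exists b.
Qed.

(** Since [sig (b *: sig z) = (b ^+ 2 * pi3 z) *: z], every [z] off the coordinate triangle is a
    value of [sig], once a square root has normalized the scalar. *)
Lemma generic_sig (P : 'cV[K]_3 -> Prop) : generic P -> generic (fun x => P (sig x)).
Proof.
case=> q hq [xq qP]; have [z [qz pz]] := generic_ex (genericI (generic_pfun hq xq) generic_pi3).
exists (fun x => q (sig x)); first exact: (pfun_comp pmap_sig hq).
split=> [|x /qP//]; have [b b2] := sqrt_ex (pi3 z)^-1.
by exists (b *: sig z); rewrite sigZ sigK b2 scalerA mulVf // scale1r.
Qed.

Lemma generic_neq0 : generic (fun x : 'cV[K]_3 => x != 0).
Proof.
by apply: genericW (generic_coord 0) => x; apply: contraNneq => ->; rewrite mxE.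
Qed.

End Generic.

Arguments generic_pi3 {K}.

(** * Words in linear maps and the quadratic map *)

Section WordRelation.

Variable K : closedFieldType.
Implicit Types (x y z : 'cV[K]_3) (M X : 'M[K]_3) (l ys : seq 'M[K]_3).

Notation unitall := (all (fun M : 'M[K]_3 => M \in unitmx)).

(** As [par] holds with the zero vector, this is a system of polynomial equations, valid also at the
    base points of the word. *)
Definition rel_word l := forall x, par (fwd l x) x.

Lemma generic_fwd_bwd l : unitall l ->
  generic (fun x => exists2 c, c != 0 & fwd l (bwd (map invmx l) x) = c *: x).
Proof.
elim/last_ind: l => [|l M IHl].
  by move=> _; apply: genericT => x; exists 1; rewrite ?oner_eq0 ?scale1r.
rewrite all_rcons => /andP[uM ul].
have uM' : invmx M \in unitmx by rewrite unitmx_inv.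
have := genericI (generic_sig (generic_mul uM' (IHl ul))) generic_pi3.
apply: genericW => x [[c c0 cE] px]; exists (c ^+ 2 * pi3 x).
  by rewrite mulf_neq0 ?expf_neq0.
rewrite map_rcons -!cats1 fwd_cat bwd_cat /= cE.
by rewrite -scalemxAr mulKVmx // sigZ sigK scalerA.
Qed.

(** At [bwd (map invmx l1) x] the letters of [l1] cancel up to a scalar that is nonzero for generic
    [x]; [generic_par] then reaches all [x]. *)
Lemma rel_half l1 l2 : unitall l1 -> rel_word (l1 ++ l2) ->
  forall x, par (fwd l2 x) (bwd (map invmx l1) x).
Proof.
move=> ul1 rel; apply: generic_par; [exact: pmap_fwd|exact: pmap_bwd|].
apply: genericW (generic_fwd_bwd ul1) => x [c c0 cE].
have := rel (bwd (map invmx l1) x); rewrite fwd_cat cE fwdZ.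
move=> /(parZl (c ^+ (2 ^ size l2))^-1).
by rewrite scalerA mulVf ?scale1r // expf_neq0.
Qed.

(** The curve [u] has degree at most [n], and [x] is its coefficient of degree [n], that is, its
    point at infinity. As [x] may vanish, the degree may be smaller. *)
Definition topd n (u : 'cV[{poly K}]_3) x :=
  forall i, (size (u i 0%R) <= n.+1)%N /\ (u i 0)`_n = x i 0.

Lemma topdM m n (p q : {poly K}) : (size p <= m.+1)%N -> (size q <= n.+1)%N ->
  (size (p * q)%R <= (m + n).+1)%N /\ (p * q)`_(m + n) = p`_m * q`_n.
Proof.
move=> sp sq; split.
  by apply: leq_trans (size_polyMleq _ _) _; rewrite -subn1 leq_subLR; lia.
have lt_m : (m < (m + n).+1)%N by lia.
rewrite coefM (bigD1 (Ordinal lt_m)) //= addKn big1 ?addr0 // => i ne_im.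
have [lt_im|le_mi] := ltnP m i; first by rewrite [p`_i]nth_default ?mul0r //; apply: leq_trans sp _.
rewrite [q`_(_ - _)]nth_default ?mulr0 //.
have lt_im : (i < m)%N.
  by rewrite ltn_neqAle le_mi andbT; apply: contraNneq ne_im => im; apply/eqP/val_inj.
by apply: leq_trans sq _; rewrite ltn_subRL ltn_add2r.
Qed.

Lemma topd_sig n u x : topd n u x -> topd (n + n) (sig u) (sig x).
Proof.
move=> top i; rewrite !mxE; have [s1 c1] := top (i + 1); have [s2 c2] := top (i + 2).
by rewrite -c1 -c2; apply: topdM.
Qed.

Lemma topd_mul n u x M : topd n u x -> topd n (map_mx polyC M *m u) (M *m x).
Proof.
move=> top i; rewrite !mxE; split.
  apply: leq_trans (size_sum _ _ _) _; apply/bigmax_leqP => j _.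
  rewrite !mxE mul_polyC; apply: leq_trans (size_scale_leq _ _) _.
  by case: (top j).
rewrite coef_sum; apply: eq_bigr => j _.
by rewrite !mxE coefCM; case: (top j) => _ ->.
Qed.

Lemma topd_fwd n l u x : topd n u x ->
  topd (n * 2 ^ size l) (fwd (map (map_mx polyC) l) u) (fwd l x).
Proof.
elim: l n u x => [|M l IHl] n u x top /=; first by rewrite expn0 muln1.
rewrite expnS mulnA muln2 -addnn.
exact/IHl/topd_sig/topd_mul.
Qed.

Lemma topd_bwd n l u x : topd n u x ->
  topd (n * 2 ^ size l) (bwd (map (map_mx polyC) l) u) (bwd l x).
Proof.
elim: l => [|M l IHl] top /=; first by rewrite expn0 muln1.
rewrite expnS mulnCA mul2n -addnn.
exact/topd_mul/topd_sig/IHl.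
Qed.

Lemma topd_line x v : topd 1 (line x v) v.
Proof.
move=> i; rewrite !mxE; split; last first.
  by rewrite coefD coefXM coefC /= coefC eqxx add0r.
rewrite (leq_trans (size_polyD _ _)) // geq_max.
rewrite (leq_trans (size_polyC_leq1 _)) //=.
by rewrite (leq_trans (size_polyMleq _ _)) // size_polyX size_polyC; case: (_ != 0).
Qed.

Lemma dvdp_par (a b : {poly K}) (u v : 'I_3 -> {poly K}) : a != 0 ->
  (forall s, root a s -> exists j, ~~ root (u j) s) -> (forall j, a * v j = u j * b) -> a %| b.
Proof.
have [n] := ubnP (size a); elim: n => // n IHn in a b *; rewrite ltnS => sa a0 au uv.
have [sa1|/closed_rootP[s as0]] := boolP (size a == 1%N).
  by have /size_poly1P[e e0 ->] := sa1; rewrite -[e%:P]mulr1 mul_polyC dvdpZl ?dvd1p.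
have [j uj] := au s as0; have bs : root b s.
  by have := rootM (u j) b s; rewrite -uv rootM as0 (negPf uj).
have /factor_theorem[a' aE] := as0; have /factor_theorem[b' bE] := bs.
have X0 : 'X - s%:P != 0 by rewrite polyXsubC_eq0.
have a'0 : a' != 0 by apply: contraNneq a0 => a'0; rewrite aE a'0 mul0r.
rewrite aE bE dvdp_mul //; apply: IHn => //.
- by apply: leq_trans sa; rewrite aE size_mul // size_XsubC addn2.
- by move=> r ar; apply: au; rewrite aE rootM ar.
by move=> i; apply: (mulIf X0); rewrite -[LHS]mulrAC -aE uv bE mulrA.
Qed.

(** The coordinates of [u] have no common root, so each root of [u i 0] is a root of [v i 0];
    [dvdp_par] removes them one at a time. *)
Lemma par_nowhere0 (u v : 'cV[{poly K}]_3) : (forall s, evmx s u != 0) -> par u v ->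
  exists c, v = c *: u.
Proof.
move=> u_neq0 uv; have [i ui] : exists i, u i 0 != 0.
  apply: neq0_coord; apply: contraNneq (u_neq0 0) => ->.
  by apply/eqP/colP => i; rewrite !mxE /horner_eval horner0.
have /dvdpP[c cE] : u i 0 %| v i 0.
  apply: (@dvdp_par _ _ (fun j => u j 0) (fun j => v j 0)) => // s _.
  by have /neq0_coord[j] := u_neq0 s; rewrite mxE => uj; exists j.
exists c; apply/colP => j; rewrite mxE; apply: (mulfI ui).
by rewrite uv cE; ring.
Qed.

Definition cross (x y : 'cV[K]_3) : 'rV[K]_3 :=
  \row_i (x (i + 1) 0 * y (i + 2) 0 - x (i + 2) 0 * y (i + 1) 0).

Lemma cross_mul x y z : (cross x y *m z) 0 0 =
  \sum_i (x (i + 1) 0 * y (i + 2) 0 - x (i + 2) 0 * y (i + 1) 0) * z i 0.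
Proof. by rewrite mxE; apply: eq_bigr => i _; rewrite mxE. Qed.

Lemma cross_l x y : (cross x y *m x) 0 0 = 0.
Proof. by rewrite cross_mul big_ord3 /= !ord3_add; ring. Qed.

Lemma cross_r x y : (cross x y *m y) 0 0 = 0.
Proof. by rewrite cross_mul big_ord3 /= !ord3_add; ring. Qed.

Lemma cross_eq0 x y : cross x y = 0 -> par x y.
Proof.
move=> /rowP c0; have e i : x (i + 1) 0 * y (i + 2) 0 = x (i + 2) 0 * y (i + 1) 0.
  by have := c0 i; rewrite !mxE => /eqP; rewrite subr_eq0 => /eqP.
have := (e 0, e 1, e 2); rewrite !ord3_add => -[[e0 e1] e2].
by elim/ord3P; elim/ord3P => //; rewrite ?e0 ?e1 ?e2 //; symmetry.
Qed.

Lemma generic_npar z : z != 0 -> generic (fun x => ~ par x z).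
Proof.
case/neq0_coord => j zj.
suff: generic (fun x : 'cV[K]_3 => x (j + 1) 0 * z j 0 - x j 0 * z (j + 1) 0 != 0).
  apply: genericW => x nz /(_ (j + 1) j) E.
  by rewrite E subrr eqxx in nz.
apply: generic_pfun.
  by apply/pfunB; apply/pfunM; [apply: pfun_coord|apply: pfun_const
       |apply: pfun_coord|apply: pfun_const].
exists (ei K (j + 1)); rewrite !eiE eqxx mul1r.
suff /negPf-> : j != j + 1 by rewrite mul0r subr0.
by elim/ord3P: (j).
Qed.

Lemma generic_all (T : eqType) (s : seq T) n (P : T -> 'cV[K]_n -> Prop) :
  (forall a, a \in s -> generic (P a)) -> generic (fun w : 'cV_n => forall a, a \in s -> P a w).
Proof.
elim: s => [|a s IHs] gP; first exact: genericT.
have gs : generic (fun w : 'cV_n => forall b, b \in s -> P b w).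
  by apply: IHs => b bs; apply: gP; rewrite inE bs orbT.
apply: genericW (genericI (gP a (mem_head _ _)) gs) => w [Pa Ps] b.
by rewrite inE => /orP[/eqP->|/Ps].
Qed.

Lemma generic_cross x y : ~ par x y -> generic (fun p => (cross x y *m p) 0 0 != 0).
Proof.
move=> nxy; apply: generic_pfun; first exact: (pmap_mul (cross x y)).
have [i ci] : exists i, cross x y 0 i != 0.
  apply: boolp.contrapT => nc; apply: nxy; apply: cross_eq0; apply/rowP => i.
  rewrite [RHS]mxE; apply/eqP/negPn/negP => ci; by apply: nc; exists i.
by exists (ei K i); rewrite -colE mxE.
Qed.

(** Finitely many zeros in the plane: the three coordinates do not vanish together along a curve. *)
Definition few_zeros (f : 'cV[K]_3 -> 'cV[K]_3) := exists2 zs : seq 'cV[K]_3,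
  (forall z, z \in zs -> z != 0) &
  forall x, f x = 0 -> x != 0 -> exists2 z, z \in zs & par x z.

(* On a line that avoids the zeros of [bwd ys], the two polynomial vectors differ by a
   polynomial factor, which is constant as both have the same degree. *)
Lemma par_word_scalar l ys : size l = size ys ->
  (forall x, par (fwd l x) (bwd ys x)) -> few_zeros (bwd ys) ->
  exists c, forall x, fwd l x = c *: bwd ys x.
Proof.
move=> szl parlb [zs zs0 zsP]; set N := (2 ^ size l)%N.
have gq : generic (fun q => forall z, z \in zs -> ~ par q z).
  by apply: generic_all => z /zs0/generic_npar.
have [q [qz q0]] := generic_ex (genericI gq (generic_neq0 K)).
have [i qi] : exists i, bwd ys q i 0 != 0.
  by apply: neq0_coord; apply/eqP => /zsP/(_ q0)[z /qz].
(* [q] is the point at infinity of every line [p + s q]. The constant found on such a line is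
   therefore this ratio at [q], whatever [p] is. *)
exists (fwd l q i 0 / bwd ys q i 0) => x; apply/colP => j.
apply/eqP; rewrite -subr_eq0; apply/eqP; move: x.
apply: generic_eq0.
  apply: pfunB; first exact: pmap_fwd.
  have -> : (fun x : 'cV[K]_3 => (fwd l q i 0 / bwd ys q i 0 *: bwd ys x) j 0) =
    (fun x => fwd l q i 0 / bwd ys q i 0 * bwd ys x j 0).
    by apply: boolp.funext => x; rewrite mxE.
  by apply: pfunM; [apply: pfun_const|apply: pmap_bwd].
(* For these [p], the line through [p] and [q] contains none of the zeros [zs]. *)
have : generic (fun p => forall z, z \in zs -> (cross q z *m p) 0 0 != 0).
  by apply: generic_all => z zin; apply: generic_cross; apply: qz.
move/(genericI (generic_npar q0)); apply: genericW => p [npq pP].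
apply/eqP; rewrite subr_eq0; apply/eqP.
have p0 s : p + s *: q != 0.
  apply/eqP => pq; apply: npq => a b.
  have -> : p = - (s *: q) by apply/eqP; rewrite -addr_eq0 pq.
  by rewrite !mxE; ring.
pose u := bwd (map (map_mx polyC) ys) (line p q).
pose v := fwd (map (map_mx polyC) l) (line p q).
have u0 s : evmx s u != 0.
  rewrite evmx_bwd evmx_line; apply/eqP => /zsP/(_ (p0 s))[z zin pz].
  have /negP[] := pP z zin.
  have [c zE] := parP (p0 s) pz.
  have : (cross q z *m (c *: (p + s *: q))) 0 0 = 0 by rewrite -zE cross_r.
  have mxE1 (A : 'M[K]_1) a : (a *: A) 0 0 = a * A 0 0 by rewrite mxE.
  rewrite -scalemxAr mulmxDr -scalemxAr mxE1 mxE mxE1 cross_l mulr0 addr0.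
  move/eqP; rewrite mulf_eq0 => /orP[|//].
  by move=> /eqP c0; have := zs0 z zin; rewrite zE c0 scale0r eqxx.
have uv : par u v.
  move=> a b; apply/eqP; rewrite -subr_eq0; apply/eqP/poly_fun0 => s.
  have E : (v b 0).[s] * (u a 0).[s] = (v a 0).[s] * (u b 0).[s].
    by have := parlb (p + s *: q) b a; rewrite -evmx_line -evmx_fwd -evmx_bwd !mxE.
  by rewrite hornerD hornerN !hornerM [X in X - _]mulrC E mulrC subrr.
have [c vE] := par_nowhere0 u0 uv.
have topu := topd_bwd ys (topd_line p q).
have topv := topd_fwd l (topd_line p q).
rewrite -szl -/N mul1n -/u in topu; rewrite -/N mul1n -/v in topv.
have size_c : (size c <= 1)%N.
  have [su cu] := topu i; have [sv cv] := topv i.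
  have [->|c0] := eqVneq c 0; first by rewrite size_poly0.
  have ui0 : u i 0 != 0 by apply: contraNneq qi => ui; rewrite -cu ui coef0.
  have sizeu : size (u i 0) = N.+1.
    apply/eqP; rewrite eqn_leq su ltnNge; apply: contra qi => su'.
    by rewrite -cu nth_default.
  by move: sv; rewrite vE mxE size_mul // sizeu addnS /= -[N.+1]add1n leq_add2r.
have [a cE] : exists a, c = a%:P by exists c`_0; apply: size1_polyC.
have aE : fwd l q i 0 = a * bwd ys q i 0.
  by have [_ <-] := topv i; have [_ <-] := topu i; rewrite vE cE mxE coefCM.
rewrite aE mulfK //.
have -> : p = evmx 0 (line p q) by rewrite evmx_line scale0r addr0.
by rewrite -evmx_fwd -evmx_bwd -/u -/v vE cE !mxE /horner_eval hornerM hornerC.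
Qed.

End WordRelation.

(** * The letter after the cut of a relation *)

Section MonomialFactor.

Variable K : closedFieldType.
Implicit Types (x y z : 'cV[K]_3) (M X : 'M[K]_3) (l ys : seq 'M[K]_3).

Notation unitall := (all (fun M : 'M[K]_3 => M \in unitmx)).

Lemma sig_eq0_coord x i : x i 0 = 0 -> sig x = (x (i + 1) 0 * x (i + 2) 0) *: ei K i.
Proof.
move=> xi; apply/colP => j; rewrite !mxE eqxx andbT.
move: xi; elim/ord3P: i; elim/ord3P: j; rewrite !ord3_add /= => xi;
  by rewrite ?xi ?mul0r ?mulr0 ?mulr1.
Qed.

(** [sig] contracts the line [x_i = 0] to [e_i]. If the word vanished at a point of this line where
    [sig] does not, it would vanish along the whole line. *)
Lemma bwd_few_coord M ys : few_zeros (bwd (rcons ys M)) ->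
  forall x i, x i 0 = 0 -> sig x != 0 -> bwd (rcons ys M) x != 0.
Proof.
move=> [zs zs0 zsP] x i xi sx; apply/eqP => bx.
have bei : bwd ys (M *m ei K i) = 0.
  move: bx; rewrite -cats1 bwd_cat /= (sig_eq0_coord xi) -scalemxAr bwdZ.
  move/eqP; rewrite scaler_eq0 => /orP[|/eqP//].
  rewrite expf_eq0 expn_gt0 /= => /eqP c0.
  by move: sx; rewrite (sig_eq0_coord xi) c0 scale0r eqxx.
pose w t : 'cV[K]_3 := ei K (i + 1) + t *: ei K (i + 2).
have wi t : w t i 0 = 0.
  by rewrite !mxE eqxx !andbT; elim/ord3P: (i); rewrite !ord3_add /= mulr0 addr0.
have wi1 t : w t (i + 1) 0 = 1.
  by rewrite !mxE eqxx !andbT; elim/ord3P: (i); rewrite !ord3_add /= mulr0 addr0.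
have wi2 t : w t (i + 2) 0 = t.
  by rewrite !mxE eqxx !andbT; elim/ord3P: (i); rewrite !ord3_add /= mulr1 add0r.
have bw t : bwd (rcons ys M) (w t) = 0.
  by rewrite -cats1 bwd_cat /= (sig_eq0_coord (wi t)) -scalemxAr bwdZ bei scaler0.
have w0 t : w t != 0.
  by apply/eqP => wt; have := wi1 t; rewrite wt mxE => /eqP; rewrite eq_sym oner_eq0.
(* Choose [t] such that [w t] is proportional to none of the [zs]; a zero whose coordinate [i + 1]
   vanishes only adds the harmless root [0]. *)
have [|t] := @poly_nonroot _ (\prod_(z <- zs) ('X - (z (i + 2) 0 / z (i + 1) 0)%:P)).
  by rewrite prodf_seq_neq0; apply/allP => z _ /=; rewrite polyXsubC_eq0.
have [z zin wz] := zsP _ (bw t) (w0 t).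
have [c zE] := parP (w0 t) wz.
have z1 : z (i + 1) 0 = c by rewrite zE mxE wi1 mulr1.
have z2 : z (i + 2) 0 = c * t by rewrite zE mxE wi2.
have c0 : c != 0 by apply: contraNneq (zs0 z zin) => c0; rewrite zE c0 scale0r.
rewrite horner_prod prodf_seq_neq0 => /allP/(_ _ zin) /=.
by rewrite hornerXsubC z1 z2 [c * t]mulrC mulfK // subrr eqxx.
Qed.

Lemma fwd_inj s M x y c : unitall (rcons s M) -> c != 0 ->
  fwd s (bwd (map invmx s) (M *m x)) = c *: (M *m x) ->
  bwd (map invmx s) (M *m x) = bwd (map invmx s) (M *m y) -> x != 0 -> y != 0 -> par x y.
Proof.
rewrite all_rcons => /andP[uM us] c0 cE xy x0 y0.
have [d dE] := fwd_bwd (M *m y) us.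
have : c *: x = d *: y.
  by apply: (can_inj (mulKmx uM)); rewrite -!scalemxAr -cE -dE xy.
move=> E; have := parZr c^-1 (parZr d (par_refl y)).
by rewrite -E scalerA mulVf // scale1r => /parC.
Qed.

Lemma sig_ei j : sig (ei K j) = 0.
Proof.
by apply/colP => a; rewrite !mxE eqxx !andbT; elim/ord3P: a; elim/ord3P: j;
   rewrite !ord3_add /= ?mul0r ?mulr0.
Qed.

Lemma fwd0 l : fwd l (0 : 'cV[K]_3) = 0.
Proof. by have := fwdZ l 0 0; rewrite scale0r expr0n expn_eq0 /= scale0r. Qed.

Lemma evmx_pi3 s (u : 'cV[{poly K}]_3) : (pi3 u).[s] = pi3 (evmx s u).
Proof. by rewrite /pi3 !hornerM !mxE. Qed.

(* The first half of the word vanishes at [y = X^-1 e_i], hence so does the other half.  This is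
   impossible if exactly one coordinate of [y] vanishes; if none does, the inverse word, restricted
   to a line through [sig y], is divisible by a power as large as its degree, so is constant. *)
Lemma sig_inv_eq0 s Xm X l : unitall (rcons s Xm) -> unitall (X :: l) ->
  size l = size s -> rel_word (rcons s Xm ++ X :: l) ->
  few_zeros (bwd (map invmx (rcons s Xm))) ->
  forall i, sig (invmx X *m ei K i) = 0.
Proof.
move=> us uXl szl rel few i; apply/eqP; rewrite -[_ == _]negbK; apply/negP => sy.
set y := _ *m _ in sy; set ys := map invmx (rcons s Xm).
have parlb x : par (fwd (X :: l) x) (bwd ys x) by apply: rel_half.
have [|c cE] := par_word_scalar _ parlb few; first by rewrite /= size_map size_rcons szl.
have c0 : c != 0.
  apply/eqP => c0.
  have [x [[d d0 dE] /eqP x0]] := generic_ex (genericI (generic_fwd_bwd uXl) (generic_neq0 K)).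
  case: x0; apply/eqP; rewrite -[_ == _]orFb -(negPf d0) -scaler_eq0.
  by rewrite -dE cE c0 scale0r.
have uX : X \in unitmx by case/andP: uXl.
have XyE : X *m y = ei K i by rewrite /y mulKVmx.
have fy : fwd (X :: l) y = 0 by rewrite /= XyE sig_ei fwd0.
have ysE : ys = rcons (map invmx s) (invmx Xm) by rewrite /ys map_rcons.
have [[j yj]|yfull] := boolp.pselect (exists j, y j 0 = 0).
  have /negP[] : bwd ys y != 0 by rewrite ysE (bwd_few_coord _ yj) // -ysE.
  by rewrite -[_ == _]orFb -(negPf c0) -scaler_eq0 -cE fy.
have piy : pi3 y != 0.
  by rewrite !mulf_neq0 //; apply/eqP => yj; apply: yfull; eexists; apply: yj.
pose z := sig y.
have z0 : z != 0.
  apply: contraNneq piy => z0; have : pi3 z = pi3 y ^+ 2 by rewrite /pi3 !mxE /= !ord3_add; ring.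
  by rewrite z0 /pi3 !mxE !mul0r => /esym/eqP; rewrite expf_eq0.
have sz : sig z = pi3 y *: y by rewrite /z sigK.
pose k x := bwd (map invmx s) (invmx Xm *m x); pose N := (2 ^ size s)%N.
(* At parameter [0] of the line [L], [X *m sig L] is a multiple of [e_i]. Hence [sig] of it is
   divisible by ['X], and one side of the relation by ['X^N]. On the other side [pi3 L] is prime to
   ['X], so ['X^N] divides [kL], whose degree is at most [N]. A multiple of ['X^N] by a constant has
   its top coefficient [k d] as its value at [1], which is [k (z + d)]. *)
have kz d : k (z + d) = k d.
  pose L := line z d; pose P := @map_mx _ _ (@polyC K) 3 3.
  have sigXL : exists u, sig (P X *m sig L) = 'X *: u.
    have /boolp.choice[u uE] : forall a, exists u, sig (P X *m sig L) a 0 = 'X * u.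
      move=> a; suff /factor_theorem[u uE] : root (sig (P X *m sig L) a 0) 0.
        by exists u; rewrite uE subr0 mulrC.
      have : evmx 0 (sig (P X *m sig L)) = 0.
        rewrite evmx_sig evmx_mul evmx_polyC evmx_sig /L evmx_line scale0r addr0 sz.
        by rewrite -scalemxAr XyE sigZ sig_ei scaler0.
      by move=> /colP/(_ a); rewrite !mxE => E; apply/eqP.
    by exists (\col_a u a); apply/colP => a; rewrite uE !mxE.
  have [u uE] := sigXL.
  have fE : fwd (map P (X :: l)) (sig L) = 'X^N *: fwd (map P l) u.
    by rewrite /= uE fwdZ size_map szl.
  have top : topd N (bwd (map P (map invmx s)) (P (invmx Xm) *m L)) (k d).
    have := topd_bwd (map invmx s) (topd_mul (invmx Xm) (topd_line z d)).
    by rewrite mul1n size_map.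
  set kL := bwd _ _ in top.
  have bE : bwd (map P ys) (sig L) = pi3 L ^+ N *: kL.
    rewrite ysE map_rcons -cats1 bwd_cat /= sigK -scalemxAr bwdZ.
    by rewrite !size_map.
  have eqL : fwd (map P (X :: l)) (sig L) = c%:P *: bwd (map P ys) (sig L).
    apply/colP => a; apply/eqP; rewrite -subr_eq0; apply/eqP/poly_fun0 => t.
    have := cE (evmx t (sig L)); rewrite -evmx_fwd -evmx_bwd => /colP/(_ a).
    rewrite [LHS]mxE /horner_eval => E; rewrite hornerD hornerN [X in X - _]E.
    by rewrite !mxE hornerM hornerC subrr.
  have kLX a : exists b, kL a 0 = b%:P * 'X^N.
    have : 'X^N %| c%:P * (pi3 L ^+ N * kL a 0).
      have /colP/(_ a) := eqL; rewrite fE bE !mxE => <-.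
      by rewrite dvdp_mulr.
    rewrite mul_polyC dvdpZr // Gauss_dvdpr; last first.
      rewrite coprimep_expl // coprimep_expr // coprimep_sym.
      rewrite -['X]subr0 coprimep_XsubC rootE evmx_pi3 /L evmx_line scale0r addr0.
      have -> : pi3 z = pi3 y ^+ 2 by rewrite /pi3 !mxE /= !ord3_add; ring.
      by rewrite expf_neq0.
    case/dvdpP => b bE'; have [sk _] := top a.
    suff /size1_polyC bC : (size b <= 1)%N by rewrite bC in bE'; exists b`_0.
    have [->|b0] := eqVneq b 0; first by rewrite size_poly0.
    move: sk; rewrite bE' size_mul ?expf_neq0 ?polyX_eq0 // size_polyXn addnS /=.
    by rewrite -[N.+1]add1n leq_add2r.
  have -> : z + d = evmx 1 L by rewrite /L evmx_line scale1r.
  rewrite /k -{1}(evmx_polyC 1 (invmx Xm)) -evmx_mul -evmx_bwd -/kL.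
  apply/colP => a; rewrite mxE /horner_eval; have [b bE'] := kLX a.
  have [_ <-] := top a; rewrite bE' coefCM coefXn eqxx mulr1.
  by rewrite hornerM hornerC hornerXn expr1n mulr1.
have [uXm us'] : Xm \in unitmx /\ unitall s by move: us; rewrite all_rcons => /andP.
(* At generic points [k] is injective up to scalars, but [z + d] and [d] are different points of the
   plane with the same image. *)
have := genericI (generic_npar z0) (genericI (generic_neq0 K)
  (generic_mul (_ : invmx Xm \in unitmx) (generic_fwd_bwd us'))).
rewrite unitmx_inv => /(_ uXm)/generic_ex[d [ndz [d0 [e e0 eE]]]].
have zd0 : z + d != 0.
  by apply/eqP => zd; apply: ndz; rewrite -[d](addKr z) zd addr0 -scaleN1r; apply/parZl/par_refl.
have uinv : unitall (rcons s (invmx Xm)) by rewrite all_rcons unitmx_inv uXm.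
have := fwd_inj uinv e0 eE (esym (kz d)) d0 zd0 => dzd; apply: ndz => a b.
by have := dzd a b; rewrite !mxE !mulrDr [d a 0 * d b 0]mulrC => /addIr.
Qed.

End MonomialFactor.

(** * Zeros of short words and monomial matrices *)

Section MonomialMatrices.

Variable K : closedFieldType.
Implicit Types (x y z : 'cV[K]_3) (M X : 'M[K]_3) (ws ys : seq 'M[K]_3).

Notation unitall := (all (fun M : 'M[K]_3 => M \in unitmx)).

Definition zeros_in (zs : seq 'cV[K]_3) (f : 'cV[K]_3 -> 'cV[K]_3) :=
  (forall z, z \in zs -> z != 0) /\
  forall x, f x = 0 -> x != 0 -> exists2 z, z \in zs & par x z.

Lemma ei_neq0 i : ei K i != 0.
Proof.
apply/eqP => /colP/(_ i); rewrite !mxE !eqxx => /eqP; by rewrite oner_eq0.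
Qed.

Lemma sig_eq0P x : sig x = 0 -> exists i, x = x i 0 *: ei K i.
Proof.
move=> /colP sx.
have e i : x (i + 1) 0 * x (i + 2) 0 = 0 by have := sx i; rewrite !mxE.
have [[e0 e1] e2] := (e 0, e 1, e 2); rewrite !ord3_add in e0 e1 e2.
have x2 i : x (i + 1) 0 = 0 -> x (i + 2) 0 = 0 -> x = x i 0 *: ei K i.
  move=> x1 x2; apply/colP => j; rewrite !mxE eqxx andbT.
  by move: x1 x2; elim/ord3P: i; elim/ord3P: j; rewrite !ord3_add /= => x1 x2;
     rewrite ?x1 ?x2 ?mulr0 ?mulr1.
have [x0|x0] := eqVneq (x 0 0) 0; last first.
  exists 0; apply: x2; rewrite !ord3_add; apply: (mulfI x0); rewrite mulr0 //.
  by rewrite mulrC.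
have [x1|x1] := eqVneq (x 1 0) 0; last first.
  exists 1; apply: x2; rewrite !ord3_add //; apply: (mulfI x1).
  by rewrite e0 mulr0.
by exists 2; apply: x2; rewrite !ord3_add.
Qed.

Lemma par_sig_sym x c : sig x != 0 -> sig c != 0 -> par (sig x) c -> par x (sig c).
Proof.
move=> sx sc /(parP sx)[a cE].
have := par_refl (sig c); rewrite {1}cE sigZ sigK scalerA => E.
have a0 : a ^+ 2 * pi3 x != 0.
  by apply: contraNneq sc => a0; rewrite cE sigZ sigK scalerA a0 scale0r.
by have := parZl (a ^+ 2 * pi3 x)^-1 E; rewrite scalerA mulVf // scale1r.
Qed.

Lemma zeros_in_rcons zs ys X : X \in unitmx -> zeros_in zs (bwd ys) ->
  (forall z, z \in zs -> sig (X *m z) != 0) ->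
  zeros_in ([:: ei K 0; ei K 1; ei K 2] ++ [seq sig (X *m z) | z <- zs])
           (bwd (rcons ys (invmx X))).
Proof.
move=> uX [zs0 zsP] Xz; split=> [z|x].
  rewrite mem_cat => /orP[|/mapP[w /Xz w0 ->]//].
  by rewrite !inE => /or3P[] /eqP->; apply: ei_neq0.
rewrite -cats1 bwd_cat /= => bx x0.
have [sx|sx] := eqVneq (sig x) 0.
  have [i xE] := sig_eq0P sx; exists (ei K i); last by rewrite xE; apply/parZl/par_refl.
  by rewrite !inE; elim/ord3P: (i); rewrite eqxx ?orbT.
have [|z zin xz] := zsP _ bx; first by rewrite mulmx_eq0 ?unitmx_inv.
exists (sig (X *m z)).
  by rewrite !inE; apply/orP; right; apply/orP; right; apply/orP; right; apply/mapP; exists z.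
apply: par_sig_sym => //; first exact: Xz.
by have := par_mul X xz; rewrite mulKVmx.
Qed.

Lemma zeros_few zs f : zeros_in zs f -> few_zeros f.
Proof. by case; exists zs. Qed.

Lemma zeros_in1 X : X \in unitmx ->
  zeros_in [:: ei K 0; ei K 1; ei K 2] (bwd [:: invmx X]).
Proof.
move=> uX; apply: (@zeros_in_rcons [::] [::]) => //.
by split=> // x /= ->; rewrite eqxx.
Qed.

Lemma few_zeros1 X : X \in unitmx -> few_zeros (bwd [:: invmx X]).
Proof. by move=> /zeros_in1/zeros_few. Qed.

Lemma few_zeros2 X1 X2 : unitall [:: X1; X2] -> (forall i, sig (X1 *m ei K i) != 0) ->
  few_zeros (bwd [:: invmx X2; invmx X1]).
Proof.
move=> /and3P[u1 u2 _] s1; have := zeros_in_rcons u1 (zeros_in1 u2).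
by move=> z12; apply: (zeros_few (z12 _)) => z; rewrite !inE => /or3P[] /eqP->.
Qed.

Lemma few_zeros3 X1 X2 X3 : unitall [:: X1; X2; X3] ->
  (forall i, sig (X1 *m ei K i) != 0) -> (forall i, sig (X2 *m ei K i) != 0) ->
  (forall i, sig (X1 *m sig (X2 *m ei K i)) != 0) ->
  few_zeros (bwd [:: invmx X3; invmx X2; invmx X1]).
Proof.
move=> /and4P[u1 u2 u3 _] s1 s2 s12;
have sz : forall z, z \in [:: ei K 0; ei K 1; ei K 2] -> sig (X2 *m z) != 0.
  by move=> z; rewrite !inE => /or3P[] /eqP->.
apply: (zeros_few (zeros_in_rcons u1 (zeros_in_rcons u2 (zeros_in1 u3) sz) _)) => z.
rewrite mem_cat => /orP[|/mapP[w + ->]]; by rewrite !inE => /or3P[] /eqP->.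
Qed.

Definition mnm (s : {perm 'I_3}) (t : 'I_3 -> K) : 'M[K]_3 :=
  \matrix_(i, j) (t j *+ (i == s j)).

Lemma mnm_mull s t n (A : 'M[K]_(3, n)) i l : (mnm s t *m A) (s i) l = t i * A i l.
Proof.
rewrite mxE (bigD1 i) //= big1 => [|j ji]; last first.
  by rewrite mxE (inj_eq perm_inj) eq_sym (negPf ji) mul0r.
by rewrite mxE eqxx addr0 mulr1n.
Qed.

Lemma mnm_mulr s t n (A : 'M[K]_(n, 3)) i l : (A *m mnm s t) i l = A i (s l) * t l.
Proof.
rewrite mxE (bigD1 (s l)) //= big1 => [|j jl]; last by rewrite mxE (negPf jl) mulr0.
by rewrite mxE eqxx addr0 mulr1n.
Qed.

Lemma mnm_ei s t i : mnm s t *m ei K i = t i *: ei K (s i).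
Proof. by rewrite -colE; apply/colP => j; rewrite !mxE eqxx andbT mulr_natr. Qed.

(** Phrased through the columns because these are what [word6_or_tight] controls for
    [X3 *m hinv X2]. *)
Lemma mnm_cols X : (forall i, X *m ei K i != 0) ->
  (forall i j, par (X *m ei K i) (X *m ei K j) -> i = j) ->
  (forall i, sig (X *m ei K i) = 0) ->
  exists s t, (forall i, t i != 0) /\ X = mnm s t.
Proof.
move=> X0 Xpar sX.
have /boolp.choice[f fE] : forall i, exists j, X *m ei K i = (X *m ei K i) j 0 *: ei K j.
  by move=> i; apply: sig_eq0P.
have t0 i : (X *m ei K i) (f i) 0 != 0.
  by apply: contraNneq (X0 i) => t0; rewrite fE t0 scale0r.
have inj_f : injective f.
  by move=> i j fij; apply: Xpar; rewrite (fE i) (fE j) fij; apply/parZl/parZr/par_refl.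
exists (perm inj_f), (fun i => (X *m ei K i) (f i) 0); split=> //.
apply/matrixP => i j; have := congr1 (fun v : 'cV_3 => v i 0) (fE j).
rewrite -{1}colE [in X in X -> _]mxE [RHS]mxE eiE => ->.
by rewrite [RHS]mxE permE mulr_natr.
Qed.

Lemma ei_par i j : par (ei K i) (ei K j) -> i = j.
Proof.
move=> /(_ i j); rewrite !mxE !eqxx !andbT mul1r eq_sym.
by case: eqP => // _ /eqP; rewrite mulr0 oner_eq0.
Qed.

Lemma unit_cols X : X \in unitmx -> forall i j, par (X *m ei K i) (X *m ei K j) -> i = j.
Proof. by move=> uX i j /(par_mul (invmx X)); rewrite !mulKmx // => /ei_par. Qed.

Lemma mnmP X : X \in unitmx -> (forall i, sig (X *m ei K i) = 0) ->
  exists s t, (forall i, t i != 0) /\ X = mnm s t.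
Proof.
move=> uX; apply: mnm_cols; last exact: unit_cols.
by move=> i; rewrite mulmx_eq0 ?ei_neq0.
Qed.

Lemma sig_mnm s t x : sig (mnm s t *m x) = mnm s (fun i => \prod_(l | l != i) t l) *m sig x.
Proof.
apply/colP => j; rewrite -[j](permKV s); move: (s^-1%g j) => i; rewrite mnm_mull.
rewrite !sig_prod (reindex_inj (@perm_inj _ s)) -big_split /=.
by apply: eq_big => [l|l _]; rewrite ?(inj_eq perm_inj) // mnm_mull.
Qed.

(** With the convention [0^-1 = 0], a monomial matrix goes to its inverse transpose ([hinv_trmx]),
    and a column without zero entries goes to a multiple of its image under [sig]. *)
Definition hinv X : 'M[K]_3 := map_mx (fun a => a^-1) X.

Lemma hinv_mnm s t : hinv (mnm s t) = mnm s (fun i => (t i)^-1).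
Proof. by apply/matrixP => i j; rewrite !mxE; case: eqP; rewrite ?mulr1n // !mulr0n invr0. Qed.

Lemma mnm_codet s t : (forall i, t i != 0) ->
  mnm s (fun i => \prod_(l | l != i) t l) = (\prod_l t l) *: hinv (mnm s t).
Proof.
move=> t0; rewrite hinv_mnm; apply/matrixP => i j; rewrite !mxE mulrnAr; congr (_ *+ _).
by rewrite [in RHS](bigD1 j) //= mulrC mulKf.
Qed.

(** A monomial matrix preserves the coordinate triangle, so [sig] conjugates it into a monomial
    matrix and the two copies of [sig] cancel. *)
Lemma sig_mnm_sig s t x : (forall i, t i != 0) ->
  sig (mnm s t *m sig x) = (pi3 x * \prod_l t l) *: (hinv (mnm s t) *m x).
Proof.
by move=> t0; rewrite sig_mnm sigK mnm_codet // -scalemxAr -scalemxAl scalerA.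
Qed.

Lemma hinv_trmx s t : (forall i, t i != 0) -> (hinv (mnm s t))^T *m mnm s t = 1%:M.
Proof.
move=> t0; apply/matrixP => i j; rewrite !mxE (bigD1 (s i)) //= big1 ?addr0.
  rewrite !mxE eqxx mulr1n (inj_eq perm_inj).
  have [->|_] := eqVneq i j; first by rewrite mulr1n mulVf.
  by rewrite mulr0n mulr0.
by move=> l li; rewrite !mxE (negPf li) mulr0n invr0 mul0r.
Qed.

Lemma unitmx_hinv s t : (forall i, t i != 0) -> hinv (mnm s t) \in unitmx.
Proof. by move=> t0; rewrite -unitmx_tr; case/mulmx1_unit: (hinv_trmx s t0). Qed.

Lemma det_hinv s t : (forall i, t i != 0) -> \det (hinv (mnm s t)) * \det (mnm s t) = 1.
Proof. by move=> t0; rewrite -det_tr -det_mulmx hinv_trmx // det1. Qed.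

Lemma unit_det_neq0 n (X : 'M[K]_n) : X \in unitmx -> \det X != 0.
Proof. by rewrite unitmxE unitfE. Qed.

Lemma unitmx_mnm s t : (forall i, t i != 0) -> mnm s t \in unitmx.
Proof.
move=> t0; rewrite unitmxE unitfE; apply: contra_neq (oner_neq0 K) => d0.
by rewrite -(det_hinv s t0) d0 mulr0.
Qed.

Lemma par_scale_inv c d x y : c != 0 -> d != 0 -> par (c *: x) (d *: y) -> par x y.
Proof.
move=> c0 d0 /(parZl c^-1)/(parZr d^-1).
by rewrite !scalerA !mulVf // !scale1r.
Qed.

Lemma rel_rot X ws : X \in unitmx -> rel_word (X :: ws) -> rel_word (rcons ws X).
Proof.
move=> uX rel; apply: generic_par; [exact: pmap_fwd|by move=> i; apply: pfun_coord|].
apply: genericW generic_pi3 => y py; have := rel (invmx X *m sig y).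
move=> /(par_mul X)/par_sig; rewrite /= mulKVmx // sigK -[sig (X *m _)]/(fwd [:: X] _).
rewrite -fwd_cat cats1 fwdZ; apply: par_scale_inv => //.
by rewrite expf_neq0.
Qed.

Lemma rel_merge s t X Z ws : (forall i, t i != 0) -> X \in unitmx -> Z \in unitmx ->
  rel_word [:: X, mnm s t, Z & ws] -> rel_word (Z *m hinv (mnm s t) *m X :: ws).
Proof.
move=> t0 uX uZ rel; apply: generic_par; [exact: pmap_fwd|by move=> i; apply: pfun_coord|].
apply: genericW (generic_mul uX generic_pi3) => x px; have := rel x.
rewrite /= sig_mnm_sig // -scalemxAr sigZ fwdZ -[x in par _ x]scale1r !mulmxA.
apply: par_scale_inv; last exact: oner_neq0.
by rewrite !expf_neq0 // mulf_neq0 //; apply/prodf_neq0.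
Qed.

End MonomialMatrices.

(** * Galois weights *)

Section Equivariance.

Variables (K : closedFieldType) (G : Type) (h : G -> {rmorphism K -> K}).
Implicit Types (x y z : 'cV[K]_3) (X : 'M[K]_3) (r : G -> K).

(* Action of Galois elements on the coordinate points: the linear part of [g] is the monomial
   matrix that sends [e_i] to [(va g i)^-1 e_(vs g i)]. *)
Record vtx := Vtx {
  vs : G -> {perm 'I_3};
  va : G -> 'I_3 -> K;
  va_neq0 : forall g i, va g i != 0;
  vs_trans : forall i j, exists g, vs g i = j
}.

Implicit Types (v w : vtx).

(* Both weights are on the same side since [sig] turns a monomial matrix into its inverse
   transpose, and [X] maps an image of [sig] to a source of [sig]. *)
Definition eqv v w r X :=
  forall g i k, h g (X i k) = r g * va v g i * va w g k * X (vs v g i) (vs w g k).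

Definition veq v g x y :=
  exists2 c, c != 0 & forall i, h g (x i 0) = c * va v g i * y (vs v g i) 0.

Lemma veq_ei v w r X : (forall g, r g != 0) -> eqv v w r X ->
  forall g k, veq v g (X *m ei K k) (X *m ei K (vs w g k)).
Proof.
move=> r0 eX g k; exists (r g * va w g k); first by rewrite mulf_neq0 ?va_neq0.
by move=> i; rewrite -!colE !mxE eX; ring.
Qed.

(** The weights are inverse to those of [veq], which concerns arguments of [sig], whereas these
    vectors are values of [sig]. *)
Definition veq' v g x y :=
  exists2 c, c != 0 & forall i, h g (x i 0) = c / va v g i * y (vs v g i) 0.

Lemma veq_sig v g x y : veq v g x y -> veq' v g (sig x) (sig y).
Proof.
case=> c c0 xy; exists (c ^+ 2 * \prod_l va v g l).
  by rewrite mulf_neq0 ?expf_neq0 //; apply/prodf_neq0 => i _; apply: va_neq0.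
move=> i; rewrite [in LHS]mxE rmorphM !xy.
have ai := va_neq0 v g i.
have -> : \prod_l va v g l = va v g i * (va v g (i + 1) * va v g (i + 2)).
  by rewrite big_ord3 /=; elim/ord3P: (i); rewrite !ord3_add; ring.
by rewrite sig_perm; field.
Qed.

Lemma veq_mul v w r X g x y : (forall g, r g != 0) -> eqv v w r X ->
  veq' w g x y -> veq v g (X *m x) (X *m y).
Proof.
move=> r0 eX [c c0 xy]; exists (r g * c); first by rewrite mulf_neq0.
move=> i; rewrite !mxE rmorph_sum mulr_sumr /=.
rewrite [RHS](reindex_inj (@perm_inj _ (vs w g))) /=.
apply: eq_bigr => k _; rewrite rmorphM eX xy.
by have ak := va_neq0 w g k; field.
Qed.

Lemma veq_sig0 v g x y : veq v g x y -> sig x = 0 -> sig y = 0.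
Proof.
move=> /veq_sig[c c0 xy] sx; apply/colP => i; rewrite [RHS]mxE.
have /eqP := xy ((vs v g)^-1%g i); rewrite sx permKV mxE rmorph0 eq_sym.
by rewrite mulf_eq0 mulf_eq0 invr_eq0 (negPf c0) (negPf (va_neq0 _ _ _)) => /eqP.
Qed.

(** By [veq_ei] the Galois group permutes the columns of [X] transitively, up to scalings and
    permutations of the coordinates. So one column that is a coordinate point forces the same for
    all. *)
Lemma mnm_or_full v w r X : (forall g, r g != 0) -> eqv v w r X -> X \in unitmx ->
  (exists s t, (forall i, t i != 0) /\ X = mnm s t) \/ forall k, sig (X *m ei K k) != 0.
Proof.
move=> r0 eX uX.
have [[k sk]|nk] := boolp.pselect (exists k, sig (X *m ei K k) = 0); last first.
  by right=> k; apply/eqP => sk; apply: nk; exists k.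
left; apply: mnmP => // i; have [g <-] := vs_trans w k i.
exact: veq_sig0 (veq_ei r0 eX g k) sk.
Qed.

Lemma mnm_inv X : X \in unitmx -> (forall i, sig (invmx X *m ei K i) = 0) ->
  forall i, sig (X *m ei K i) = 0.
Proof.
move=> uX sY; have [|s [t [t0 YE]]] := mnmP _ sY; first by rewrite unitmx_inv.
move=> i; rewrite -[i](permKV s); set j := _ i.
have -> : X *m ei K (s j) = (t j)^-1 *: ei K j.
  apply: (scalerI (t0 j)); rewrite scalemxAr -mnm_ei -YE mulKVmx //.
  by rewrite scalerA mulfV // scale1r.
by rewrite sigZ sig_ei scaler0.
Qed.

Definition cube_rel r r' (d d' : K) := exists2 nu, nu ^+ 3 * d' = d &
  forall g, h g nu * r' g = r g * nu.

Lemma cube_rel_sym r r' d d' : d != 0 -> d' != 0 -> cube_rel r r' d d' -> cube_rel r' r d' d.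
Proof.
move=> d0 d'0 [nu nuE nug].
have nu0 : nu != 0 by apply: contraNneq d0 => nu0; rewrite -nuE nu0 expr0n mul0r.
exists nu^-1; first by rewrite -nuE exprVn mulrA mulVf ?mul1r // expf_neq0.
move=> g; rewrite fmorphV; have hnu0 : h g nu != 0 by rewrite fmorph_eq0.
by apply: (mulfI hnu0); rewrite mulVKf // [RHS]mulrA nug mulfK.
Qed.

Lemma scalar_par X : (forall x, par (X *m x) x) -> exists c, X = c%:M.
Proof.
move=> Xp; have off i j : i != j -> X i j = 0.
  move=> ij; have := Xp (ei K j) i j; rewrite -!colE !mxE !eqxx (negPf ij).
  by rewrite mulr1 mulr0.
have S i : (X *m const_mx 1 : 'cV_3) i 0 = X i i.
  rewrite mxE (bigD1 i) //= mxE mulr1 big1 ?addr0 // => l li.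
  by rewrite off ?mul0r // eq_sym.
exists (X 0 0); apply/matrixP => i j; rewrite [RHS]mxE.
have [<-|/off//] := eqVneq i j; have := Xp (const_mx 1) i 0.
by rewrite !S !mxE !mulr1.
Qed.

(** [sig_inv_eq0] makes [X2] monomial, so [sig X2 sig] is [hinv X2], the inverse transpose, and the
    relation becomes [X1 = nu *: X2^T]. Transposition exchanges [v1] and [v2], so the vertex weights
    cancel when one nonzero entry is compared. *)
Lemma word2 v1 v2 r1 r2 X1 X2 :
  (forall g, r1 g != 0) -> (forall g, r2 g != 0) -> X1 \in unitmx -> X2 \in unitmx ->
  eqv v1 v2 r1 X1 -> eqv v2 v1 r2 X2 -> rel_word [:: X1; X2] ->
  cube_rel r1 r2 (\det X1) (\det X2).
Proof.
move=> r10 r20 u1 u2 e1 e2 rel.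
have m2 : forall i, sig (invmx X2 *m ei K i) = 0.
  by apply: (@sig_inv_eq0 _ [::] X1 X2 [::]); rewrite //= ?u1 ?u2 //; apply: few_zeros1.
have [s [t [t0 X2E]]] := mnmP u2 (mnm_inv u2 m2).
have [x|nu nuE] := @scalar_par (hinv X2 *m X1).
  move: x; apply: generic_par; [exact: pmap_mul|by move=> i; apply: pfun_coord|].
  apply: genericW (generic_mul u1 generic_pi3) => x px; have := rel x.
  rewrite /= {1}X2E sig_mnm_sig // -X2E -[x in par _ x]scale1r mulmxA.
  apply: par_scale_inv; last exact: oner_neq0.
  by rewrite mulf_neq0 //; apply/prodf_neq0.
have X1E : X1 = nu *: X2^T.
  have := hinv_trmx s t0; rewrite -X2E => /(congr1 trmx); rewrite trmx_mul trmxK trmx1 => E.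
  by rewrite -[X1]mul1mx -E -mulmxA nuE -scalemx1 -scalemxAr mulmx1.
exists nu; first by rewrite X1E detZ det_tr.
move=> g; have [k] : exists k, X2 k 0 != 0.
  have /neq0_coord[k] : X2 *m ei K 0 != 0 by rewrite mulmx_eq0 ?ei_neq0.
  by rewrite -colE mxE; exists k.
move=> X20; have := e1 g 0 k; rewrite X1E !mxE rmorphM e2.
have : X2 (vs v2 g k) (vs v1 g 0) != 0.
  by have := fmorph_eq0 (h g) (X2 k 0); rewrite (negPf X20) e2 !mulf_eq0 => /norP[].
move: (X2 _ _) => a a0 E.
apply: (mulfI a0); apply: (mulfI (va_neq0 v1 g 0)); apply: (mulfI (va_neq0 v2 g k)).
by rewrite -!mulrA in E *; move: E; move: (h g nu) => b E; ring: E.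
Qed.

End Equivariance.

(** * Words of length four and six: a monomial letter or a tight pair *)

Section ShortWords.

Variables (K : closedFieldType) (G : Type) (h : G -> {rmorphism K -> K}).
Implicit Types (x y z : 'cV[K]_3) (X : 'M[K]_3) (r : G -> K).
Implicit Types (v w : vtx K G).

Notation unitall := (all (fun M : 'M[K]_3 => M \in unitmx)).
Notation eqv := (eqv h).
Notation cube_rel := (cube_rel h).

Definition mono X := exists s t, (forall i, t i != 0) /\ X = mnm s t.

Lemma eqv_merge v1 v2 v5 v6 r1 r2 r6 X1 X2 X6 :
  eqv v2 v1 r2 X2 -> eqv v1 v6 r1 X1 -> eqv v6 v5 r6 X6 ->
  eqv v2 v5 (fun g => r2 g / r1 g * r6 g) (X2 *m hinv X1 *m X6).
Proof.
move=> e2 e1 e6 g i k; rewrite !mxE rmorph_sum mulr_sumr /=.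
rewrite [RHS](reindex_inj (@perm_inj _ (vs v6 g))) /=; apply: eq_bigr => l _.
rewrite rmorphM e6 !mxE rmorph_sum !mulr_suml mulr_sumr /=.
rewrite [RHS](reindex_inj (@perm_inj _ (vs v1 g))) /=; apply: eq_bigr => m _.
rewrite rmorphM e2 !mxE fmorphV e1 !invfM.
have a1 := va_neq0 v1 g m; have a6 := va_neq0 v6 g l.
move: (r1 g)^-1 (X1 _ _)^-1 => b c.
by field; rewrite a1 a6.
Qed.

Lemma unit_merge X1 X2 X6 : mono X1 -> X2 \in unitmx -> X6 \in unitmx ->
  X2 *m hinv X1 *m X6 \in unitmx.
Proof. by case=> s [t [t0 ->]] u2 u6; rewrite !unitmx_mul u2 u6 unitmx_hinv. Qed.

Lemma det_merge X1 X2 X6 : mono X1 ->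
  \det (X2 *m hinv X1 *m X6) * \det X1 = \det X2 * \det X6.
Proof.
case=> s [t [t0 ->]]; have := det_hinv s t0; rewrite !det_mulmx => E.
by rewrite mulrAC -!mulrA [_ * (_ * \det X6)]mulrA E mul1r.
Qed.

Lemma cube_rel_eq r r' (d d' : K) s s' e e' : cube_rel r r' d d' ->
  r =1 s -> r' =1 s' -> d = e -> d' = e' -> cube_rel s s' e e'.
Proof. by move=> [nu nuE nug] rs rs' <- <-; exists nu => // g; rewrite -rs -rs'. Qed.

(** Merging around [X1] leaves the two letters [X2 *m hinv X1 *m X4] and [X3]. The determinant of
    [X1] enters through its inverse, so [word2] compares even letters to odd ones; [cube_rel_sym]
    turns this around. *)
Lemma word4_mnm v1 v2 v3 v4 r1 r2 r3 r4 X1 X2 X3 X4 :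
  (forall g, r1 g != 0) -> (forall g, r2 g != 0) -> (forall g, r3 g != 0) ->
  (forall g, r4 g != 0) -> unitall [:: X1; X2; X3; X4] ->
  eqv v1 v4 r1 X1 -> eqv v2 v1 r2 X2 -> eqv v3 v2 r3 X3 -> eqv v4 v3 r4 X4 ->
  rel_word [:: X1; X2; X3; X4] -> mono X1 ->
  cube_rel (fun g => r1 g * r3 g) (fun g => r2 g * r4 g)
     (\det X1 * \det X3) (\det X2 * \det X4).
Proof.
move=> r10 r20 r30 r40 /and5P[u1 u2 u3 u4 _] e1 e2 e3 e4 rel m1.
have {rel} := rel_rot u3 (rel_rot u2 (rel_rot u1 rel)) => /= rel.
have [s [t [t0 X1E]]] := m1; rewrite X1E in rel.
have {}rel := rel_merge t0 u4 u2 rel; rewrite -X1E in rel.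
have um := unit_merge m1 u2 u4.
have r'0 g : r2 g / r1 g * r4 g != 0 by rewrite !mulf_neq0 ?invr_eq0.
have := word2 r'0 r30 um u3 (eqv_merge e2 e1 e4) e3 rel.
case=> nu nuE nug; apply: cube_rel_sym; rewrite ?mulf_neq0 ?unit_det_neq0 //.
exists nu; first by rewrite mulrCA nuE mulrC det_merge.
by move=> g; rewrite mulrCA nug; have r1g := r10 g; field.
Qed.

(** A relation of length four always has a monomial letter: if [X2] is not monomial, the inverse of
    the first half has finitely many zeros, and [sig_inv_eq0] makes [X3] monomial. *)
Lemma word4 v1 v2 v3 v4 r1 r2 r3 r4 X1 X2 X3 X4 :
  (forall g, r1 g != 0) -> (forall g, r2 g != 0) -> (forall g, r3 g != 0) ->
  (forall g, r4 g != 0) -> unitall [:: X1; X2; X3; X4] ->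
  eqv v1 v4 r1 X1 -> eqv v2 v1 r2 X2 -> eqv v3 v2 r3 X3 -> eqv v4 v3 r4 X4 ->
  rel_word [:: X1; X2; X3; X4] ->
  cube_rel (fun g => r1 g * r3 g) (fun g => r2 g * r4 g)
     (\det X1 * \det X3) (\det X2 * \det X4).
Proof.
move=> r10 r20 r30 r40 us e1 e2 e3 e4 rel; have /and5P[u1 u2 u3 u4 _] := us.
have [m1|n1] := mnm_or_full r10 e1 u1; first exact: word4_mnm.
have [m2|n2] := mnm_or_full r20 e2 u2.
  have us2 : unitall [:: X2; X3; X4; X1] by rewrite /= u1 u2 u3 u4.
  apply: cube_rel_sym; rewrite ?mulf_neq0 ?unit_det_neq0 //.
  by apply: cube_rel_eq (word4_mnm r20 r30 r40 r10 us2 e2 e3 e4 e1 (rel_rot u1 rel) m2)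
     _ _ _ _ => // [g|]; rewrite mulrC.
have s3 : forall i, sig (invmx X3 *m ei K i) = 0.
  apply: (@sig_inv_eq0 _ [:: X1] X2 X3 [:: X4]) => //; rewrite /= ?u1 ?u2 ?u3 ?u4 //.
  by apply: few_zeros2 => //=; rewrite u1 u2.
have m3 := mnmP u3 (mnm_inv u3 s3).
have us3 : unitall [:: X3; X4; X1; X2] by rewrite /= u1 u2 u3 u4.
have rel3 := rel_rot u2 (rel_rot u1 rel).
by apply: cube_rel_eq (word4_mnm r30 r40 r10 r20 us3 e3 e4 e1 e2 rel3 m3) _ _ _ _ => [g|g||];
   rewrite mulrC.
Qed.

Lemma word6_mnm v1 v2 v3 v4 v5 v6 r1 r2 r3 r4 r5 r6 X1 X2 X3 X4 X5 X6 :
  (forall g, r1 g != 0) -> (forall g, r2 g != 0) -> (forall g, r3 g != 0) ->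
  (forall g, r4 g != 0) -> (forall g, r5 g != 0) -> (forall g, r6 g != 0) ->
  unitall [:: X1; X2; X3; X4; X5; X6] ->
  eqv v1 v6 r1 X1 -> eqv v2 v1 r2 X2 -> eqv v3 v2 r3 X3 -> eqv v4 v3 r4 X4 ->
  eqv v5 v4 r5 X5 -> eqv v6 v5 r6 X6 ->
  rel_word [:: X1; X2; X3; X4; X5; X6] -> mono X1 ->
  cube_rel (fun g => r1 g * r3 g * r5 g) (fun g => r2 g * r4 g * r6 g)
     (\det X1 * \det X3 * \det X5) (\det X2 * \det X4 * \det X6).
Proof.
move=> r10 r20 r30 r40 r50 r60 /and5P[u1 u2 u3 u4 /and3P[u5 u6 _]] e1 e2 e3 e4 e5 e6 rel m1.
have {rel} := rel_rot u5 (rel_rot u4 (rel_rot u3 (rel_rot u2 (rel_rot u1 rel)))) => /= rel.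
have [s [t [t0 X1E]]] := m1; rewrite X1E in rel.
have {}rel := rel_merge t0 u6 u2 rel; rewrite -X1E in rel.
have um := unit_merge m1 u2 u6.
have r'0 g : r2 g / r1 g * r6 g != 0 by rewrite !mulf_neq0 ?invr_eq0.
have us : unitall [:: X2 *m hinv X1 *m X6; X3; X4; X5] by rewrite /= um u3 u4 u5.
have := word4 r'0 r30 r40 r50 us (eqv_merge e2 e1 e6) e3 e4 e5 rel.
case=> nu nuE nug; apply: cube_rel_sym; rewrite ?mulf_neq0 ?unit_det_neq0 //.
exists nu.
  by rewrite -mulrA mulrCA nuE [\det X1 * _]mulrC mulrAC det_merge //; ring.
move=> g; have r1g := r10 g; rewrite -mulrA mulrCA nug.
by field.
Qed.

(** Then each [X' *m sig (X *m ei K k)] is a multiple of a coordinate point: a line contracted by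
    one [sig] is carried to a base point of the second [sig] after it. *)
Definition tight X X' := (forall i j, X i j != 0) /\ mono (X' *m hinv X).

(** If [X2] and [X3] are not monomial, the only possible obstruction in [few_zeros3] is that some
    [X3 *m sig (X2 *m ei K i)] is a coordinate point. If none is, [X4] is monomial; if one is,
    transitivity spreads this to all [i]. *)
Lemma word6_or_tight v1 v2 v3 v4 v5 v6 r1 r2 r3 r4 r5 r6 X1 X2 X3 X4 X5 X6 :
  (forall g, r1 g != 0) -> (forall g, r2 g != 0) -> (forall g, r3 g != 0) ->
  (forall g, r4 g != 0) -> (forall g, r5 g != 0) -> (forall g, r6 g != 0) ->
  unitall [:: X1; X2; X3; X4; X5; X6] ->
  eqv v1 v6 r1 X1 -> eqv v2 v1 r2 X2 -> eqv v3 v2 r3 X3 -> eqv v4 v3 r4 X4 ->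
  eqv v5 v4 r5 X5 -> eqv v6 v5 r6 X6 ->
  rel_word [:: X1; X2; X3; X4; X5; X6] ->
  cube_rel (fun g => r1 g * r3 g * r5 g) (fun g => r2 g * r4 g * r6 g)
     (\det X1 * \det X3 * \det X5) (\det X2 * \det X4 * \det X6) \/ tight X2 X3.
Proof.
move=> r10 r20 r30 r40 r50 r60 us e1 e2 e3 e4 e5 e6 rel.
have /and5P[u1 u2 u3 u4 /and3P[u5 u6 _]] := us.
have rel2 := rel_rot u1 rel; have rel3 := rel_rot u2 rel2; have rel4 := rel_rot u3 rel3.
have [m2|n2] := mnm_or_full r20 e2 u2.
  left; have us2 : unitall [:: X2; X3; X4; X5; X6; X1] by rewrite /= u1 u2 u3 u4 u5 u6.
  apply: cube_rel_sym; rewrite ?mulf_neq0 ?unit_det_neq0 //.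
  by apply: cube_rel_eq (word6_mnm r20 r30 r40 r50 r60 r10 us2 e2 e3 e4 e5 e6 e1 rel2 m2)
    _ _ _ _ => // [g|]; rewrite mulrC mulrA.
have [m3|n3] := mnm_or_full r30 e3 u3.
  left; have us3 : unitall [:: X3; X4; X5; X6; X1; X2] by rewrite /= u1 u2 u3 u4 u5 u6.
  by apply: cube_rel_eq (word6_mnm r30 r40 r50 r60 r10 r20 us3 e3 e4 e5 e6 e1 e2 rel3 m3)
    _ _ _ _ => [g|g||]; ring.
have [[i s23]|n23] := boolp.pselect (exists i, sig (X3 *m sig (X2 *m ei K i)) = 0); last first.
  left; have us4 : unitall [:: X4; X5; X6; X1; X2; X3] by rewrite /= u1 u2 u3 u4 u5 u6.
  have s4 : forall i, sig (invmx X4 *m ei K i) = 0.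
    apply: (@sig_inv_eq0 _ [:: X1; X2] X3 X4 [:: X5; X6]) => //=; rewrite ?u1 ?u2 ?u3 ?u4 ?u5 ?u6 //.
    apply: few_zeros3 => //=; first by rewrite u1 u2 u3.
    by move=> i; apply/eqP => s23; apply: n23; exists i.
  have m4 := mnmP u4 (mnm_inv u4 s4).
  apply: cube_rel_sym; rewrite ?mulf_neq0 ?unit_det_neq0 //.
  by apply: cube_rel_eq (word6_mnm r40 r50 r60 r10 r20 r30 us4 e4 e5 e6 e1 e2 e3 rel4 m4)
    _ _ _ _ => [g|g||]; ring.
right.
have {i}s23 j : sig (X3 *m sig (X2 *m ei K j)) = 0.
  have [g gE] := vs_trans v1 i j.
  have E := veq_mul r30 e3 (veq_sig (veq_ei r20 e2 g i)).
  by rewrite gE in E; apply: veq_sig0 E s23.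
(* A zero entry would make [sig (X2 *m ei K j)] a multiple of [e_i], but [X3 *m ei K i] is not a
   coordinate point. *)
have full i j : X2 i j != 0.
  apply/eqP => Xij; have Xi : (X2 *m ei K j) i 0 = 0 by rewrite -colE mxE.
  have := s23 j; have := n2 j; rewrite (sig_eq0_coord Xi); move: (_ * _) => c.
  rewrite scaler_eq0 negb_or => /andP[c0 _] /eqP.
  by rewrite -scalemxAr sigZ scaler_eq0 (negPf (n3 i)) orbF expf_eq0 (negPf c0).
split=> //.
have hE j : hinv X2 *m ei K j = (pi3 (X2 *m ei K j))^-1 *: sig (X2 *m ei K j).
  have f k : (X2 *m ei K j) k 0 = X2 k j by rewrite -colE mxE.
  apply/colP => i; rewrite -colE mxE mxE [RHS]mxE [sig _ _ _]mxE /pi3 !f.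
  have [[x0 x1] x2] := (full 0 j, full 1 j, full 2 j).
  by elim/ord3P: (i); rewrite !ord3_add; field; rewrite ?x0 ?x1 ?x2.
have pi0 j : pi3 (X2 *m ei K j) != 0.
  by rewrite /pi3 -!colE ![col _ _ _ _]mxE !mulf_neq0.
apply: mnm_cols => i.
- rewrite -mulmxA mulmx_eq0 // hE scaler_eq0 invr_eq0 negb_or pi0 /=.
  exact: n2.
- move=> j; rewrite -!mulmxA => /(par_mul (invmx X3)); rewrite !mulKmx // !hE.
  have pi0' k : (pi3 (X2 *m ei K k))^-1 != 0 by rewrite invr_eq0.
  move=> /(par_scale_inv (pi0' i) (pi0' j))/par_sig.
  by rewrite !sigK => /(par_scale_inv (pi0 i) (pi0 j))/(unit_cols u2).
- by rewrite -mulmxA hE -scalemxAr sigZ s23 scaler0.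
Qed.

End ShortWords.

(** * Tight words *)

Section Polar.

Variable R : comNzRingType.
Implicit Types x y : 'cV[R]_3.

(** The polar form of [sig]: [pol x] is the differential of [sig] at [x], and
    [pol x x = sig x + sig x]. *)
Definition pol x y : 'cV[R]_3 :=
  \col_i (x (i + 1) 0 * y (i + 2) 0 + x (i + 2) 0 * y (i + 1) 0).

Lemma sigD x y a b : sig (a *: x + b *: y) =
  a ^+ 2 *: sig x + (a * b) *: pol x y + b ^+ 2 *: sig y.
Proof. by apply/colP => i; rewrite !mxE; ring. Qed.

Lemma polDr x y z a : pol x (y + a *: z) = pol x y + a *: pol x z.
Proof. by apply/colP => i; rewrite !mxE; ring. Qed.

End Polar.

Section TightPermutations.

Variables (K : closedFieldType).
Implicit Types (x y z c d : 'cV[K]_3) (X : 'M[K]_3).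

Notation unitall := (all (fun M : 'M[K]_3 => M \in unitmx)).

Lemma pmap_pol (x : 'cV[K]_3) : pmap (pol x).
Proof.
move=> i; rewrite (_ : (fun y => pol x y i 0) =
  (fun y => x (i + 1) 0 * y (i + 2) 0 + x (i + 2) 0 * y (i + 1) 0)).
  by apply/pfunD; apply/pfunM; (apply: pfun_const || apply: pfun_coord).
by apply: boolp.funext => y; rewrite mxE.
Qed.

(** With coordinates [c i 0 * e i 0] for [d], the system becomes [e (i + 1) + e (i + 2) = o i + l].
    The matrix of its left-hand side has determinant [2]; the free multiple [l] of [sig c] makes it
    solvable in every characteristic, with [e 0 = 0]. *)
Lemma pol_solve c w : (forall i, c i 0 != 0) ->
  exists d l, pol c d = w + l *: sig c.
Proof.
move=> c0; pose o i := w i 0 / sig c i 0.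
have s0 i : sig c i 0 != 0 by rewrite mxE mulf_neq0.
pose l := o 0 - o 1 - o 2.
pose e : 'cV[K]_3 := \col_i (if i == 0 then 0 else if i == 1 then o 2 + l else o 1 + l).
exists (\col_i (c i 0 * e i 0)), l; apply/colP => i.
have wE : (w + l *: sig c) i 0 = (o i + l) * sig c i 0.
  by rewrite mulrDl divfK // [LHS]mxE [in LHS]mxE.
rewrite wE !mxE /l {wE}; elim/ord3P: i; rewrite !ord3_add /=; ring.
Qed.

Lemma tight_inv X X' s t : X' \in unitmx -> X' *m hinv X = mnm s t ->
  (forall i j, X i j != 0) -> (forall i, t i != 0) ->
  forall i k, invmx X' i (s k) = (X i k * t k)^-1.
Proof.
move=> u' XE X0 t0 i k.
have : invmx X' *m (mnm s t *m ei K k) = hinv X *m ei K k by rewrite -XE -mulmxA mulKmx.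
rewrite mnm_ei -scalemxAr => /colP/(_ i); rewrite -!colE mxE !mxE => E.
by rewrite invfM -E [t k * _]mulrC mulfK.
Qed.

Lemma tight_inv_full X X' s t : X' \in unitmx -> X' *m hinv X = mnm s t ->
  (forall i j, X i j != 0) -> (forall i, t i != 0) ->
  forall i j, invmx X' i j != 0.
Proof.
move=> u' XE X0 t0 i j; rewrite -[j](permKV s) (tight_inv u' XE) //.
by rewrite invr_eq0 mulf_neq0.
Qed.

Lemma tight_fwd X X' s t : X' *m hinv X = mnm s t -> (forall i j, X i j != 0) ->
  forall k, X' *m sig (X *m ei K k) = (pi3 (X *m ei K k) * t k) *: ei K (s k).
Proof.
move=> XE X0 k; rewrite -scalerA -mnm_ei -XE -mulmxA scalemxAr; congr (_ *m _).
apply/colP => i; rewrite -!colE !mxE /pi3 !mxE.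
have [[x0 x1] x2] := (X0 0 k, X0 1 k, X0 2 k).
by elim/ord3P: (i); rewrite !ord3_add; field.
Qed.

Lemma tight_bwd X X' s t : X \in unitmx -> X' \in unitmx -> X' *m hinv X = mnm s t ->
  (forall i j, X i j != 0) -> (forall i, t i != 0) ->
  forall k, exists2 a, a != 0 & invmx X *m sig (invmx X' *m ei K (s k)) = a *: ei K k.
Proof.
move=> u u' XE X0 t0 k; have E := tight_inv u' XE X0 t0.
exists (pi3 (invmx X' *m ei K (s k)) * t k).
  by rewrite mulf_neq0 // /pi3 -!colE !mulf_neq0 // mxE E invr_eq0 mulf_neq0.
apply: (can_inj (mulKmx u)); rewrite mulKVmx // -scalemxAr.
apply/colP => i; rewrite -!colE !mxE /pi3 !mxE !E.
have [[x0 x1] x2] := (X0 0 k, X0 1 k, X0 2 k); have tk := t0 k.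
by elim/ord3P: (i); rewrite !ord3_add; field; rewrite ?x0 ?x1 ?x2 ?tk.
Qed.

Lemma par_curve (F H : 'cV[K]_3 -> 'cV[K]_3) V V' : pmap F -> pmap H ->
  (forall s, s != 0 -> par (F (evmx s V)) (H (evmx s V'))) ->
  par (F (evmx 0 V)) (H (evmx 0 V')).
Proof.
move=> pF pH FH i j.
have [[p pE] [p' p'E]] := (pF i V, pF j V); have [[q qE] [q' q'E]] := (pH i V', pH j V').
suff /eqP : p * q' - p' * q = 0.
  by rewrite pE p'E qE q'E -!hornerM subr_eq0 => /eqP->.
apply/eqP; have : 'X * (p * q' - p' * q) = 0.
  apply: poly_fun0 => s; rewrite !hornerE; have [->|s0] := eqVneq s 0; first by rewrite mul0r.
  by rewrite -pE -p'E -qE -q'E FH // subrr mulr0.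
by move/eqP; rewrite mulf_eq0 polyX_eq0.
Qed.

Lemma pol_ei_self i : pol (ei K i) (ei K i) = 0.
Proof.
apply/colP => j; rewrite !mxE eqxx !andbT.
by elim/ord3P: i; elim/ord3P: j; rewrite !ord3_add /= ?(mul0r, mulr0) addr0.
Qed.

Lemma pol_eiE i x : [/\ pol (ei K i) x i 0 = 0,
  pol (ei K i) x (i + 1) 0 = x (i + 2) 0 & pol (ei K i) x (i + 2) 0 = x (i + 1) 0].
Proof.
by rewrite !mxE !eqxx !andbT; elim/ord3P: i; rewrite !ord3_add /=; split;
   rewrite ?(mul0r, mul1r) ?addr0 ?add0r.
Qed.

(* The limit for [s -> 0] of the hypothesis at [e_i + s d], after division of both sides by
   powers of [s]: it compares the images of the exceptional line over [e_i]. *)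
Lemma exceptional_limit Y1 Y2 Y3 Y4 X5 X6 i m k d :
  (forall x, par (sig (X6 *m sig (X5 *m sig x)))
                 (Y1 *m sig (Y2 *m sig (Y3 *m sig (Y4 *m x))))) ->
  Y3 *m sig (Y4 *m ei K i) = k *: ei K m -> k != 0 ->
  par (sig (X6 *m sig (X5 *m pol (ei K i) d)))
      (Y1 *m sig (Y2 *m pol (ei K m) (Y3 *m pol (Y4 *m ei K i) (Y4 *m d)))).
Proof.
move=> rel mE k0; set c := Y4 *m ei K i in mE *; set e := Y4 *m d.
set u := Y3 *m pol c e; set u' := Y3 *m sig e.
(* As [sig e_i = 0], [sig (e_i + s d) = s V(s)]. On the other side [Y3 sig Y4] maps [e_i + s d] to
   [k e_m + s U(s)], and [sig] of this is [s V'(s)]. *)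
pose V := line (pol (ei K i) d) (sig d).
pose U := line u u'.
pose V' := k%:P *: pol (map_mx polyC (ei K m)) U + 'X *: sig U.
have VE s : evmx s V = pol (ei K i) d + s *: sig d by rewrite evmx_line.
have V'E s : evmx s V' = k *: pol (ei K m) (u + s *: u') + s *: sig (u + s *: u').
  by rewrite -evmx_line; apply/colP => a; rewrite !mxE /horner_eval !hornerE.
have pF : pmap (fun x => sig (X6 *m sig (X5 *m x))) by exact: (pmap_fwd [:: X5; X6]).
have pH : pmap (fun x => Y1 *m sig (Y2 *m x)).
  by apply: pmap_comp (pmap_comp (pmap_mul Y2) (@pmap_sig K)) (pmap_mul Y1).
have := @par_curve _ _ V V' pF pH; rewrite VE V'E !scale0r !addr0 => lim.
have {}lim := lim _; rewrite -scalemxAr sigZ -scalemxAr -[sig (X6 *m _)]scale1r in lim.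
apply: (par_scale_inv _ _ (lim _)); rewrite ?oner_eq0 ?expf_neq0 // => s s0.
have sE : sig (ei K i + s *: d) = s *: evmx s V.
  have := sigD (ei K i) d 1 s; rewrite scale1r sig_ei scaler0 add0r mul1r => ->.
  by rewrite VE scalerDr scalerA expr2.
have s'E : sig (Y3 *m sig (Y4 *m (ei K i + s *: d))) = s *: evmx s V'.
  rewrite mulmxDr -scalemxAr -/c -/e.
  have := sigD c e 1 s; rewrite !scale1r mul1r expr1n scale1r => ->.
  rewrite !mulmxDr -!scalemxAr mE -/u -/u' -addrA expr2 -scalerA -scalerDr.
  rewrite sigD sig_ei scaler0 add0r V'E scalerDr !scalerA expr2.
  by rewrite [s * k]mulrC.
have := rel (ei K i + s *: d); rewrite sE s'E -!scalemxAr !sigZ -!scalemxAr !sigZ -?scalemxAr.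
by apply: par_scale_inv; rewrite !expf_neq0.
Qed.

Lemma pol_ei_other (m k : 'I_3) : k != m ->
  exists2 k', k' != m & pol (ei K m) (ei K k') = ei K k.
Proof.
move=> km; have [kE|kE] : k = m + 1 \/ k = m + 2.
  by move: km; elim/ord3P: m; elim/ord3P: k; rewrite ?ord3_add //; auto.
  exists (m + 2); first by elim/ord3P: (m); rewrite ?ord3_add.
  rewrite kE; apply/colP => j; rewrite !mxE eqxx !andbT.
  by elim/ord3P: (m); elim/ord3P: j; rewrite !ord3_add /=; ring.
exists (m + 1); first by elim/ord3P: (m); rewrite ?ord3_add.
rewrite kE; apply/colP => j; rewrite !mxE eqxx !andbT.
by elim/ord3P: (m); elim/ord3P: j; rewrite !ord3_add /=; ring.
Qed.

Lemma pol_ei_decomp i d :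
  pol (ei K i) d = d (i + 2) 0 *: ei K (i + 1) + d (i + 1) 0 *: ei K (i + 2).
Proof.
apply/colP => j; rewrite !mxE eqxx !andbT.
by elim/ord3P: i; elim/ord3P: j; rewrite !ord3_add /=; ring.
Qed.

Lemma ord3_rot (i : 'I_3) :
  [/\ i + 1 + 1 = i + 2, i + 1 + 2 = i, i + 2 + 1 = i & i + 2 + 2 = i + 1].
Proof. by elim/ord3P: i; rewrite !ord3_add. Qed.

(* Otherwise some direction at [e_i] is sent to [e_(s5 i)] by the right-hand side of
   [exceptional_limit], but none is by the left-hand side. *)
Lemma tight_perm X1 X2 X3 X4 X5 X6 s1 t1 s3 t3 s5 t5 :
  unitall [:: X1; X2; X3; X4; X5; X6] -> rel_word [:: X1; X2; X3; X4; X5; X6] ->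
  X2 *m hinv X1 = mnm s1 t1 -> X4 *m hinv X3 = mnm s3 t3 -> X6 *m hinv X5 = mnm s5 t5 ->
  (forall i, t1 i != 0) -> (forall i, t3 i != 0) -> (forall i, t5 i != 0) ->
  (forall i j, X1 i j != 0) -> (forall i j, X3 i j != 0) -> (forall i j, X5 i j != 0) ->
  (forall i j, X6 i j != 0) -> (forall i j, invmx X5 i j != 0) ->
  forall i, s3 (s1 (s5 i)) = i.
Proof.
move=> us rel T1 T3 T5 t10 t30 t50 X10 X30 X50 X60 Y50 i.
have /and5P[u1 u2 u3 u4 /and3P[u5 u6 _]] := us.
have relH x : par (sig (X6 *m sig (X5 *m sig x)))
    (invmx X1 *m sig (invmx X2 *m sig (invmx X3 *m sig (invmx X4 *m x)))).
  move: x; apply: generic_par.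
  - apply: pmap_comp (@pmap_sig K) (pmap_fwd [:: X5; X6]).
  - exact: pmap_comp (pmap_mul (invmx X4)) (pmap_bwd [:: invmx X1; invmx X2; invmx X3]).
  apply: genericW generic_pi3 => x px.
  have us4 : unitall [:: X1; X2; X3; X4] by rewrite /= u1 u2 u3 u4.
  have := rel_half (l2 := [:: X5; X6]) us4 rel (sig x); rewrite /= sigK.
  rewrite -!scalemxAr !sigZ -!scalemxAr !sigZ -!scalemxAr !sigZ -!scalemxAr.
  rewrite -{1}[sig (X6 *m _)]scale1r; apply: par_scale_inv; rewrite ?oner_eq0 ?expf_neq0 //.
apply/eqP; rewrite -[_ == _]negbK; apply/negP => ne.
pose m := (s3^-1)%g i; have mE : s3 m = i by rewrite permKV.
have ne_rm : s1 (s5 i) != m by rewrite -(inj_eq (@perm_inj _ s3)) mE.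
have [k k0 kE] := tight_bwd u3 u4 T3 X30 t30 m; rewrite mE in kE.
have [w w0 wE] := tight_bwd u1 u2 T1 X10 t10 (s5 i).
have lim := exceptional_limit _ relH kE k0.
set c := invmx X4 *m ei K i in kE lim.
have c0 j : c j 0 != 0 by rewrite /c -colE mxE (tight_inv_full u4 T3).
have [k' ne_k'm k'E] := pol_ei_other ne_rm.
(* The direction [d0] that the right-hand side sends to [e_(s5 i)] is found backwards: the
   exceptional line over [e_m] has to be met in direction [e_k'], to which a multiple of [e_m] may
   be added because [pol e_m e_m = 0]. *)
have [dl [l dlE]] := pol_solve (X3 *m ei K k') c0.
pose d0 := X4 *m dl.
pose W d := invmx X1 *m sig (invmx X2 *m pol (ei K m) (invmx X3 *m pol c (invmx X4 *m d))).
have upE : invmx X3 *m pol c dl = ei K k' + (l * k) *: ei K m.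
  by rewrite dlE mulmxDr -scalemxAr kE mulKmx // scalerA.
have Wd0 : W d0 = w *: ei K (s5 i).
  by rewrite /W mulKmx // upE polDr pol_ei_self scaler0 addr0 k'E.
pose a d : K := d (i + 2) 0; pose b d : K := d (i + 1) 0.
pose n := X6 *m pol (X5 *m ei K (i + 1)) (X5 *m ei K (i + 2)).
pose g := pi3 (X5 *m ei K (i + 1)) * t5 (i + 1).
pose g' := pi3 (X5 *m ei K (i + 2)) * t5 (i + 2).
have g0 j : pi3 (X5 *m ei K j) * t5 j != 0.
  by rewrite /pi3 -!colE ![col _ _ _ _]mxE !mulf_neq0.
have uE al be : X6 *m sig (X5 *m (al *: ei K (i + 1) + be *: ei K (i + 2))) =
    (al ^+ 2 * g) *: ei K (s5 (i + 1)) + (al * be) *: n + (be ^+ 2 * g') *: ei K (s5 (i + 2)).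
  rewrite mulmxDr -!scalemxAr sigD !mulmxDr -!scalemxAr -/n.
  by rewrite !(tight_fwd T5) // !scalerA.
have [s_01 s_02 s_12] : [/\ s5 i != s5 (i + 1), s5 i != s5 (i + 2) & s5 (i + 1) != s5 (i + 2)].
  by rewrite !(inj_eq perm_inj); elim/ord3P: (i); rewrite !ord3_add.
pose u al be := X6 *m sig (X5 *m (al *: ei K (i + 1) + be *: ei K (i + 2))).
have u_0 al be : u al be (s5 i) 0 = al * be * n (s5 i) 0.
  by rewrite /u uE !mxE !eqxx (negPf s_01) (negPf s_02) /=; ring.
have u_1 al be : u al be (s5 (i + 1)) 0 = al * (al * g + be * n (s5 (i + 1)) 0).
  rewrite /u uE !mxE !eqxx (negPf s_12) /=; ring.
have u_2 al be : u al be (s5 (i + 2)) 0 = be * (be * g' + al * n (s5 (i + 2)) 0).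
  rewrite /u uE !mxE !eqxx [s5 (i + 2) == _]eq_sym (negPf s_12) /=; ring.
have v_neq0 (v : 'cV[K]_3) : v i 0 = 0 -> v != 0 -> sig (X5 *m v) != 0.
  move=> vi v0; apply/eqP => /sig_eq0P[j]; move: (_ j 0) => e E.
  have vE : v = e *: (invmx X5 *m ei K j) by rewrite scalemxAr -E mulKmx.
  move: vi v0; rewrite vE -colE !mxE => /eqP; rewrite mulf_eq0 (negPf (Y50 _ _)) orbF.
  by move=> /eqP->; rewrite scale0r eqxx.
pose vv al be : 'cV[K]_3 := al *: ei K (i + 1) + be *: ei K (i + 2).
have vvE al be : [/\ vv al be i 0 = 0, vv al be (i + 1) 0 = al & vv al be (i + 2) 0 = be].
  by rewrite !mxE !eqxx !andbT; elim/ord3P: (i); rewrite !ord3_add /=; split; ring.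
(* Test at the point of the line [x_i = 0] whose image under [X5] has coordinate [0] equal to zero:
   there [u] is a nonzero multiple of a column of [X6], which has no zero entry. *)
have n0 : n (s5 i) 0 != 0.
  pose al := X5 0 (i + 2); pose be := - X5 0 (i + 1).
  have [vi v1 v2] := vvE al be.
  have v0 : vv al be != 0.
    by apply/eqP => v0; have := X50 0 (i + 2); rewrite -/al -v1 v0 mxE eqxx.
  have x0 : (X5 *m vv al be) 0 0 = 0.
    by rewrite mulmxDr -!scalemxAr -!colE !mxE /al /be; ring.
  have := v_neq0 _ vi v0; rewrite (sig_eq0_coord x0) scaler_eq0 negb_or => /andP[e0 _].
  have := u_0 al be; rewrite /u -/(vv al be) (sig_eq0_coord x0) -scalemxAr -colE.
  rewrite mxE [col _ _ _ _]mxE => E; apply: contraNneq e0 => n0.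
  by move/eqP: E; rewrite n0 mulr0 mulf_eq0 (negPf (X60 _ _)) orbF.
have LE d : sig (X6 *m sig (X5 *m pol (ei K i) d)) = sig (u (a d) (b d)).
  by rewrite pol_ei_decomp.
have [r1 r2 r3 r4] := ord3_rot i.
have pW : pmap W.
  have p4 := pmap_comp (pmap_mul (invmx X4)) (pmap_pol c).
  have p3 := pmap_comp (pmap_comp p4 (pmap_mul (invmx X3))) (pmap_pol (ei K m)).
  exact: pmap_comp p3 (pmap_comp (pmap_comp (pmap_mul (invmx X2)) (@pmap_sig K)) (pmap_mul (invmx X1))).
have gab : generic (fun d : 'cV[K]_3 => a d * b d != 0).
  apply: genericW (genericI (generic_coord _ (i + 2)) (generic_coord _ (i + 1))) => d [].
  exact: mulf_neq0.
have pa : pfun a by apply: pfun_coord.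
have pb : pfun b by apply: pfun_coord.
(* Two minors of the limit relation, with the common factor [a b] of the coordinates of [sig u]
   cancelled. Otherwise they would be empty at [d0] if [a] or [b] vanished there. *)
pose f1 d := b d * (b d * g' + a d * n (s5 (i + 2)) 0) * n (s5 i) 0 * W d (s5 i) 0.
pose f1' d := (a d * g + b d * n (s5 (i + 1)) 0) * (b d * g' + a d * n (s5 (i + 2)) 0)
               * W d (s5 (i + 1)) 0.
pose f2 d := a d * (a d * g + b d * n (s5 (i + 1)) 0) * n (s5 i) 0 * W d (s5 i) 0.
pose f2' d := (a d * g + b d * n (s5 (i + 1)) 0) * (b d * g' + a d * n (s5 (i + 2)) 0)
               * W d (s5 (i + 2)) 0.
have e1 d : f1 d - f1' d = 0.
  move: d; apply: generic_eq0.
    by apply/pfunB; do ![apply/pfunM|apply/pfunD|apply: pa|apply: pb|apply: pfun_const|apply: pW].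
  apply: genericW gab => d ab0; have := lim d (s5 (i + 1)) (s5 i).
  rewrite LE !sig_perm r1 r2 -/(W d) u_0 u_1 u_2 => E.
  by apply: (mulfI ab0); move/eqP: E; rewrite -subr_eq0 mulr0 => /eqP <-; rewrite /f1 /f1'; ring.
have e2 d : f2 d - f2' d = 0.
  move: d; apply: generic_eq0.
    by apply/pfunB; do ![apply/pfunM|apply/pfunD|apply: pa|apply: pb|apply: pfun_const|apply: pW].
  apply: genericW gab => d ab0; have := lim d (s5 (i + 2)) (s5 i).
  rewrite LE !sig_perm r3 r4 -/(W d) u_0 u_1 u_2 => E.
  by apply: (mulfI ab0); move/eqP: E; rewrite -subr_eq0 mulr0 => /eqP <-; rewrite /f2 /f2'; ring.
have Wr : W d0 (s5 i) 0 = w by rewrite Wd0 !mxE !eqxx mulr1.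
have Wr1 : W d0 (s5 (i + 1)) 0 = 0 by rewrite Wd0 !mxE eq_sym (negPf s_01) mulr0.
have Wr2 : W d0 (s5 (i + 2)) 0 = 0 by rewrite Wd0 !mxE eq_sym (negPf s_02) mulr0.
have := e1 d0; have := e2 d0; rewrite /f1 /f1' /f2 /f2' Wr Wr1 Wr2 !mulr0 !subr0.
move/eqP; rewrite !mulf_eq0 (negPf n0) (negPf w0) !orbF => /orP E2.
move/eqP; rewrite !mulf_eq0 (negPf n0) (negPf w0) !orbF => /orP E1.
(* Otherwise [d0] is a multiple of [e_i], so [dl] is one of [c] and [invmx X3 *m pol c dl] one of
   [e_m], although its coordinate [k'] is [1]. *)
have v0 : pol (ei K i) d0 != 0.
  apply/eqP => v0; have [_ d2 d1] := pol_eiE i d0; rewrite v0 !mxE in d1 d2.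
  have dE : d0 = 0 + d0 i 0 *: ei K i.
    rewrite add0r; apply/colP => j; rewrite !mxE eqxx andbT; move: d1 d2.
    by elim/ord3P: (i); elim/ord3P: j; rewrite !ord3_add /= ?(mulr0, mulr1) // => <- <-.
  have dlE' : dl = 0 + d0 i 0 *: c.
    by rewrite -[dl](mulKmx u4) -/d0 {1}dE !add0r -scalemxAr.
  have polcc : pol c c = sig c + sig c by apply/colP => j; rewrite !mxE; ring.
  have pol0 : pol c 0 = 0 by apply/colP => j; rewrite !mxE; ring.
  have := upE; rewrite dlE' polDr pol0 add0r polcc -scalemxAr mulmxDr kE.
  move=> /colP/(_ k'); rewrite !mxE !eqxx (negPf ne_k'm) !mulr0 !addr0 => /eqP.
  by rewrite mulr0 eq_sym oner_eq0.
have vE := pol_ei_decomp i d0; rewrite -/(a d0) -/(b d0) in vE.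
have vi : pol (ei K i) d0 i 0 = 0 by case: (pol_eiE i d0).
case: E1 => [/eqP b0|E1].
  case: E2 => [/eqP a0|/eqP]; first by move/eqP: v0; rewrite vE a0 b0 !scale0r addr0.
  rewrite b0 mul0r addr0 => /eqP; rewrite mulf_eq0 (negPf (g0 _)) orbF => /eqP a0.
  by move/eqP: v0; rewrite vE a0 b0 !scale0r addr0.
case: E2 => [/eqP a0|E2].
  move: E1; rewrite a0 mul0r addr0 mulf_eq0 (negPf (g0 _)) orbF => /eqP b0.
  by move/eqP: v0; rewrite vE a0 b0 !scale0r addr0.
have u1E := u_1 (a d0) (b d0); rewrite (eqP E2) mulr0 in u1E.
have u2E := u_2 (a d0) (b d0); rewrite (eqP E1) mulr0 in u2E.
have : sig (u (a d0) (b d0)) = 0.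
  apply/colP => j; rewrite -[j](permKV s5) [RHS]mxE sig_perm; move: (_ j) => {}j.
  have [->|[->|->]] : j = i \/ j = i + 1 \/ j = i + 2.
    by elim/ord3P: (i); elim/ord3P: j; rewrite ?ord3_add; auto.
  - by rewrite u1E mul0r.
  - by rewrite r1 u2E mul0r.
  - by rewrite r4 u1E mulr0.
case/sig_eq0P => j uj.
have sv := v_neq0 _ vi v0.
have uj0 : u (a d0) (b d0) j 0 != 0.
  move: sv; rewrite -(mulmx_eq0 _ u6) vE -/(u (a d0) (b d0)) uj scaler_eq0 negb_or.
  by case/andP => uj0 _; rewrite -uj.
have jE : j = s5 i.
  apply/eqP; rewrite -[_ == _]negbK; apply/negP => ji; move: uj0.
  have [jE|jE] : j = s5 (i + 1) \/ j = s5 (i + 2).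
    move: ji; rewrite -[j](permKV s5) !(inj_eq perm_inj); move: (_ j) => k2.
    by elim/ord3P: (i); elim/ord3P: k2; rewrite !ord3_add //; auto.
    by rewrite jE u1E eqxx.
  by rewrite jE u2E eqxx.
(* So the point [pol e_i d0], which lies on the line [x_i = 0], has the same image as [e_i], which
   does not. Undoing [X6], [sig] and [X5] identifies the two points. *)
have pu : par (X6 *m sig (X5 *m pol (ei K i) d0)) (X6 *m sig (X5 *m ei K i)).
  by rewrite vE -/(u (a d0) (b d0)) uj jE (tight_fwd T5) //; apply/parZl/parZr/par_refl.
have {}pu := par_mul (invmx X6) pu; rewrite !mulKmx // in pu.
have := par_sig_sym sv _ pu; rewrite sigK scaler_eq0 negb_or mulmx_eq0 // ei_neq0 andbT.
have pi0 : pi3 (X5 *m ei K i) != 0 by have := g0 i; rewrite mulf_eq0 negb_or => /andP[].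
move=> /(_ pi0) pp; have {}pp : par (X5 *m pol (ei K i) d0) (X5 *m ei K i).
  by apply: (par_scale_inv (oner_neq0 K) pi0); rewrite scale1r.
have {}pp := par_mul (invmx X5) pp; rewrite !mulKmx // in pp.
move/eqP: v0; apply; apply/colP => j'; have := pp j' i.
by rewrite vi mul0r eiE eqxx mulr1 => ->; rewrite mxE.
Qed.

End TightPermutations.

(** * Entries and determinants of tight pairs *)

Section Adj3.

Variable R : comNzRingType.

(** The adjugate, with cyclic indices in place of signs, in a form that [ring] and [field] can
    expand. *)
Definition adj3 (A : 'M[R]_3) : 'M[R]_3 := \matrix_(k, i)
  (A (i + 1) (k + 1) * A (i + 2) (k + 2) - A (i + 1) (k + 2) * A (i + 2) (k + 1)).

Lemma det3 (A : 'M[R]_3) : \det A = \sum_k A 0 k * adj3 A k 0.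
Proof.
pose F m n := A (inord m) (inord n).
have -> : A = \matrix_(i, j) F i j by apply/matrixP => i j; rewrite mxE /F !inord_val.
have e0 : nat_of_ord (0 : 'I_3) = 0%N by [].
have e1 : nat_of_ord (1 : 'I_3) = 1%N by [].
have e2 : nat_of_ord (2 : 'I_3) = 2%N by [].
rewrite [RHS]big_ord3 /= !mxE !ord3_add e0 e1 e2.
rewrite (expand_det_row _ 0) !big_ord_recl !big_ord0 /cofactor.
rewrite !(expand_det_row _ 0) !big_ord_recl !big_ord0 /cofactor !det_mx11 !mxE /=.
rewrite /bump /= !addn0 ?addn1 ?add1n /=.
by rewrite !expr2 !expr1 !expr0; ring.
Qed.

Lemma mul_adj3 (A : 'M[R]_3) : A *m adj3 A = (\det A)%:M.
Proof.
apply/matrixP => i k; rewrite det3 !mxE !big_ord3 /= !mxE.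
by elim/ord3P: i; elim/ord3P: k; rewrite !ord3_add /= ?mulr1n ?mulr0n; ring.
Qed.

End Adj3.

Section Tight.

Variable K : closedFieldType.
Implicit Types (X : 'M[K]_3) (t : 'I_3 -> K).

Definition rowp X i := \prod_k X i k.
Definition colp X k := \prod_i X i k.
Definition allp X := \prod_i rowp X i.
Definition tau t := \prod_i t i.
Definition diag3 t : 'M[K]_3 := \matrix_(i, j) (t j *+ (i == j)).
Definition full X := forall i j, X i j != 0.

Lemma allp_col X : allp X = \prod_k colp X k.
Proof. exact: exchange_big. Qed.

Lemma rowp_neq0 X i : full X -> rowp X i != 0.
Proof. by move=> fX; apply/prodf_neq0 => k _. Qed.

Lemma colp_neq0 X i : full X -> colp X i != 0.
Proof. by move=> fX; apply/prodf_neq0 => k _. Qed.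

Lemma allp_neq0 X : full X -> allp X != 0.
Proof. by move=> fX; apply/prodf_neq0 => k _; apply: rowp_neq0. Qed.

Lemma tau_neq0 t : (forall i, t i != 0) -> tau t != 0.
Proof. by move=> t0; apply/prodf_neq0 => k _. Qed.

Lemma adj3_inv X : X \in unitmx -> adj3 X = \det X *: invmx X.
Proof.
move=> uX; apply: (can_inj (mulKmx uX)).
by rewrite mul_adj3 -scalemxAr mulmxV // scalemx1.
Qed.

Lemma det_diag3 t : \det (diag3 t) = tau t.
Proof.
have -> : diag3 t = diag_mx (\row_i t i).
  by apply/matrixP => i j; rewrite !mxE; case: eqP => [->|].
by rewrite det_diag; apply: eq_bigr => i _; rewrite mxE.
Qed.

Lemma diag3_mul t X i k : (diag3 t *m X) i k = t i * X i k.
Proof.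
rewrite mxE (bigD1 i) //= mxE eqxx mulr1n big1 ?addr0 // => j ji.
by rewrite mxE eq_sym (negPf ji) mul0r.
Qed.

(** A minor of [hinv X] is [1/(a d) - 1/(b c) = - (a d - b c)/(a b c d)], and the four entries
    involved are those outside row [i] and column [k]. *)
Lemma adj3_hinv X i k : full X ->
  adj3 (hinv X) k i * (allp X * X i k) = - (adj3 X k i * (rowp X i * colp X k)).
Proof.
move=> fX; rewrite /allp /rowp /colp !big_ord3 /= !mxE.
have := ((fX 0 0, fX 0 1, fX 0 2), (fX 1 0, fX 1 1, fX 1 2), (fX 2 0, fX 2 1, fX 2 2)).
case=> [[[[a0 a1] a2] [[b0 b1] b2]] [[c0 c1] c2]].
by elim/ord3P: i; elim/ord3P: k; rewrite !ord3_add; field;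
   rewrite ?a0 ?a1 ?a2 ?b0 ?b1 ?b2 ?c0 ?c1 ?c2.
Qed.

Definition tight_factor X X' t := - (\det X * \det X') / (allp X * tau t).

(** [X'] is [diag3 t] times the inverse of [hinv X], and [adj3_hinv] expresses the adjugate of
    [hinv X] through that of [X]. *)
Lemma tight_mul X X' t : X \in unitmx -> X' \in unitmx -> full X -> (forall i, t i != 0) ->
  X' *m hinv X = diag3 t -> forall i k,
  X' k i * X i k = tight_factor X X' t * rowp X i * colp X k * t k * invmx X k i.
Proof.
move=> uX uX' fX t0 E i k.
have tau0 := tau_neq0 t0; have all0 := allp_neq0 fX; have ik0 := fX i k.
have dE : \det X' * \det (hinv X) = tau t by rewrite -det_mulmx E det_diag3.
have uh : hinv X \in unitmx.
  by rewrite unitmxE unitfE; apply: contraNneq tau0 => d0; rewrite -dE d0 mulr0.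
have X'E : \det (hinv X) * X' k i = t k * adj3 (hinv X) k i.
  have -> : X' = diag3 t *m invmx (hinv X) by rewrite -E mulmxK.
  by rewrite diag3_mul adj3_inv // mxE; ring.
have d0 : \det (hinv X) != 0 by rewrite -unitfE -unitmxE.
apply: (mulfI d0); rewrite mulrA X'E.
have aE := adj3_hinv i k fX; rewrite [X in _ = - (X * _)](_ : _ = \det X * invmx X k i) in aE; last first.
  by rewrite adj3_inv // mxE.
apply: (mulfI all0).
transitivity (t k * (adj3 (hinv X) k i * (allp X * X i k))); first by ring.
rewrite aE /tight_factor -dE; have d0' : \det X' != 0 by rewrite -unitfE -unitmxE.
by field; rewrite all0 d0 d0'.
Qed.

Lemma tight_inv_diag X X' t : X' \in unitmx -> full X -> (forall i, t i != 0) ->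
  X' *m hinv X = diag3 t -> forall i k, invmx X' i k = (X i k * t k)^-1.
Proof.
move=> uX' fX t0 E i k.
have : invmx X' *m diag3 t = hinv X by rewrite -E mulKmx.
move/matrixP/(_ i k); rewrite mxE (bigD1 k) //= !mxE eqxx mulr1n big1 ?addr0; last first.
  by move=> j jk; rewrite mxE (negPf jk) mulr0.
by move=> e; rewrite invfM -e mulfK.
Qed.

(** The preceding tight pair turns the entry of [invmx X1] into the inverse of an entry of [X0].
    Thus a product of entries of three consecutive matrices splits into a function of [i] and a
    function of [k]. *)
Lemma tight_mul3 X0 X1 X2 t0 t1 : X1 \in unitmx -> X2 \in unitmx ->
  full X0 -> full X1 -> (forall i, t0 i != 0) -> (forall i, t1 i != 0) ->
  X1 *m hinv X0 = diag3 t0 -> X2 *m hinv X1 = diag3 t1 ->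
  forall i k, X2 k i * X1 i k * (X0 k i * t0 i) = tight_factor X1 X2 t1 * rowp X1 i * colp X1 k * t1 k.
Proof.
move=> u1 u2 f0 f1 t00 t10 E0 E1 i k.
rewrite (tight_mul u1 u2 f1 t10 E1) (tight_inv_diag u1 f0 t00 E0) mulfVK //.
by rewrite mulf_neq0.
Qed.

Definition tight_quad_row X2 X3 t1 t3 k := colp X3 k * t3 k * t1 k / rowp X2 k.

Definition tight_quad_col X2 X3 t2 i := rowp X3 i / (colp X2 i * t2 i ^+ 2).

(** Dividing two consecutive instances of [tight_mul3] removes [X2] and [X3]: up to scaling of rows
    and columns, [X4] is the transpose of [X1]. *)
Lemma tight_quad X1 X2 X3 X4 t1 t2 t3 : X2 \in unitmx -> X3 \in unitmx -> X4 \in unitmx ->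
  full X1 -> full X2 -> full X3 ->
  (forall i, t1 i != 0) -> (forall i, t2 i != 0) -> (forall i, t3 i != 0) ->
  X2 *m hinv X1 = diag3 t1 -> X3 *m hinv X2 = diag3 t2 -> X4 *m hinv X3 = diag3 t3 ->
  tight_factor X2 X3 t2 != 0 ->
  forall i k, X4 k i = tight_factor X3 X4 t3 / tight_factor X2 X3 t2 * X1 i k *
     (tight_quad_row X2 X3 t1 t3 k * tight_quad_col X2 X3 t2 i).
Proof.
move=> u2 u3 u4 f1 f2 f3 t10 t20 t30 E1 E2 E3 h20 i k.
have := tight_mul3 u3 u4 f2 f3 t20 t30 E2 E3 i k.
have := tight_mul3 u2 u3 f1 f2 t10 t20 E1 E2 k i.
have r2 := rowp_neq0 k f2; have c2 := colp_neq0 i f2; rewrite /tight_quad_row /tight_quad_col.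
have x1 := f1 i k; have x2 := f2 k i; have x3 := f3 i k; have t1k := t10 k; have t2i := t20 i.
set h2 := tight_factor X2 _ _ in h20 *; set h3 := tight_factor X3 _ _.
move=> e2 e3.
have nz : X3 i k * X2 k i * (X1 i k * t1 k) != 0 by rewrite !mulf_neq0.
have nz' : h2 * rowp X2 k * colp X2 i * t2 i != 0 by rewrite -e2.
apply: (mulfI nz).
transitivity (X1 i k * t1 k / t2 i * (X4 k i * X3 i k * (X2 k i * t2 i))); first by field.
rewrite e3 e2.
by field; rewrite h20 c2 t2i r2.
Qed.

Lemma det_rank1 (A : 'M[K]_3) (a : K) (u v : 'I_3 -> K) :
  \det (\matrix_(k, i) (a * A i k * (u k * v i))) = a ^+ 3 * \det A * (tau u * tau v).
Proof.
have -> : \matrix_(k, i) (a * A i k * (u k * v i)) =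
   a *: (diag3 u *m A^T *m diag3 v).
  apply/matrixP => k i; rewrite !mxE (bigD1 i) //= [diag3 v _ _]mxE eqxx mulr1n big1 ?addr0.
    by rewrite diag3_mul mxE; ring.
  by move=> j ji; rewrite [diag3 v _ _]mxE (negPf ji) mulr0.
by rewrite detZ !det_mulmx !det_diag3 det_tr; ring.
Qed.

End Tight.

(** * Identities around a tight cycle of six matrices *)

Section TightCycle.

Variables (K : closedFieldType).
Variables (X : 'I_6 -> 'M[K]_3) (t : 'I_6 -> 'I_3 -> K).
Hypothesis uX : forall j, X j \in unitmx.
Hypothesis fX : forall j, full (X j).
Hypothesis t0 : forall j i, t j i != 0.
Hypothesis XE : forall j, X (j + 1) *m hinv (X j) = diag3 (t j).

Let d j := \det (X j).
Let p j := allp (X j).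
Let u j := tau (t j).
Let h j := tight_factor (X j) (X (j + 1)) (t j).
Let R j := rowp (X j).
Let C j := colp (X j).

Lemma ord6D (j : 'I_6) :
  (j + 1 + 1 = j + 2) * (j + 2 + 1 = j + 3) * (j + 3 + 1 = j + 4) *
  (j + 4 + 1 = j + 5) * (j + 5 + 1 = j) * (j + 5 + 2 = j + 1) * (j + 3 + 3 = j) *
  (j + 3 + 2 = j + 5) * (j + 4 + 2 = j) * (j + 1 + 5 = j) * (j + 2 + 5 = j + 1) *
  (j + 1 + 2 = j + 3) * (j + 1 + 3 = j + 4) * (j + 1 + 4 = j + 5) * (j + 2 + 2 = j + 4) *
  (j + 3 + 5 = j + 2) * (j + 4 + 5 = j + 3) * (j + 5 + 5 = j + 4).
Proof. by case: j => [[|[|[|[|[|[|//]]]]]] lt_j]; do !split; apply: val_inj. Qed.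

Let d_neq0 j : d j != 0. Proof. exact: unit_det_neq0. Qed.
Let p_neq0 j : p j != 0. Proof. exact: allp_neq0. Qed.
Let u_neq0 j : u j != 0. Proof. exact: tau_neq0. Qed.
Let R_neq0 j i : R j i != 0. Proof. exact: rowp_neq0. Qed.
Let C_neq0 j i : C j i != 0. Proof. exact: colp_neq0. Qed.
Let h_neq0 j : h j != 0.
Proof.
rewrite /h /tight_factor mulf_neq0 ?invr_eq0 ?oppr_eq0 //; apply: mulf_neq0; solve
  [exact: unit_det_neq0|exact: allp_neq0|exact: tau_neq0].
Qed.

Let tight_mul3E j i k : X (j + 2) k i * X (j + 1) i k * (X j k i * t j i) =
  h (j + 1) * R (j + 1) i * C (j + 1) k * t (j + 1) k.
Proof. by rewrite -(tight_mul3 (uX _) (uX _) _ _ _ _ (XE j) (XE (j + 1))) // !ord6D. Qed.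

Let tight_quadE j i k : X (j + 3) k i = h (j + 2) / h (j + 1) * X j i k *
  (C (j + 2) k * t (j + 2) k * t j k / R (j + 1) k *
   (R (j + 2) i / (C (j + 1) i * t (j + 1) i ^+ 2))).
Proof.
have E1 := XE (j + 1); have E2 := XE (j + 2); rewrite !ord6D in E1 E2.
rewrite (tight_quad (uX _) (uX _) (uX _) _ _ _ _ _ _ (XE j) E1 E2) //.
  by rewrite /h !ord6D.
by have := h_neq0 (j + 1); rewrite /h !ord6D.
Qed.

Let detE j : d (j + 3) = (h (j + 2) / h (j + 1)) ^+ 3 * d j *
  (p (j + 2) * u (j + 2) * u j / p (j + 1) * (p (j + 2) / (p (j + 1) * u (j + 1) ^+ 2))).
Proof.
have -> : d (j + 3) = \det (\matrix_(k, i) (h (j + 2) / h (j + 1) * X j i k *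
   (C (j + 2) k * t (j + 2) k * t j k / R (j + 1) k *
   (R (j + 2) i / (C (j + 1) i * t (j + 1) i ^+ 2))))).
  by congr (\det _); apply/matrixP => k i; rewrite mxE -tight_quadE.
rewrite det_rank1; congr (_ * (_ * _)); rewrite [LHS]/tau.
  by rewrite !big_split /= prodfV /R /C -allp_col.
by rewrite big_split /= prodfV big_split /= prodrXl /R /C -allp_col.
Qed.

Let prodE j : p (j + 2) * p (j + 1) * (p j * u j ^+ 3) =
  h (j + 1) ^+ 9 * p (j + 1) ^+ 6 * u (j + 1) ^+ 3.
Proof.
have : \prod_i \prod_k (X (j + 2) k i * X (j + 1) i k * (X j k i * t j i)) =
  \prod_i \prod_k (h (j + 1) * R (j + 1) i * C (j + 1) k * t (j + 1) k).
  by apply: eq_bigr => i _; apply: eq_bigr => k _.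
have L : \prod_i \prod_k (X (j + 2) k i * X (j + 1) i k * (X j k i * t j i)) =
    p (j + 2) * p (j + 1) * (p j * u j ^+ 3).
  under eq_bigr => i _ do rewrite !big_split /= prodr_const card_ord.
  rewrite !big_split /= /p /u (allp_col (X (j + 2))) (allp_col (X j)).
  by rewrite /allp /colp /rowp /tau; ring.
have Rr : \prod_i \prod_k (h (j + 1) * R (j + 1) i * C (j + 1) k * t (j + 1) k) =
    h (j + 1) ^+ 9 * p (j + 1) ^+ 6 * u (j + 1) ^+ 3.
  have pC : \prod_k C (j + 1) k = p (j + 1) by rewrite /p allp_col.
  have pR : \prod_k R (j + 1) k = p (j + 1) by [].
  move: (h (j + 1)) => hh.
  under eq_bigr => i _ do rewrite !big_split /= !prodr_const !card_ord pC.
  by rewrite !big_split /= !prodr_const !card_ord pR -/(tau _) -/(u _); ring.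
by rewrite L Rr.
Qed.

Lemma ord6_add : (1 + 1 = 2 :> 'I_6)%R * (1 + 2 = 3 :> 'I_6)%R * (1 + 3 = 4 :> 'I_6)%R *
  (1 + 4 = 5 :> 'I_6)%R * (1 + 5 = 0 :> 'I_6)%R * (2 + 1 = 3 :> 'I_6)%R *
  (2 + 2 = 4 :> 'I_6)%R * (2 + 3 = 5 :> 'I_6)%R * (3 + 1 = 4 :> 'I_6)%R *
  (3 + 2 = 5 :> 'I_6)%R * (3 + 3 = 0 :> 'I_6)%R * (4 + 1 = 5 :> 'I_6)%R *
  (4 + 2 = 0 :> 'I_6)%R * (4 + 3 = 1 :> 'I_6)%R * (4 + 4 = 2 :> 'I_6)%R *
  (2 + 5 = 1 :> 'I_6)%R * (3 + 5 = 2 :> 'I_6)%R * (5 + 5 = 4 :> 'I_6)%R *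
  (4 + 5 = 3 :> 'I_6)%R * (5 + 1 = 0 :> 'I_6)%R * (5 + 2 = 1 :> 'I_6)%R * (5 + 3 = 2 :> 'I_6)%R.
Proof. by do !split; apply: val_inj. Qed.

Let hE j : h j = - (d j * d (j + 1)) / (p j * u j). Proof. by []. Qed.

(** In [detE] at [1], [3], [5] the cubed factors [d 4 / d 2], [d 0 / d 4] and [d 2 / d 0] multiply
    to [1]. *)
Lemma det_ratio : d 0 * d 2 * d 4 / (d 1 * d 3 * d 5) =
  (p 0 * p 2 * p 4 * (u 0 * u 2 * u 4)) / (p 1 * p 3 * p 5 * (u 1 * u 3 * u 5)).
Proof.
have := (detE 1, detE 3, detE 5); rewrite !hE !ord6_add !add0r => -[[e1 e3] e5].
have f j := (d_neq0 j, p_neq0 j, u_neq0 j).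
have [[[[[f0 f1] f2] f3] f4] f5] := (f 0, f 1, f 2, f 3, f 4, f 5).
have -> : d 0 * d 2 * d 4 / (d 1 * d 3 * d 5) = (d 4 / d 1) * (d 0 / d 3) * (d 2 / d 5).
  by field; rewrite !f1 !f3 !f5.
have {}e1 : d 4 / d 1 = (d 4 / d 2) ^+ 3 * (p 2 / p 3) * (u 2 * u 1 / u 3 ^+ 2).
  rewrite {1}e1; field; by rewrite ?f1 ?f2 ?f3 ?f4 ?f5 ?f0 ?oppr_eq0 ?mulf_neq0 ?f1 ?f2 ?f3 ?f4 ?f5 ?f0.
have {}e3 : d 0 / d 3 = (d 0 / d 4) ^+ 3 * (p 4 / p 5) * (u 4 * u 3 / u 5 ^+ 2).
  rewrite {1}e3; field; by rewrite ?f1 ?f2 ?f3 ?f4 ?f5 ?f0 ?oppr_eq0 ?mulf_neq0 ?f1 ?f2 ?f3 ?f4 ?f5 ?f0.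
have {}e5 : d 2 / d 5 = (d 2 / d 0) ^+ 3 * (p 0 / p 1) * (u 0 * u 5 / u 1 ^+ 2).
  rewrite {1}e5; field; by rewrite ?f1 ?f2 ?f3 ?f4 ?f5 ?f0 ?oppr_eq0 ?mulf_neq0 ?f1 ?f2 ?f3 ?f4 ?f5 ?f0.
rewrite e1 e3 e5; field.
by rewrite ?f1 ?f2 ?f3 ?f4 ?f5 ?f0.
Qed.

(** With [hE] substituted, [prodE] says [Q j = -1], the sign being that of a ninth power. In the
    alternating product over [j] the signs and all determinants cancel. *)
Lemma prod_ratio : (p 0 * p 2 * p 4 / (p 1 * p 3 * p 5)) ^+ 2 *
  (u 0 * u 2 * u 4 / (u 1 * u 3 * u 5)) ^+ 3 = 1.
Proof.
have f j := (d_neq0 j, p_neq0 j, u_neq0 j).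
have [[[[[f0 f1] f2] f3] f4] f5] := (f 0, f 1, f 2, f 3, f 4, f 5).
pose L j := p (j + 2) * p (j + 1) * (p j * u j ^+ 3).
pose Q j := (p (j + 2) * p j * p (j + 1) ^+ 4 * u j ^+ 3 * u (j + 1) ^+ 6) /
   (d (j + 1) * d (j + 2)) ^+ 9.
have QE j : Q j = -1.
  have L0 : L j != 0 by rewrite !mulf_neq0 ?expf_neq0.
  have := prodE j; rewrite -/(L j) hE !ord6D => E.
  apply: (mulfI L0); rewrite {1}E /Q /L.
  have [[g0 g1] g2] := (f j, f (j + 1), f (j + 2)).
  by field; rewrite ?g0 ?g1 ?g2 ?oppr_eq0 ?mulf_neq0 ?g0 ?g1 ?g2.
have : Q 0 * Q 2 * Q 4 / (Q 1 * Q 3 * Q 5) = 1 by rewrite !QE !mulrNN !mul1r ?invrN invr1; ring.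
rewrite /Q !ord6_add !add0r => /(congr1 GRing.inv); rewrite invr1 => <-.
by field; rewrite ?f1 ?f2 ?f3 ?f4 ?f5 ?f0.
Qed.

(** The exponents make the vertex weights cancel in [eproj i] and in [eproj' k], so that Galois acts
    on them by a permutation and a scalar independent of the index. Both families have the same
    product, which will cancel in [s1 ^+ 3 / s2 ^+ 3]. *)
Definition eproj i : K := R 1 i / (C 0 i * t 0 i ^+ 3).
Definition eproj' k : K := C 1 k / (R 0 k * u 0).

Lemma eproj_prod : \prod_i eproj i = \prod_k eproj' k.
Proof.
have -> : \prod_i eproj i = p 1 / (p 0 * u 0 ^+ 3).
  by rewrite /eproj big_split /= prodfV big_split /= prodrXl /C -allp_col.
rewrite /eproj' big_split /= prodfV big_split /= prodr_const card_ord.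
by rewrite /C -allp_col.
Qed.

(** [tight_quadE] at [j] followed by [j + 3] leads back to the same matrix, so the accumulated
    scalings of rows and columns are trivial, and the factor that depends on [i] is constant. *)
Let close_row j : exists2 c, c != 0 & forall i, t (j + 5) i * t (j + 3) i * C (j + 5) i * R (j + 2) i
   = c * (R (j + 4) i * C (j + 1) i * t (j + 1) i ^+ 2).
Proof.
pose U j k := C (j + 2) k * t (j + 2) k * t j k / R (j + 1) k.
pose V j i := R (j + 2) i / (C (j + 1) i * t (j + 1) i ^+ 2).
pose a j := h (j + 2) / h (j + 1).
have a0 l : a l != 0 by rewrite mulf_neq0 ?invr_eq0.
have U0 l k : U l k != 0 by rewrite !mulf_neq0 ?invr_eq0.
have V0 l k : V l k != 0 by rewrite !mulf_neq0 ?invr_eq0 ?mulf_neq0 ?expf_neq0.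
have E i k : V j i * U (j + 3) i * (a j * a (j + 3) * (U j k * V (j + 3) k)) = 1.
  have := tight_quadE (j + 3) k i; rewrite !ord6D (tight_quadE j i k) => E.
  apply: (mulfI (fX j i k)); rewrite mulr1 [RHS]E /a /U /V !ord6D.
  by ring.
have aU0 : a j * a (j + 3) * (U j 0 * V (j + 3) 0) != 0.
  exact: mulf_neq0 (mulf_neq0 (a0 _) (a0 _)) (mulf_neq0 (U0 _ _) (V0 _ _)).
exists (a j * a (j + 3) * (U j 0 * V (j + 3) 0))^-1; first by rewrite invr_eq0.
move=> i; have := E i 0; move/(canRL (mulfK aU0)); rewrite mul1r => <-.
rewrite /U /V !ord6D; have c1 := C_neq0 (j + 1) i; have r4 := R_neq0 (j + 4) i; have t1 := t0 (j + 1) i.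
by field; rewrite c1 r4 t1.
Qed.

(** [tight_mul3E] multiplied over one index, and in [rcr] over the other. Only the dependence on the
    remaining index matters, so the constant is left unspecified. *)
Let crc j : exists2 c, c != 0 & forall i, C (j + 2) i * C j i * t j i ^+ 3 = c * R (j + 1) i ^+ 2.
Proof.
exists (h (j + 1) ^+ 3 * p (j + 1) * u (j + 1)).
  exact: mulf_neq0 (mulf_neq0 (expf_neq0 3 (h_neq0 _)) (p_neq0 _)) (u_neq0 _).
move=> i; have : \prod_k (X (j + 2) k i * X (j + 1) i k * (X j k i * t j i)) =
  \prod_k (h (j + 1) * R (j + 1) i * C (j + 1) k * t (j + 1) k).
  by apply: eq_bigr => k _.
have -> : \prod_k (X (j + 2) k i * X (j + 1) i k * (X j k i * t j i)) =
    C (j + 2) i * R (j + 1) i * (C j i * t j i ^+ 3).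
  by rewrite !big_split /= prodr_const card_ord.
have -> : \prod_k (h (j + 1) * R (j + 1) i * C (j + 1) k * t (j + 1) k) =
    h (j + 1) ^+ 3 * R (j + 1) i ^+ 3 * p (j + 1) * u (j + 1).
  move: (h _) (R _ i) => a b.
  by rewrite !big_split /= !prodr_const !card_ord /p allp_col.
move=> E; apply: (mulfI (R_neq0 (j + 1) i)).
by transitivity (C (j + 2) i * R (j + 1) i * (C j i * t j i ^+ 3)); [ring|rewrite E; ring].
Qed.

Let rcr j : exists2 c, c != 0 & forall k, R (j + 2) k * R j k = c * (C (j + 1) k ^+ 2 * t (j + 1) k ^+ 3).
Proof.
exists (h (j + 1) ^+ 3 * p (j + 1) / u j).
  by rewrite mulf_neq0 ?invr_eq0 // (mulf_neq0 (expf_neq0 3 (h_neq0 _)) (p_neq0 _)).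
move=> k; have : \prod_i (X (j + 2) k i * X (j + 1) i k * (X j k i * t j i)) =
  \prod_i (h (j + 1) * R (j + 1) i * C (j + 1) k * t (j + 1) k).
  by apply: eq_bigr => i _.
have -> : \prod_i (X (j + 2) k i * X (j + 1) i k * (X j k i * t j i)) =
    R (j + 2) k * C (j + 1) k * (R j k * u j).
  by rewrite !big_split.
have -> : \prod_i (h (j + 1) * R (j + 1) i * C (j + 1) k * t (j + 1) k) =
    h (j + 1) ^+ 3 * p (j + 1) * C (j + 1) k ^+ 3 * t (j + 1) k ^+ 3.
  move: (h _) (C _ k) (t _ k) => a b c.
  by rewrite !big_split /= !prodr_const !card_ord.
move=> E; have uj := u_neq0 j.
apply: (mulfI (C_neq0 (j + 1) k)); apply: (mulfI uj).
transitivity (R (j + 2) k * C (j + 1) k * (R j k * u j)); first by ring.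
by rewrite E; field.
Qed.

Lemma even_const : exists s, forall i, t 0 i * t 2 i * t 4 i * eproj i ^+ 2 = s.
Proof.
have [[c1 _ e1] [c2 c20 e2]] := (close_row 1, crc 0).
have [[c3 c30 e3] [c4 c40 e4]] := (rcr 1, rcr 5).
(* In this combination all row and column products cancel except those in [eproj]. *)
exists (c1 * c4 / (c2 * c3)) => i; rewrite /eproj.
have := (e1 i, e2 i, e3 i, e4 i); rewrite !ord6_add !add0r => -[[[E1 E2] E3] E4].
have r j := R_neq0 j i; have c j := C_neq0 j i; have t' j := t0 j i.
have -> : c1 = t 0 i * t 4 i * C 0 i * R 3 i / (R 5 i * C 2 i * t 2 i ^+ 2).
  by rewrite E1; field; rewrite ?r ?c ?t'.
have -> : c2 = C 2 i * C 0 i * t 0 i ^+ 3 / R 1 i ^+ 2 by rewrite E2; field; rewrite r.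
have -> : c3 = R 3 i * R 1 i / (C 2 i ^+ 2 * t 2 i ^+ 3).
  by rewrite E3; field; rewrite ?r ?c ?t'.
have -> : c4 = R 1 i * R 5 i / (C 0 i ^+ 2 * t 0 i ^+ 3).
  by rewrite E4; field; rewrite ?r ?c ?t'.
by field; rewrite ?r ?c ?t'.
Qed.

Lemma odd_const : exists s, forall k, t 1 k * t 3 k * t 5 k * eproj' k ^+ 2 = s.
Proof.
have [[c1 _ e1] [c2 c20 e2]] := (close_row 4, crc 5).
have [[c3 c30 e3] [c4 c40 e4]] := (rcr 0, crc 1).
exists (c1 * c2 / (c3 * c4) / u 0 ^+ 2) => i; rewrite /eproj'.
have := (e1 i, e2 i, e3 i, e4 i); rewrite !ord6_add !add0r => -[[[E1 E2] E3] E4].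
have r j := R_neq0 j i; have c j := C_neq0 j i; have t' j := t0 j i.
have -> : c1 = t 3 i * t 1 i * C 3 i * R 0 i / (R 2 i * C 5 i * t 5 i ^+ 2).
  by rewrite E1; field; rewrite ?r ?c ?t'.
have -> : c2 = C 1 i * C 5 i * t 5 i ^+ 3 / R 0 i ^+ 2 by rewrite E2; field; rewrite r.
have -> : c3 = R 2 i * R 0 i / (C 1 i ^+ 2 * t 1 i ^+ 3).
  by rewrite E3; field; rewrite ?r ?c ?t'.
have -> : c4 = C 3 i * C 1 i * t 1 i ^+ 3 / R 2 i ^+ 2 by rewrite E4; field; rewrite r.
have u0 := u_neq0 0; by field; rewrite ?r ?c ?t' ?u0.
Qed.

End TightCycle.

(** * Galois weights around a tight cycle *)

Section TightScalar.

Variables (K : closedFieldType) (G : Type) (h : G -> {rmorphism K -> K}).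

Section Diagonal.

Variables (X : 'I_6 -> 'M[K]_3) (t : 'I_6 -> 'I_3 -> K).
Variables (v : 'I_6 -> vtx K G) (r : 'I_6 -> G -> K).
Hypothesis uX : forall j, X j \in unitmx.
Hypothesis fX : forall j, full (X j).
Hypothesis t0 : forall j i, t j i != 0.
Hypothesis XE : forall j, X (j + 1) *m hinv (X j) = diag3 (t j).
Hypothesis r0 : forall j g, r j g != 0.
Hypothesis eX : forall j, eqv h (v j) (v (j + 5)) (r j) (X j).

Let a j g := va (v j) g.
Let s j g := vs (v j) g.
Let A j g := \prod_i a j g i.

Let a_neq0 j g i : a j g i != 0. Proof. exact: va_neq0. Qed.
Let A_neq0 j g : A j g != 0. Proof. by apply/prodf_neq0 => i _. Qed.

Let tightE j g i k : h g (diag3 (t j) i k) = r (j + 1) g / r j g * a (j + 1) g i / a (j + 5) g k *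
  diag3 (t j) (s (j + 1) g i) (s (j + 5) g k).
Proof.
rewrite -!XE !mxE rmorph_sum mulr_sumr /= [RHS](reindex_inj (@perm_inj _ (s j g))) /=.
apply: eq_bigr => l _; rewrite rmorphM [hinv _ _ _]mxE fmorphV !eX [hinv _ _ _]mxE !ord6D.
rewrite -/(a _ _ _) -/(a _ _ _) -/(a _ _ _) -/(s _ _) -/(s _ _) -/(s _ _).
have x0 := fX j (s j g l) (s (j + 5) g k); have al := a_neq0 j g l; have ak := a_neq0 (j + 5) g k.
have rj := r0 j g; by field; rewrite x0 al ak rj.
Qed.

(** Galois preserves nonzero entries, and those of a diagonal matrix lie on the diagonal; so rows
    and columns are permuted in the same way. *)
Let sE j g i : s (j + 1) g i = s (j + 5) g i.
Proof.
have := tightE j g i i; rewrite mxE eqxx mulr1n => E; apply/eqP.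
have : h g (t j i) != 0 by rewrite fmorph_eq0.
by rewrite E mxE; case: (s (j + 1) g i == _) => //=; rewrite mulr0 eqxx.
Qed.

Let tE j g i : h g (t j i) = r (j + 1) g / r j g * a (j + 1) g i / a (j + 5) g i * t j (s (j + 1) g i).
Proof.
have := tightE j g i i; rewrite mxE eqxx mulr1n => ->.
by rewrite -sE [diag3 _ _ _]mxE eqxx mulr1n.
Qed.

Let rowE j g i : h g (rowp (X j) i) = r j g ^+ 3 * a j g i ^+ 3 * A (j + 5) g * rowp (X j) (s j g i).
Proof.
rewrite /rowp rmorph_prod; under eq_bigr => k _ do rewrite eX.
rewrite !big_split /= !prodr_const !card_ord -/(A _ _); congr (_ * _).
by rewrite [RHS](reindex_inj (@perm_inj _ (s (j + 5) g))).
Qed.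

Let colE j g k : h g (colp (X j) k) =
  r j g ^+ 3 * A j g * a (j + 5) g k ^+ 3 * colp (X j) (s (j + 5) g k).
Proof.
rewrite /colp rmorph_prod; under eq_bigr => i _ do rewrite eX.
rewrite !big_split /= !prodr_const !card_ord -/(A _ _); congr (_ * _).
by rewrite [RHS](reindex_inj (@perm_inj _ (s j g))).
Qed.

Let allE j g : h g (allp (X j)) = r j g ^+ 9 * A j g ^+ 3 * A (j + 5) g ^+ 3 * allp (X j).
Proof.
rewrite /allp rmorph_prod; under eq_bigr => i _ do rewrite rowE.
rewrite [X in _ = _ * X](reindex_inj (@perm_inj _ (s j g))) /=.
move: (A (j + 5) g) (r j g) => b c.
rewrite big_split /= big_split /= big_split /= !prodrXl !prodr_const !card_ord -/(A _ _); ring.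
Qed.

Let tauE j g : h g (tau (t j)) = (r (j + 1) g / r j g) ^+ 3 * A (j + 1) g / A (j + 5) g * tau (t j).
Proof.
rewrite /tau rmorph_prod; under eq_bigr => i _ do rewrite tE.
rewrite [X in _ = _ * X](reindex_inj (@perm_inj _ (s (j + 1) g))) /=.
move: (r _ g / _) => b.
by rewrite big_split /= big_split /= big_split /= prodfV prodr_const card_ord.
Qed.

(* [s1] and [s2] come with their cubes, found by multiplying [even_const] and [odd_const] over
   the three coordinates, and with their Galois weights, read off a single coordinate. *)
Lemma word6_diag : cube_rel h (fun g => r 0 g * r 2 g * r 4 g) (fun g => r 1 g * r 3 g * r 5 g)
  (\det (X 0) * \det (X 2) * \det (X 4)) (\det (X 1) * \det (X 3) * \det (X 5)).
Proof.
have [s1 s1E] := even_const uX fX t0 XE; have [s2 s2E] := odd_const uX fX t0 XE.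
have dR := det_ratio uX fX t0 XE; have pR := prod_ratio uX fX t0 XE.
have ep := eproj_prod X t.
have p_neq0 j : allp (X j) != 0 by apply: allp_neq0.
have u_neq0 j : tau (t j) != 0 by apply: tau_neq0.
have R_neq0 j i : rowp (X j) i != 0 by apply: rowp_neq0.
have C_neq0 j i : colp (X j) i != 0 by apply: colp_neq0.
have e_neq0 i : eproj X t i != 0 by rewrite /eproj mulf_neq0 ?invr_eq0 ?mulf_neq0 ?expf_neq0.
have e'_neq0 i : eproj' X t i != 0 by rewrite /eproj' mulf_neq0 ?invr_eq0 ?mulf_neq0.
have s1_neq0 : s1 != 0 by rewrite -(s1E 0) (mulf_neq0 _ (expf_neq0 2 (e_neq0 0))) ?mulf_neq0.
have s2_neq0 : s2 != 0 by rewrite -(s2E 0) (mulf_neq0 _ (expf_neq0 2 (e'_neq0 0))) ?mulf_neq0.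
set e := \prod_i eproj X t i in ep.
have e0 : e != 0 by apply/prodf_neq0 => i _.
have s1_3 : s1 ^+ 3 = tau (t 0) * tau (t 2) * tau (t 4) * e ^+ 2.
  have -> : s1 ^+ 3 = \prod_(i < 3) s1 by rewrite prodr_const card_ord.
  rewrite -(eq_bigr _ (fun i _ => s1E i)).
  by rewrite big_split /= prodrXl big_split /= big_split.
have s2_3 : s2 ^+ 3 = tau (t 1) * tau (t 3) * tau (t 5) * e ^+ 2.
  have -> : s2 ^+ 3 = \prod_(i < 3) s2 by rewrite prodr_const card_ord.
  rewrite -(eq_bigr _ (fun i _ => s2E i)).
  by rewrite big_split /= prodrXl -ep big_split /= big_split.
pose P := allp (X 0) * allp (X 2) * allp (X 4) / (allp (X 1) * allp (X 3) * allp (X 5)).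
pose T := tau (t 0) * tau (t 2) * tau (t 4) / (tau (t 1) * tau (t 3) * tau (t 5)).
have d_neq0 j : \det (X j) != 0 by apply: unit_det_neq0.
(* The ratio of the two products of determinants is [P T], while [P^2 T^3 = 1] and
   [s1^3 / s2^3 = T]. So the cube of [P T s1 / s2] is [P (P^2 T^3) T = P T]. *)
exists (P * T * s1 / s2).
  have dE : \det (X 0) * \det (X 2) * \det (X 4) =
      P * T * (\det (X 1) * \det (X 3) * \det (X 5)).
    apply: (mulIf (_ : (\det (X 1) * \det (X 3) * \det (X 5))^-1 != 0)).
      by rewrite invr_eq0 !mulf_neq0.
    by rewrite dR /P /T; field; rewrite ?p_neq0 ?u_neq0 ?d_neq0.
  rewrite dE; congr (_ * _).
  have -> : (P * T * s1 / s2) ^+ 3 = P ^+ 2 * T ^+ 3 * P * (s1 ^+ 3 / s2 ^+ 3) by field.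
  rewrite /P /T pR s1_3 s2_3 mul1r -/P.
  by field; rewrite ?p_neq0 ?u_neq0 ?e0.
move=> g.
have s35 i : s 3 g i = s 1 g i by have := sE 2 g i; rewrite !ord6_add.
have s51 i : s 5 g i = s 1 g i by have := sE 0 g i; rewrite !add0r.
have s20 i : s 2 g i = s 0 g i by have := sE 1 g i; rewrite !ord6_add.
have s40 i : s 4 g i = s 0 g i by have := sE 3 g i; rewrite !ord6_add s20.
have a0 j i : a j g i != 0 by [].
have B0 j : A j g != 0 by [].
have hs1 : h g s1 = (r 1 g * r 3 g * r 5 g) / (r 0 g * r 2 g * r 4 g) * s1.
  rewrite -{1}(s1E 0) -(s1E (s 1 g 0)) /eproj !(rmorphM, rmorphXn, fmorphV) /=.
  rewrite rowE colE !tE !ord6_add !add0r s35 s51.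
  have R1 := R_neq0 1; have C0 := C_neq0 0; have t00 := t0 0.
  by field; rewrite ?r0 ?a0 ?B0 ?R1 ?C0 ?t00.
have hs2 : h g s2 = (r 0 g * r 2 g * r 4 g) / (r 1 g * r 3 g * r 5 g) * s2.
  rewrite -{1}(s2E 0) -(s2E (s 0 g 0)) /eproj' !(rmorphM, rmorphXn, fmorphV) /=.
  rewrite rowE colE tauE !tE !ord6_add !add0r s20 s40.
  have R1 := R_neq0 0; have C0 := C_neq0 1; have t00 := u_neq0 0.
  by field; rewrite ?r0 ?a0 ?B0 ?R1 ?C0 ?t00.
have hP : h g P = ((r 0 g * r 2 g * r 4 g) / (r 1 g * r 3 g * r 5 g)) ^+ 9 * P.
  rewrite /P !rmorphM fmorphV !rmorphM /= !allE !ord6_add !add0r.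
  by field; rewrite ?r0 ?a0 ?B0 ?p_neq0.
have hT : h g T = ((r 1 g * r 3 g * r 5 g) / (r 0 g * r 2 g * r 4 g)) ^+ 6 * T.
  rewrite /T !rmorphM fmorphV !rmorphM /= !tauE !ord6_add !add0r.
  by field; rewrite ?r0 ?a0 ?B0 ?u_neq0.
(* Let [rho] be the product of the even [r j g] over that of the odd ones. The weights of [P], [T],
   [s1], [s2] are the powers [9], [-6], [-1], [1] of [rho], and [9 - 6 - 1 - 1 = 1]. *)
rewrite (rmorphM _ (P * T * s1)) (rmorphM _ (P * T)) (rmorphM _ P) fmorphV /=.
rewrite hs1 hs2 hP hT.
by field; rewrite ?r0 ?s2_neq0.
Qed.

End Diagonal.
End TightScalar.

(** * Cyclic words of length six *)

Section LongWord.

Variables (K : closedFieldType) (G : Type) (h : G -> {rmorphism K -> K}).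

Lemma ord6_ind (P : 'I_6 -> Prop) : P 0 -> (forall j, P j -> P (j + 1)) -> forall j, P j.
Proof.
move=> P0 PS; have P1 := PS _ P0; have P2 := PS _ P1; have P3 := PS _ P2.
have P4 := PS _ P3; have P5 := PS _ P4.
case=> [[|[|[|[|[|[|//]]]]]] lt_j].
- by rewrite (_ : Ordinal lt_j = 0) //; apply: val_inj.
- by rewrite (_ : Ordinal lt_j = 0 + 1) //; apply: val_inj.
- by rewrite (_ : Ordinal lt_j = 0 + 1 + 1) //; apply: val_inj.
- by rewrite (_ : Ordinal lt_j = 0 + 1 + 1 + 1) //; apply: val_inj.
- by rewrite (_ : Ordinal lt_j = 0 + 1 + 1 + 1 + 1) //; apply: val_inj.
- by rewrite (_ : Ordinal lt_j = 0 + 1 + 1 + 1 + 1 + 1) //; apply: val_inj.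
Qed.

Lemma ord6_ind_ex (P : 'I_6 -> Prop) : (exists j, P j) -> (forall j, P j -> P (j + 1)) -> P 0.
Proof.
move=> [i Pi] PS; rewrite -(addrN i); move: (- i); apply: ord6_ind; first by rewrite addr0.
by move=> j Pj; rewrite addrA; apply: PS.
Qed.

Lemma perm_conj_trans (T : finType) (p s : {perm T}) i : (p * s * p^-1)%g i = (p^-1)%g (s (p i)).
Proof. by rewrite !permM. Qed.

Section Reorder.

Variable p : {perm 'I_3}.
Variable v : vtx K G.

Lemma conj_trans i j : exists g, (p * vs v g * p^-1)%g i = j.
Proof.
have [g gE] := vs_trans v (p i) (p j); exists g.
by rewrite perm_conj_trans gE permK.
Qed.

Definition reorder_vtx : vtx K G :=
  Vtx (vs := fun g => (p * vs v g * p^-1)%g) (va := fun g i => va v g (p i))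
      (fun g i => va_neq0 v g (p i)) conj_trans.

End Reorder.

Definition reorder (p q : {perm 'I_3}) (X : 'M[K]_3) : 'M[K]_3 := \matrix_(i, k) X (p i) (q k).

Lemma reorder_row_col p q X : reorder p q X = row_perm p (col_perm q X).
Proof. by apply/matrixP => i k; rewrite !mxE. Qed.

Lemma eqv_reorder p q v w r X : eqv h v w r X ->
  eqv h (reorder_vtx p v) (reorder_vtx q w) r (reorder p q X).
Proof. by move=> eX g i k; rewrite !mxE eX !perm_conj_trans !permKV. Qed.

Lemma det_reorder p q X : \det (reorder p q X) = (-1) ^+ p * (-1) ^+ q * \det X.
Proof.
rewrite reorder_row_col row_permE col_permE !det_mulmx !det_perm odd_permV.
by rewrite [\det X * _]mulrC mulrA.
Qed.

Lemma unit_reorder p q X : X \in unitmx -> reorder p q X \in unitmx.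
Proof. by rewrite !unitmxE det_reorder -mulrA !unitrM !unitrX ?unitrN1. Qed.

Section Family.

Variables (X : 'I_6 -> 'M[K]_3) (v : 'I_6 -> vtx K G) (r : 'I_6 -> G -> K).
Hypothesis uX : forall j, X j \in unitmx.
Hypothesis r0 : forall j g, r j g != 0.
Hypothesis eX : forall j, eqv h (v j) (v (j + 5)) (r j) (X j).
Hypothesis rel : rel_word [:: X 0; X 1; X 2; X 3; X 4; X 5].

Let relj j : rel_word [:: X j; X (j + 1); X (j + 2); X (j + 3); X (j + 4); X (j + 5)].
Proof.
move: j; apply: ord6_ind => [|j /(rel_rot (uX j)) /=]; first by rewrite !add0r.
by rewrite !ord6D.
Qed.

Let unitj j : all (fun M => M \in unitmx)
  [:: X j; X (j + 1); X (j + 2); X (j + 3); X (j + 4); X (j + 5)].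
Proof. by rewrite /= !uX. Qed.

Definition cube_rel_at j := cube_rel h (fun g => r j g * r (j + 2) g * r (j + 4) g)
  (fun g => r (j + 1) g * r (j + 3) g * r (j + 5) g)
  (\det (X j) * \det (X (j + 2)) * \det (X (j + 4)))
  (\det (X (j + 1)) * \det (X (j + 3)) * \det (X (j + 5))).

Let cube_rel_next j : cube_rel_at j -> cube_rel_at (j + 1).
Proof.
rewrite /cube_rel_at !ord6D => c; have := cube_rel_sym _ _ c.
rewrite !mulf_neq0 ?unit_det_neq0 // => /(_ isT isT).
move=> {}c; apply: cube_rel_eq c _ _ _ _ => //= [g|]; ring.
Qed.

Let stepj j : cube_rel_at j \/ tight (X (j + 1)) (X (j + 2)).
Proof.
have e i := eX (j + i); have := (e 1, e 2, e 3, e 4, e 5); rewrite !ord6D.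
move=> [[[[e1 e2] e3] e4] e5].
exact: word6_or_tight (r0 _) (r0 _) (r0 _) (r0 _) (r0 _) (r0 _) (unitj j) (eX j) e1 e2 e3 e4 e5 (relj j).
Qed.

Section AllTight.

Hypothesis fX : forall j, full (X j).
Variables (s : 'I_6 -> {perm 'I_3}) (t : 'I_6 -> 'I_3 -> K).
Hypothesis t0 : forall j i, t j i != 0.
Hypothesis XE : forall j, X (j + 1) *m hinv (X j) = mnm (s j) (t j).

Let sE j i : s (j + 2) (s j (s (j + 4) i)) = i.
Proof.
have E2 := XE (j + 2); have E3 := XE (j + 3); have E4 := XE (j + 4); rewrite !ord6D in E2 E3 E4.
apply: (tight_perm (unitj j) (relj j) (XE j) E2 E4) => //; try exact: fX.
exact: (tight_inv_full (uX _) E3 (fX _) (t0 _)).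
Qed.

(** The solution of [p (j + 1) = s j \o p (j - 1)] with [p 0] and [p 1] trivial, which makes the
    matrices [mnm (s j) (t j)] diagonal after relabelling. The recursion closes up after six steps
    by [tight_perm]. The product of permutations applies its left factor first. *)
Definition cyc_perm (j : 'I_6) : {perm 'I_3} :=
  nth 1%g [:: 1%g; 1%g; s 1; s 2; (s 1%R * s 3%R)%g; (s 2%R * s 4%R)%g] j.

Let pE j k : cyc_perm (j + 1) k = s j (cyc_perm (j + 5) k).
Proof.
have s042 i : s 0 (s 4 (s 2 i)) = i by have := sE 4 i; rewrite !ord6_add.
have s531 i : s 5 (s 3 (s 1 i)) = i.
  by have := sE 3 i; rewrite !ord6_add (_ : 3 + 4 = 1 :> 'I_6) //; apply: val_inj.
case: j => [[|[|[|[|[|[|//]]]]]] lt_j]; rewrite /cyc_perm /= ?perm1 ?permM.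
- by rewrite (_ : Ordinal lt_j = 0) ?s042 //; apply: val_inj.
- by rewrite (_ : Ordinal lt_j = 1) //; apply: val_inj.
- by rewrite (_ : Ordinal lt_j = 2) //; apply: val_inj.
- by rewrite (_ : Ordinal lt_j = 3) //; apply: val_inj.
- by rewrite (_ : Ordinal lt_j = 4) //; apply: val_inj.
- by rewrite (_ : Ordinal lt_j = 5) ?s531 //; apply: val_inj.
Qed.

Let X' j := reorder (cyc_perm j) (cyc_perm (j + 5)) (X j).

Let X'E j : X' (j + 1) *m hinv (X' j) = diag3 (fun i => t j (cyc_perm (j + 5) i)).
Proof.
apply/matrixP => i k; have := congr1 (fun A : 'M[K]_3 => A (cyc_perm (j + 1) i) (cyc_perm (j + 5) k)) (XE j).
rewrite !mxE pE (inj_eq (@perm_inj _ (s j))) (inj_eq (@perm_inj _ _)) => <-.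
rewrite [RHS](reindex_inj (@perm_inj _ (cyc_perm j))) /=; apply: eq_bigr => l _.
by rewrite !mxE !ord6D pE.
Qed.

Lemma cube_rel_tight : cube_rel_at 0.
Proof.
rewrite /cube_rel_at !add0r.
have uX' j : X' j \in unitmx by apply: unit_reorder.
have fX' j : full (X' j) by move=> i k; rewrite mxE; apply: fX.
have eX' j : eqv h (reorder_vtx (cyc_perm j) (v j)) (reorder_vtx (cyc_perm (j + 5)) (v (j + 5))) (r j) (X' j).
  exact: eqv_reorder.
have [nu nuE nug] := word6_diag (v := fun j => reorder_vtx (cyc_perm j) (v j)) uX' fX'
  (fun j i => t0 j _) X'E r0 eX'.
have [e [e0 dE]] : exists e : 'I_6 -> K, (forall j, e j != 0) /\
    forall j, \det (X' j) = e j * e (j + 5) * \det (X j).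
  exists (fun j => (-1) ^+ cyc_perm j); split=> j; first by rewrite expf_neq0 // oppr_eq0 oner_eq0.
  exact: det_reorder.
exists nu => //; move: nuE; rewrite !dE !ord6_add !add0r => E.
(* On either side the sign is the product of all six [e j]: the pairs [e j * e (j + 5)] for [j] of
   one parity cover each index once. *)
have e0' : e 0 * e 1 * e 2 * e 3 * e 4 * e 5 != 0 by rewrite !mulf_neq0.
apply: (mulfI e0').
transitivity (nu ^+ 3 * (e 1 * e 0 * \det (X 1) * (e 3 * e 2 * \det (X 3))
   * (e 5 * e 4 * \det (X 5)))).
  by ring.
by rewrite E; ring.
Qed.

End AllTight.

(** [cube_rel_at] passes from one rotation to the next. If it holds at no rotation, [stepj] makes
    every pair of neighbours tight. *)
Lemma word6_cyclic : cube_rel_at 0.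
Proof.
have [[j cj]|nc] := boolp.pselect (exists j, cube_rel_at j).
  by apply: (ord6_ind_ex _ cube_rel_next); exists j.
have tj j : tight (X (j + 1)) (X (j + 2)).
  by case: (stepj j) => // cj; case: nc; exists j.
have fX j : full (X j) by have [] := tj (j + 5); rewrite !ord6D.
have /boolp.choice[s sP] : forall j, exists s : {perm 'I_3}, exists t : 'I_3 -> K,
    (forall i, t i != 0) /\ X (j + 1) *m hinv (X j) = mnm s t.
  by move=> j; have [_] := tj (j + 5); rewrite !ord6D.
have /boolp.choice[t tP] := sP.
apply: (cube_rel_tight fX (s := s) (t := t)) => j; [by case: (tP j)|by case: (tP j)].
Qed.

End Family.

Lemma word6 v1 v2 v3 v4 v5 v6 r1 r2 r3 r4 r5 r6 (X1 X2 X3 X4 X5 X6 : 'M[K]_3) :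
  (forall g, r1 g != 0) -> (forall g, r2 g != 0) -> (forall g, r3 g != 0) ->
  (forall g, r4 g != 0) -> (forall g, r5 g != 0) -> (forall g, r6 g != 0) ->
  all (fun M => M \in unitmx) [:: X1; X2; X3; X4; X5; X6] ->
  eqv h v1 v6 r1 X1 -> eqv h v2 v1 r2 X2 -> eqv h v3 v2 r3 X3 -> eqv h v4 v3 r4 X4 ->
  eqv h v5 v4 r5 X5 -> eqv h v6 v5 r6 X6 ->
  rel_word [:: X1; X2; X3; X4; X5; X6] ->
  cube_rel h (fun g => r1 g * r3 g * r5 g) (fun g => r2 g * r4 g * r6 g)
     (\det X1 * \det X3 * \det X5) (\det X2 * \det X4 * \det X6).
Proof.
move=> r10 r20 r30 r40 r50 r60 /and5P[u1 u2 u3 u4 /and3P[u5 u6 _]] e1 e2 e3 e4 e5 e6 rel.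
pose X (j : 'I_6) := nth X1 [:: X1; X2; X3; X4; X5; X6] j.
pose v (j : 'I_6) := nth v1 [:: v1; v2; v3; v4; v5; v6] j.
pose r (j : 'I_6) := nth r1 [:: r1; r2; r3; r4; r5; r6] j.
apply: (@word6_cyclic X v r) => //; case=> [[|[|[|[|[|[|//]]]]]] lt_j] //=.
Qed.

End LongWord.

(** * The fixed field of the automorphisms of K over k *)

Section Fixed.

Variables (k : fieldType) (K : closedFieldType) (iota : {rmorphism k -> K}).
Hypothesis k_perfect : perfect_field k.
Hypothesis K_closure : is_alg_closure iota.

(** If [n] is nonzero in [K], the coefficient of degree [n - 1] is [- n nu]. Otherwise the
    characteristic [p] divides [n], the polynomial is [(X^p - nu^p)^(n/p)], induction puts [nu^p] in
    [k], and perfectness gives [nu]. *)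
Lemma single_root_in_base n (nu : K) : (0 < n)%N ->
  (forall i, exists c, (('X - nu%:P) ^+ n)`_i = iota c) -> exists c, nu = iota c.
Proof.
have [m] := ubnP n; elim: m => // m IHm in n nu *; rewrite ltnS => le_nm n0 cf.
have [/eqP n_eq0|n_neq0] := eqVneq (n%:R : K) 0.
  have [p pK] := natf0_pchar n0 n_eq0.
  have p_pr : prime p by apply: pcharf_prime pK.
  have pn : (p %| n)%N by rewrite (dvdn_pcharf pK).
  have pX : p \in [pchar {poly K}] by rewrite pchar_poly.
  have pk : p \in [pchar k] by rewrite -(fmorph_pchar iota).
  have [|||c cE] := IHm (n %/ p)%N (nu ^+ p).
  - by apply: leq_trans le_nm; apply: ltn_Pdiv => //; apply: prime_gt1.
  - by rewrite divn_gt0 ?prime_gt0 // dvdn_leq.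
  - move=> i; have [c cE] := cf (i * p)%N; exists c; rewrite -cE.
    have <- : (('X - (nu ^+ p)%:P) ^+ (n %/ p)) \Po 'X^p = ('X - nu%:P) ^+ n.
      rewrite rmorphXn /= comp_polyB comp_polyX comp_polyC -{2}(divnK pn) mulnC exprM.
      congr (_ ^+ _); rewrite polyC_exp -!(pFrobenius_autE pX).
      by rewrite (pFrobenius_autB_comm pX) //; apply: mulrC.
    by rewrite coef_comp_poly_Xn ?prime_gt0 // dvdn_mull // mulnK ?prime_gt0.
  have [y yE] := k_perfect pk c; exists y; apply/eqP; rewrite -subr_eq0.
  have : (nu - iota y) ^+ p == 0.
    rewrite -(pFrobenius_autE pK) (pFrobenius_autB_comm pK); last exact: mulrC.
    by rewrite !pFrobenius_autE cE -rmorphXn yE subrr.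
  by rewrite expf_eq0 => /andP[].
have [c cE] := cf n.-1.
exists (- (c / n%:R)); rewrite rmorphN fmorph_div rmorph_nat -cE.
have -> : ('X - nu%:P) ^+ n = \prod_(z <- nseq n nu) ('X - z%:P).
  by rewrite big_nseq iter_mulr_1.
have -> : n.-1 = (size (nseq n nu)).-1 by rewrite size_nseq.
rewrite coefPn_prod_XsubC ?size_nseq -?lt0n // big_nseq iter_addr_0.
by rewrite mulNr opprK -[nu *+ n]mulr_natr mulfK.
Qed.

Lemma min_poly_ex (nu : K) : exists2 m : {poly k}, m != 0 /\ root (map_poly iota m) nu &
  forall q, root (map_poly iota q) nu -> m %| q.
Proof.
have [p0 mon0 root0] := K_closure nu.
pose P n := boolp.asbool (exists2 m : {poly k}, m != 0 /\ root (map_poly iota m) nu & size m = n).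
have exP : exists n, P n.
  by exists (size p0); apply/boolp.asboolP; exists p0; rewrite ?monic_neq0.
case: (ex_minnP exP) => n /boolp.asboolP[m [m0 mr] <-] minm; exists m => // q qr.
apply/modp_eq0P; have [//|r0] := eqVneq (q %% m) 0.
have : (size m <= size (q %% m)%R)%N.
  apply: minm; apply/boolp.asboolP; exists (q %% m) => //; split=> //.
  move: qr; rewrite {1}(divp_eq q m) rmorphD rmorphM /= !rootE hornerD hornerM.
  by move/eqP: mr => ->; rewrite mulr0 add0r.
by rewrite leqNgt ltn_modp m0.
Qed.

(** If [nu] were its only root, the minimal polynomial would be a constant times a power of
    [X - nu], and [single_root_in_base] would put [nu] in [k]. *)
Lemma conjugate_ex (nu : K) : (forall c, nu <> iota c) ->
  exists2 nu', nu' != nu & forall q, root (map_poly iota q) nu -> root (map_poly iota q) nu'.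
Proof.
move=> nk; have [m [m0 mr] mmin] := min_poly_ex nu.
have [r rE] := closed_field_poly_normal (map_poly iota m).
have lc0 : lead_coef m != 0 by rewrite lead_coef_eq0.
have [all_nu|/allPn[nu' nu'r ne]] := boolP (all (pred1 nu) r); last first.
  exists nu' => // q /mmin/dvdpP[s ->]; rewrite rmorphM /= rootM; apply/orP; right.
  rewrite rE rootZ ?root_prod_XsubC // lead_coef_map ?fmorph_eq0 //.
case: (single_root_in_base (n := size r) (nu := nu)).
- rewrite lt0n; apply: contraTneq mr => /size0nil r0.
  by rewrite rE r0 big_nil rootZ ?root1 // lead_coef_map fmorph_eq0.
- move=> i; exists ((lead_coef m)^-1 * m`_i).
  have -> : ('X - nu%:P) ^+ size r = \prod_(z <- r) ('X - z%:P).
    by rewrite {2}(all_pred1P _ _ all_nu) big_nseq iter_mulr_1.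
  have E : (map_poly iota m)`_i = iota (lead_coef m) * (\prod_(z <- r) ('X - z%:P))`_i.
    by rewrite {1}rE coefZ lead_coef_map.
  by rewrite rmorphM fmorphV -(coef_map iota m i) E mulKf ?fmorph_eq0.
- by move=> c /nk.
Qed.

Section Extend.

Variable B : K -> K -> Prop.

(* Partial k-algebra endomorphisms of K, as functional relations. *)
Definition good (B : K -> K -> Prop) :=
  [/\ forall c, B (iota c) (iota c),
      forall x y x' y', B x y -> B x' y' -> B (x + x') (y + y'),
      forall x y x' y', B x y -> B x' y' -> B (x * x') (y * y') &
      forall x y y', B x y -> B x y' -> y = y'].

Hypothesis gB : good B.

Let B0 : B 0 0. Proof. by case: gB => /(_ 0); rewrite rmorph0. Qed.
Let B1 : B 1 1. Proof. by case: gB => /(_ 1); rewrite rmorph1. Qed.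
Let BD x y x' y' : B x y -> B x' y' -> B (x + x') (y + y').
Proof. by case: gB => _ + _ _; apply. Qed.
Let BM x y x' y' : B x y -> B x' y' -> B (x * x') (y * y').
Proof. by case: gB => _ _ + _; apply. Qed.
Let BF x y y' : B x y -> B x y' -> y = y'.
Proof. by case: gB => _ _ _; apply. Qed.
Let BN x y : B x y -> B (- x) (- y).
Proof.
move=> xy; rewrite -mulN1r -[- y]mulN1r; apply: BM => //.
by case: gB => /(_ (-1)); rewrite rmorphN rmorph1.
Qed.
Let Bi c : B (iota c) (iota c). Proof. by case: gB. Qed.

Lemma good_horner (p : {poly k}) x y : B x y -> B (map_poly iota p).[x] (map_poly iota p).[y].
Proof.
move=> xy; elim/poly_ind: p => [|p c IHp]; first by rewrite !rmorph0 !horner0.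
rewrite !rmorphD !rmorphM /= !map_polyX !map_polyC !hornerE /=.
by apply: BD => //; apply: BM.
Qed.

(** [good] asks for no inverses. Since [x] is algebraic, [x^-1] is a polynomial in [x] over [k]:
    divide an annihilating polynomial by ['X] until its constant term is nonzero. *)
Lemma good_inv x y : B x y -> x != 0 -> exists z, B x^-1 z.
Proof.
move=> xy x0; have [p mp rp] := K_closure x.
have [q q0 qr] : exists2 q : {poly k}, q`_0 != 0 & root (map_poly iota q) x.
  have {mp} p0 : p != 0 by apply: monic_neq0.
  have [n] := ubnP (size p); elim: n => // n IHn in p rp p0 *; rewrite ltnS => sp.
  have [p00|] := eqVneq (p`_0) 0; last by exists p.
  have : root p 0 by rewrite rootE horner_coef0 p00.
  move=> /factor_theorem[q pE]; rewrite subr0 in pE.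
  have q0 : q != 0 by apply: contraNneq p0 => q0; rewrite pE q0 mul0r.
  apply: (IHn q) => //.
    by move: rp; rewrite pE rmorphM /= map_polyX rootM rootX (negPf x0) orbF.
  by apply: leq_trans sp; rewrite pE size_mulX.
have [r qE] : exists r, q = r * 'X + (q`_0)%:P.
  by elim/poly_ind: q {q0 qr} => [|r c _]; [exists 0; rewrite mul0r coef0 add0r
    |exists r; rewrite coefD coefMX coefC /= add0r].
pose u := map_poly iota r.
exists (- (iota q`_0)^-1 * u.[y]).
have -> : x^-1 = - (iota q`_0)^-1 * u.[x].
  apply: (mulIf x0); rewrite mulVf //; move: qr; rewrite {1}qE rootE !(rmorphD, rmorphM) /=.
  rewrite map_polyX map_polyC !hornerE /= -/u addr_eq0 => /eqP E.
  by rewrite -mulrA E mulrNN mulVf // fmorph_eq0.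
by apply: BM; [apply: BN; rewrite -fmorphV|apply: good_horner].
Qed.

Definition Bp (p q : {poly K}) := forall i, B p`_i q`_i.

Lemma BpD p q p' q' : Bp p q -> Bp p' q' -> Bp (p + p') (q + q').
Proof. by move=> pq pq' i; rewrite !coefD; apply: BD. Qed.

Lemma BpN p q : Bp p q -> Bp (- p) (- q).
Proof. by move=> pq i; rewrite !coefN; apply: BN. Qed.

Lemma Bsum n (F H : 'I_n -> K) : (forall i, B (F i) (H i)) -> B (\sum_i F i) (\sum_i H i).
Proof. by move=> FH; apply: (big_ind2 B) => // *; apply: BD. Qed.

Lemma BpM p q p' q' : Bp p q -> Bp p' q' -> Bp (p * p') (q * q').
Proof. by move=> pq pq' i; rewrite !coefM; apply: Bsum => j; apply: BM. Qed.

Lemma BpC x y : B x y -> Bp x%:P y%:P.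
Proof. by move=> xy i; rewrite !coefC; case: eqP. Qed.

Lemma BpXn n : Bp 'X^n 'X^n.
Proof. by move=> i; rewrite !coefXn; case: eqP. Qed.

Lemma Bp_size p q : Bp p q -> (size q <= size p)%N.
Proof.
move=> pq; apply/leq_sizeP => i si; apply: (BF _ B0).
by have := pq i; rewrite nth_default.
Qed.

(** Let [m] be monic of least degree with coefficients in the domain of [B] and root [z]. Then [w]
    is any root of its image [n], and an arbitrary pair [p], [q] is reduced by [m] and [n] in
    parallel. *)
Lemma extend_ex z : exists w, forall p q, Bp p q -> p.[z] = 0 -> q.[w] = 0.
Proof.
pose P n := boolp.asbool (exists m n', [/\ Bp m n', m \is monic, root m z & size m = n]).
have exP : exists n, P n.
  have [p mp rp] := K_closure z; exists (size (map_poly iota p)); apply/boolp.asboolP.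
  exists (map_poly iota p), (map_poly iota p).
  by split=> //; [move=> i; rewrite coef_map /=; apply: Bi|rewrite map_monic].
have [_ /boolp.asboolP[m [n [mn mon mz <-]]] minm] := ex_minnP exP.
have sn : (size n <= size m)%N := Bp_size mn.
have n_lead : n`_(size m).-1 = 1 by have := mn (size m).-1; rewrite -/(lead_coef m) (monicP mon) => /BF/(_ B1).
have m_gt1 : (1 < size m)%N.
  rewrite ltnNge; apply/negP => /size1_polyC mE; move: mz mon; rewrite mE rootC monicE lead_coefC.
  by move=> /eqP->; rewrite eq_sym oner_eq0.
have sizen : size n = size m.
  apply/eqP; rewrite eqn_leq sn /= leqNgt; apply/negP => lt_nm.
  move/eqP: n_lead; rewrite nth_default ?(eq_sym 0) ?oner_eq0 //.
  by rewrite -ltnS prednK // (ltn_trans _ m_gt1).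
have [w nw] : exists w, root n w by apply/closed_rootP; rewrite sizen neq_ltn m_gt1 orbT.
exists w => // p q; have [s] := ubnP (size p); elim: s => // s IHs in p q *.
rewrite ltnS => sp pq pz.
have [lt_pm|le_mp] := ltnP (size p) (size m).
  have [p0|p0] := eqVneq p 0.
    have q0 : q = 0 by apply/polyP => i; rewrite coef0; apply: BF (pq i) _; rewrite p0 coef0.
    by rewrite q0 horner0.
  have lp0 : p`_(size p).-1 != 0 by rewrite -/(lead_coef p) lead_coef_eq0.
  have [e ce] := good_inv (pq (size p).-1) lp0.
  have : (size m <= size ((lead_coef p)^-1 *: p)%R)%N.
    apply: minm; apply/boolp.asboolP; exists ((lead_coef p)^-1 *: p), (e%:P * q).
    split=> //; first by rewrite -mul_polyC; apply: BpM; first exact: BpC.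
      by rewrite monicE lead_coefZ mulVf // lead_coef_eq0.
    by rewrite rootE hornerZ pz mulr0.
  by rewrite size_scale ?invr_eq0 ?lead_coef_eq0 // leqNgt lt_pm.
pose a := p`_(size p).-1; pose b := q`_(size p).-1; pose d := (size p - size m)%N.
have p0 : p != 0 by rewrite -size_poly_gt0 (leq_trans _ le_mp) // (ltn_trans _ m_gt1).
have pq' : Bp (p - a%:P * 'X^d * m) (q - b%:P * 'X^d * n).
  by apply: BpD => //; apply: BpN; apply: BpM => //; apply: BpM; [exact: BpC (pq _)|exact: BpXn].
have -> : q.[w] = (q - b%:P * 'X^d * n).[w].
  by rewrite hornerD hornerN hornerM (eqP nw) mulr0 subr0.
apply: IHs pq' _; last first.
  by rewrite hornerD hornerN hornerM (eqP mz) mulr0 subr0 pz.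
apply: leq_trans sp; have a0 : a != 0 by rewrite -/(lead_coef p) lead_coef_eq0.
have sizeX : size (a%:P * 'X^d * m) = size p.
  rewrite size_Mmonic // ?mulf_neq0 ?polyC_eq0 ?expf_neq0 ?polyX_eq0 //.
  by rewrite mul_polyC size_scale // size_polyXn addSn /= subnK.
have lt0p : (0 < size p)%N by rewrite size_poly_gt0.
rewrite -(prednK lt0p) ltnS; apply/leq_sizeP => i; rewrite leq_eqVlt => /orP[/eqP<-|lt_i].
  rewrite coefB -/a -sizeX -/(lead_coef (_ * m)) lead_coef_Mmonic // mul_polyC.
  by rewrite lead_coefZ lead_coefXn mulr1 subrr.
by rewrite prednK // in lt_i; rewrite coefB !nth_default ?subrr // sizeX.
Qed.

Lemma good_extend z : exists B', [/\ good B', forall x y, B x y -> B' x y & exists w, B' z w].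
Proof.
have [w wP] := extend_ex z.
exists (fun x y => exists p q, [/\ Bp p q, x = p.[z] & y = q.[w]]); split; last first.
- exists w, 'X, 'X; rewrite !hornerX; split=> //; exact: (BpXn 1).
- by move=> x y xy; exists x%:P, y%:P; rewrite !hornerC; split=> //; apply: BpC.
split=> [c|x y x' y' [p [q [pq -> ->]]] [p' [q' [pq' -> ->]]]
        |x y x' y' [p [q [pq -> ->]]] [p' [q' [pq' -> ->]]]
        |x y y' [p [q [pq -> ->]]] [p' [q' [pq' e ->]]]].
- by exists (iota c)%:P, (iota c)%:P; rewrite !hornerC; split=> //; apply: BpC.
- by exists (p + p'), (q + q'); rewrite !hornerD; split=> //; apply: BpD.
- by exists (p * p'), (q * q'); rewrite !hornerM; split=> //; apply: BpM.
apply/eqP; rewrite -subr_eq0 -hornerN -hornerD; apply/eqP; apply: wP (BpD pq (BpN pq')) _.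
by rewrite hornerD hornerN e subrr.
Qed.

End Extend.

Lemma good_total (A0 : K -> K -> Prop) : good A0 ->
  exists B, [/\ good B, forall x y, A0 x y -> B x y & forall x, exists y, B x y].
Proof.
move=> gA0.
(* Zorn's lemma is applied to the sets whose union with [A0] is good, so that the empty chain is
   covered too. *)
pose U (A : classical_sets.set (K * K)) x y := A (x, y) \/ A0 x y.
have [|A [gA maxA]] := @classical_sets.Zorn_bigcup (K * K)%type (fun A => good (U A)).
  move=> F FP Ftot.
  have lift2 x y x' y' : U (classical_sets.bigcup F id) x y ->
      U (classical_sets.bigcup F id) x' y' ->
      exists2 C : K -> K -> Prop, good C /\ (C x y /\ C x' y') &
        forall a b, C a b -> U (classical_sets.bigcup F id) a b.
    have upF C : F C -> forall a b, U C a b -> U (classical_sets.bigcup F id) a b.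
      by move=> FC a b [Cab|]; [left; exists C|right].
    move=> [[C FC Cxy]|xy] [[D FD Dxy]|xy'].
    - have [CD|DC] := Ftot _ _ FC FD.
        by exists (U D); [split; [exact: FP|split; left=> //; apply: CD]|apply: upF].
      by exists (U C); [split; [exact: FP|split; left=> //; apply: DC]|apply: upF].
    - by exists (U C); [split; [exact: FP|split; [left|right]]|apply: upF].
    - by exists (U D); [split; [exact: FP|split; [right|left]]|apply: upF].
    - by exists A0 => // a b; right.
  split=> [c|x y x' y' xy xy'|x y x' y' xy xy'|x y y' xy xy'].
  - by right; case: gA0.
  - by have [C [[_ CD _ _] [c1 c2]] up] := lift2 _ _ _ _ xy xy'; apply/up/CD.
  - by have [C [[_ _ CM _] [c1 c2]] up] := lift2 _ _ _ _ xy xy'; apply/up/CM.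
  - by have [C [[_ _ _ CF] [c1 c2]] up] := lift2 _ _ _ _ xy xy'; apply: CF c1 c2.
exists (U A); split=> // [x y|z]; first by right.
have [B' [gB' BB' [w zw]]] := good_extend gA z.
exists w; apply: boolp.contrapT => nzw.
apply: (maxA (fun xy => B' xy.1 xy.2)).
  split; first by move=> [x y] Axy; apply: BB'; left.
  by move=> sub; apply: nzw; left; apply: (sub (z, w)).
suff -> : U (fun xy => B' xy.1 xy.2) = B' by [].
apply: boolp.funext => x; apply: boolp.funext => y; apply: boolp.propext; split; last by left.
by case=> // xy; apply: BB'; right.
Qed.

Lemma automorphism_ex (nu nu' : K) :
  (forall q, root (map_poly iota q) nu -> root (map_poly iota q) nu') ->
  exists2 h : {rmorphism K -> K}, fixes_base iota h & h nu = nu'.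
Proof.
move=> nunu'.
(* The homomorphism from [k[nu]] that sends [nu] to [nu']; the hypothesis makes it well defined. *)
have gA0 : good (fun x y => exists q, x = (map_poly iota q).[nu] /\ y = (map_poly iota q).[nu']).
  split=> [c|x y x' y' [p [-> ->]] [p' [-> ->]]|x y x' y' [p [-> ->]] [p' [-> ->]]
          |x y y' [p [-> ->]] [p' [e ->]]].
  - by exists c%:P; rewrite map_polyC !hornerC.
  - by exists (p + p'); rewrite rmorphD !hornerD.
  - by exists (p * p'); rewrite rmorphM !hornerM.
  have := nunu' (p - p'); rewrite !rootE rmorphB !hornerD !hornerN e subrr eqxx.
  by move=> /(_ isT); rewrite subr_eq0 => /eqP.
have [B [[Bi BD BM BF] A0B tot]] := good_total gA0.
have [f fP] := boolp.choice tot.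
have f_add : {morph f : x y / x - y}.
  move=> x y; apply: BF (fP _) _; apply: (BD) => //.
  rewrite -mulN1r -[- f y]mulN1r; apply: BM => //.
  by have := Bi (-1); rewrite rmorphN rmorph1.
have f_mul : {morph f : x y / x * y} by move=> x y; apply: BF (fP _) _; apply: BM.
have f_1 : f 1 = 1 by apply: BF (fP _) _; have := Bi 1; rewrite rmorph1.
pose fA := GRing.isZmodMorphism.Build K K f f_add.
pose fM := GRing.isMonoidMorphism.Build K K f (f_1, f_mul).
pose h : {rmorphism K -> K} := HB.pack f fA fM.
exists h; first by move=> c; apply: BF (fP _) (Bi c).
by apply: BF (fP _) _; apply: A0B; exists 'X; rewrite map_polyX !hornerX.
Qed.

Lemma fixed_in_base (nu : K) :
  (forall h : {rmorphism K -> K}, fixes_base iota h -> h nu = nu) -> exists c, nu = iota c.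
Proof.
move=> fix_nu; apply: boolp.contrapT => nk.
have [|nu' /eqP ne conj] := @conjugate_ex nu; first by move=> c nuE; apply: nk; exists c.
by have [h /fix_nu hnu hE] := automorphism_ex conj; apply: ne; rewrite -hE.
Qed.

End Fixed.

(** * Morphisms of projective sets *)

Section SamePoint.

Variable K : closedFieldType.

Lemma same_pt_refl n (x : 'cV[K]_n.+1) : same_pt x x.
Proof. by exists 1; rewrite ?oner_eq0 ?scale1r. Qed.

Lemma same_pt_sym n (x y : 'cV[K]_n.+1) : same_pt x y -> same_pt y x.
Proof.
by case=> c c0 ->; exists c^-1; rewrite ?invr_eq0 // scalerA mulVf // scale1r.
Qed.

Lemma same_pt_trans n (y x z : 'cV[K]_n.+1) : same_pt x y -> same_pt y z -> same_pt x z.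
Proof.
by case=> c c0 -> [d d0 ->]; exists (d * c); rewrite ?mulf_neq0 // scalerA.
Qed.

Lemma same_ptZ n c (x : 'cV[K]_n.+1) : c != 0 -> same_pt x (c *: x).
Proof. by exists c. Qed.

Lemma same_pt_mul n m (M : 'M[K]_(m.+1, n.+1)) x y : same_pt x y -> same_pt (M *m x) (M *m y).
Proof. by case=> c c0 ->; exists c; rewrite // scalemxAr. Qed.

Lemma same_pt_sig (x y : 'cV[K]_3) : same_pt x y -> same_pt (sig x) (sig y).
Proof. by case=> c c0 ->; exists (c ^+ 2); rewrite ?sigZ ?expf_neq0. Qed.

Lemma same_pt_map n (h : {rmorphism K -> K}) (x y : 'cV[K]_n.+1) :
  same_pt x y -> same_pt (map_mx h x) (map_mx h y).
Proof. by case=> c c0 ->; exists (h c); rewrite ?fmorph_eq0 // map_mxZ. Qed.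

Lemma same_pt_neq0 n (x y : 'cV[K]_n.+1) : same_pt x y -> (y != 0) = (x != 0).
Proof. by case=> c c0 ->; rewrite scaler_eq0 (negPf c0). Qed.

Lemma same_pt_par (x y : 'cV[K]_3) : same_pt x y -> par x y.
Proof. by case=> c _ ->; apply/parZr/par_refl. Qed.

Lemma par_same_pt (x y : 'cV[K]_3) : x != 0 -> y != 0 -> par x y -> same_pt x y.
Proof.
move=> x0 y0 /(parP x0)[c yE]; exists c => //.
by apply: contraNneq y0 => c0; rewrite yE c0 scale0r.
Qed.

Lemma same_pt_pi3 (x y : 'cV[K]_3) : same_pt x y -> (pi3 y != 0) = (pi3 x != 0).
Proof. by case=> c c0 ->; rewrite /pi3 !mxE !mulf_eq0 !(negPf c0). Qed.

Lemma same_pt_map_inv (h : {rmorphism K -> K}) (x y : 'cV[K]_3) :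
  x != 0 -> y != 0 -> same_pt (map_mx h x) (map_mx h y) -> same_pt x y.
Proof.
move=> x0 y0 /same_pt_par xy; apply: par_same_pt => // i j.
by apply: (fmorph_inj h); rewrite !rmorphM; have := xy i j; rewrite !mxE.
Qed.

Lemma pi3_neq0 (x : 'cV[K]_3) : pi3 x != 0 -> x != 0.
Proof. by apply: contraNneq => ->; rewrite /pi3 !mxE !mul0r. Qed.

Lemma pi3P (x : 'cV[K]_3) : reflect (forall i, x i 0 != 0) (pi3 x != 0).
Proof.
rewrite /pi3 !mulf_eq0 !negb_or -andbA; apply: (iffP and3P) => [[x0 x1 x2]|x0]; last by split; apply: x0.
exact: (@ord3P (fun i => x i 0 != 0)).
Qed.

Lemma pi3_sig (x : 'cV[K]_3) : (pi3 (sig x) != 0) = (pi3 x != 0).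
Proof.
rewrite /pi3 !mxE !ord3_add !mulf_eq0.
by do 3![case: (_ == 0)].
Qed.

End SamePoint.

Section Evaluation.

Variables (K : closedFieldType) (E : fieldType) (e : {rmorphism E -> K}).

Lemma pevalE n (p : {mpoly E[n.+1]}) (x : 'cV[K]_n.+1) :
  peval e p x = \sum_(m <- msupp p) e p@_m * \prod_i x i 0 ^+ m i.
Proof.
rewrite /peval mevalE (perm_big _ (msupp_map_mpoly p (fmorph_inj e))).
by apply: eq_bigr => m _; rewrite mcoeff_map_mpoly.
Qed.

Lemma pfun_sum n I (r : seq I) (F : I -> 'cV[K]_n -> K) :
  (forall i, pfun (F i)) -> pfun (fun x => \sum_(i <- r) F i x).
Proof.
move=> hF c; have /boolp.choice[p pE] := fun i => hF i c.
by exists (\sum_(i <- r) p i) => s; rewrite horner_sum; apply: eq_bigr => i _; apply: pE.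
Qed.

Lemma pfun_prod n I (r : seq I) (F : I -> 'cV[K]_n -> K) :
  (forall i, pfun (F i)) -> pfun (fun x => \prod_(i <- r) F i x).
Proof.
move=> hF c; have /boolp.choice[p pE] := fun i => hF i c.
by exists (\prod_(i <- r) p i) => s; rewrite horner_prod; apply: eq_bigr => i _; apply: pE.
Qed.

Lemma pfunX n (q : 'cV[K]_n -> K) d : pfun q -> pfun (fun x => q x ^+ d).
Proof.
by move=> hq c; have [p pE] := hq c; exists (p ^+ d) => s; rewrite horner_exp pE.
Qed.

Lemma pfun_peval n (p : {mpoly E[n.+1]}) : pfun (peval e p).
Proof.
rewrite (_ : peval e p = fun x : 'cV_n.+1 => \sum_(m <- msupp p) e p@_m * \prod_i x i 0 ^+ m i); last first.
  by apply: boolp.funext => x; apply: pevalE.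
apply: pfun_sum => m; apply: pfunM; first exact: pfun_const.
by apply: pfun_prod => i; apply: pfunX; apply: pfun_coord.
Qed.

Lemma pmap_teval n m (F : ptuple E n m) : pmap (teval e F).
Proof.
move=> i; rewrite (_ : (fun _ => _) = peval e (F i)); first exact: pfun_peval.
by apply: boolp.funext => x; rewrite mxE.
Qed.

Lemma pevalZ n d (p : {mpoly E[n.+1]}) c (x : 'cV[K]_n.+1) : p \is d.-homog ->
  peval e p (c *: x) = c ^+ d * peval e p x.
Proof.
move=> /dhomogP hp; rewrite !pevalE mulr_sumr; apply: eq_big_seq => m /hp md.
rewrite mulrCA; congr (_ * _); rewrite (_ : d = mdeg m) // mdegE -prodrXr -big_split /=.
by apply: eq_bigr => i _; rewrite mxE exprMn.
Qed.

Lemma teval_same n m (F : ptuple E n m) x y : homog_tuple F ->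
  same_pt x y -> same_pt (teval e F x) (teval e F y).
Proof.
move=> [d hF] [c c0 ->]; exists (c ^+ d); first by rewrite expf_neq0.
by apply/colP => i; rewrite !mxE (pevalZ _ _ (hF i)).
Qed.

Lemma map_peval n (h : {rmorphism K -> K}) (p : {mpoly E[n.+1]}) (x : 'cV[K]_n.+1) :
  (forall c, h (e c) = e c) -> h (peval e p x) = peval e p (map_mx h x).
Proof.
move=> he; rewrite !pevalE rmorph_sum; apply: eq_bigr => m _.
rewrite rmorphM he rmorph_prod; congr (_ * _).
by apply: eq_bigr => i _; rewrite rmorphXn mxE.
Qed.

Lemma map_teval n m (h : {rmorphism K -> K}) (F : ptuple E n m) x :
  (forall c, h (e c) = e c) -> map_mx h (teval e F x) = teval e F (map_mx h x).
Proof. by move=> he; apply/colP => i; rewrite !mxE map_peval. Qed.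

End Evaluation.

Section Morphisms.

Variable K : closedFieldType.

Definition cone n (X : pset K n) := forall x y, X x -> same_pt x y -> X y.

Lemma cone_plane : cone (@plane K).
Proof. by move=> x y x0 /same_pt_neq0; rewrite /plane => ->. Qed.

Lemma cone_closed (E : fieldType) (e : {rmorphism E -> K}) n (X : pset K n) :
  closed_over e X -> cone X.
Proof.
case=> ps ps_homog XE x y Xx xy; have [x0 px] := (XE x).1 Xx; apply/XE; split.
  by rewrite (same_pt_neq0 xy).
move=> p pin; have [d hp] := ps_homog p pin; case: xy => c _ ->.
by rewrite (pevalZ _ _ _ hp) px // mulr0.
Qed.

Lemma closed_map (E : fieldType) (e : {rmorphism E -> K}) n (X : pset K n)
    (h : {rmorphism K -> K}) : (forall c, h (e c) = e c) -> closed_over e X ->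
  forall x, X x -> X (map_mx h x).
Proof.
move=> he [ps _ XE] x /XE[x0 px]; apply/XE; split; first by rewrite map_mx_eq0.
by move=> p pin; rewrite -map_peval // px // rmorph0.
Qed.

(* The local formulas no longer have to be homogeneous: this is stable under composition. *)
Definition lrep n m (X : pset K n) (f : 'cV[K]_n.+1 -> 'cV[K]_m.+1) x :=
  exists F q, [/\ pmap F, pfun q, q x != 0 &
    forall y, X y -> q y != 0 -> F y != 0 /\ same_pt (f y) (F y)].

Definition mor n m (X : pset K n) (Y : pset K m) (f : 'cV[K]_n.+1 -> 'cV[K]_m.+1) :=
  [/\ forall x, X x -> Y (f x),
      forall x y, X x -> same_pt x y -> same_pt (f x) (f y) &
      forall x, X x -> lrep X f x].

Lemma pfun_ext n (q r : 'cV[K]_n -> K) : q =1 r -> pfun q -> pfun r.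
Proof. by move=> /boolp.funext->. Qed.

Lemma pmapZ n m c (F : 'cV[K]_n -> 'cV[K]_m) : pmap F -> pmap (fun x => c *: F x).
Proof.
move=> hF i; apply: (@pfun_ext _ (fun x => c * F x i 0)); first by move=> x; rewrite mxE.
by apply: pfunM; [apply: pfun_const|apply: hF].
Qed.

Lemma lrep_comp n m l (X : pset K n) (Y : pset K m) f (g : 'cV[K]_m.+1 -> 'cV[K]_l.+1) x :
  (forall y z, X y -> z != 0 -> same_pt (f y) z -> Y z) -> X x -> lrep X f x ->
  (forall x y, Y x -> same_pt x y -> same_pt (g x) (g y)) ->
  lrep Y g (f x) -> lrep X (g \o f) x.
Proof.
move=> XY Xx [F [q [hF hq qx FE]]] gs [G [r [hG hr rx GE]]].
have [_ fx] := FE x Xx qx.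
have [c c0 fE] := fx.
(* Scaled so that [F' x] equals the representative [f x], at which [r] is known to be nonzero. *)
pose F' y := c^-1 *: F y.
have hF' : pmap F' by apply: pmapZ.
exists (G \o F'), (fun y => q y * r (F' y)); split.
- exact: pmap_comp.
- by apply: pfunM => //; apply: (pfun_comp hF' hr).
- by rewrite mulf_neq0 // /F' fE scalerA mulVf // scale1r.
move=> y Xy; rewrite mulf_eq0 negb_or => /andP[qy ry].
have [F0 fy] := FE y Xy qy.
have fy' : same_pt (f y) (F' y).
  by apply: same_pt_trans fy _; apply: same_ptZ; rewrite invr_eq0.
have F'0 : F' y != 0 by rewrite scaler_eq0 invr_eq0 (negPf c0).
have [G0 gG] := GE _ (XY _ _ Xy F'0 fy') ry; split=> //.
apply: same_pt_trans gG; apply: gs => //.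
apply: (XY _ _ Xy) (same_pt_refl _); by rewrite -(same_pt_neq0 fy').
Qed.

Lemma mor_comp n m l (X : pset K n) (Y : pset K m) (Z : pset K l) f g :
  cone Y -> mor X Y f -> mor Y Z g -> mor X Z (g \o f).
Proof.
move=> cY [XY fs fl] [YZ gs gl]; split.
- by move=> x /XY/YZ.
- by move=> x y Xx xy; apply: gs; [apply: XY|apply: fs].
move=> x Xx; apply: (lrep_comp _ Xx (fl x Xx) gs); last exact/gl/XY.
by move=> y z /XY Yf _; apply: cY.
Qed.

Lemma morphism_mor (E : fieldType) (e : {rmorphism E -> K}) n m (X : pset K n) (Y : pset K m) f :
  cone X -> morphism_over e X Y f -> mor X Y f.
Proof.
move=> cX fP; split=> [x /fP[]//|x y Xx xy|x Xx].
  have [_ [F [hF Fx FE]]] := fP x Xx; have Fxy := teval_same e hF xy.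
  apply: same_pt_trans (FE _ Xx Fx) (same_pt_trans Fxy _); apply/same_pt_sym/FE.
    exact: cX xy.
  by rewrite (same_pt_neq0 Fxy).
have [_ [F [hF Fx FE]]] := fP x Xx; have [i Fi] := neq0_coord Fx.
exists (teval e F), (fun y => teval e F y i 0); split=> //; first exact: pmap_teval.
  exact: pmap_teval.
move=> y Xy Fy; have F0 : teval e F y != 0 by apply: contraNneq Fy => ->; rewrite mxE.
by split=> //; apply: FE.
Qed.

Lemma morphism_map (E : fieldType) (e : {rmorphism E -> K}) n m (X : pset K n) (Y : pset K m) f
    (h : {rmorphism K -> K}) : (forall c, h (e c) = e c) -> closed_over e X ->
  morphism_over e X Y f -> forall x, X x -> same_pt (map_mx h (f x)) (f (map_mx h x)).
Proof.
move=> he cX fP x Xx; have [_ [F [hF Fx FE]]] := fP x Xx.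
have hx := closed_map he cX Xx; apply: same_pt_trans (same_pt_map h (FE x Xx Fx)) _.
rewrite map_teval //; apply/same_pt_sym/FE => //.
by rewrite -map_teval // map_mx_eq0.
Qed.

End Morphisms.

(** * Morphisms of the plane along lines *)

Section PlaneMorphisms.

Variable K : closedFieldType.
Implicit Types (x y z v : 'cV[K]_3) (f g : 'cV[K]_3 -> 'cV[K]_3).

Notation plane := (@plane K).
Notation pmor f := (mor plane plane f).

Lemma pmap_curve n m (F : 'cV[K]_n -> 'cV[K]_m) (c : 'cV[{poly K}]_n) : pmap F ->
  exists d, forall s, F (evmx s c) = evmx s d.
Proof.
move=> hF; have /boolp.choice[p pE] := fun i => hF i c.
by exists (\col_i p i) => s; apply/colP => i; rewrite pE !mxE.
Qed.

Lemma primitive_part m (c : 'cV[{poly K}]_m) : c != 0 ->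
  exists (a : {poly K}) (d : 'cV[{poly K}]_m), [/\ a != 0, c = a *: d & forall s, evmx s d != 0].
Proof.
move=> /neq0_coord[i ci].
have [n] := ubnP (size (c i 0)); elim: n => // n IHn in c ci *; rewrite ltnS => sc.
have [[s cs]|nc] := boolp.pselect (exists s, evmx s c = 0); last first.
  exists 1, c; rewrite oner_eq0 scale1r; split=> // s.
  by apply/eqP => cs; apply: nc; exists s.
have /boolp.choice[d dE] : forall j, exists p, c j 0 = p * ('X - s%:P).
  move=> j; apply/factor_theorem; have /colP/(_ j) := cs.
  by rewrite !mxE => cj; apply/eqP.
have di : d i != 0 by apply: contraNneq ci => di; rewrite dE di mul0r.
have [||g [e [g0 eE e0]]] := IHn (\col_j d j); rewrite ?mxE //.
  by apply: leq_trans sc; rewrite dE size_mul ?polyXsubC_eq0 // size_XsubC addn2.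
exists (('X - s%:P) * g), e; split=> //; first by rewrite mulf_neq0 ?polyXsubC_eq0.
by rewrite -scalerA -eE; apply/colP => j; rewrite dE !mxE mulrC.
Qed.

Lemma polyvec_par (c d : 'cV[{poly K}]_3) (p : {poly K}) : p != 0 ->
  (forall s, p.[s] != 0 -> par (evmx s c) (evmx s d)) -> forall s, par (evmx s c) (evmx s d).
Proof.
move=> p0 cd; suff cdE : par c d.
  by move=> s i j; have := congr1 (horner_eval s) (cdE i j); rewrite !rmorphM !mxE.
move=> i j; apply/eqP; rewrite -subr_eq0; apply/eqP; apply: (mulIf p0); rewrite mul0r.
apply: poly_fun0 => s; rewrite hornerM; have [->|/cd/(_ i j)] := eqVneq p.[s] 0.
  by rewrite mulr0.
by rewrite !mxE /horner_eval => e; rewrite hornerD hornerN !hornerM e subrr mul0r.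
Qed.

(** Along an affine line the local formulas glue: the primitive part of one of them vanishes
    nowhere, and its proportionality to any other is a polynomial identity in the parameter. *)
Lemma line_rep f x v : pmor f -> (forall t, x + t *: v != 0) ->
  exists c, forall t, evmx t c != 0 /\ same_pt (f (x + t *: v)) (evmx t c).
Proof.
move=> [_ _ fl] xv; have x0 : x != 0 by have := xv 0; rewrite scale0r addr0.
have rep t : exists F (q : {poly K}), q.[t] != 0 /\
    forall s, q.[s] != 0 -> evmx s F != 0 /\ same_pt (f (x + s *: v)) (evmx s F).
  have [F [q [hF hq qt FE]]] := fl _ (xv t).
  have [c cE] := pmap_curve (line x v) hF; have [p pE] := hq (line x v).
  exists c, p; split; first by rewrite -pE evmx_line.
  by move=> s; rewrite -pE -cE !evmx_line; apply: FE; apply: xv.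
have [c [q [q0 cE]]] := rep 0.
have c0 : c != 0.
  have [+ _] := cE 0 q0; apply: contraNneq => ->.
  by apply/eqP/colP => i; rewrite !mxE /horner_eval horner0.
have [g [d [g0 cd d0]]] := primitive_part c0.
exists d => t; split=> //; have [F [r [rt FE]]] := rep t.
have [Ft fF] := FE t rt; apply: same_pt_trans fF _; apply: par_same_pt => //.
apply: (@polyvec_par _ _ (q * r * g)).
  by rewrite !mulf_neq0 //; [apply: contraNneq q0|apply: contraNneq rt] => ->; rewrite horner0.
move=> s; rewrite !hornerM !mulf_eq0 !negb_or -andbA => /and3P[qs rs gs].
have [_ f1] := cE s qs; have [_ f2] := FE s rs.
apply/same_pt_par/(same_pt_trans (same_pt_sym f2))/(same_pt_trans f1).
rewrite cd; apply: same_pt_sym; exists g.[s] => //.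
by apply/colP => i; rewrite !mxE /horner_eval hornerM.
Qed.

(** The two local formulas are compared on a line through [x] that meets the generic set. The
    statement is local at [x] so that it applies to [sig], which is not a morphism on the whole
    plane. *)
Lemma lrep_eq f g x : x != 0 -> lrep plane f x -> lrep plane g x ->
  generic (fun y => y != 0 -> same_pt (f y) (g y)) -> same_pt (f x) (g x).
Proof.
move=> x0 [F [q [hF hq qx FE]]] [G [r [hG hr rx GE]]] /genericI/(_ (@generic_neq0 K)).
move=> /(generic_line x)[v [p p0 fg]].
have [c cE] := pmap_curve (line x v) hF; have [d dE] := pmap_curve (line x v) hG.
have [q' qE] := hq (line x v); have [r' rE] := hr (line x v).
have xE : x = evmx 0 (line x v) by rewrite evmx_line scale0r addr0.
have [F0 fF] := FE x x0 qx; have [G0 gG] := GE x x0 rx.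
apply: same_pt_trans fF _; apply: same_pt_trans (same_pt_sym gG).
apply: par_same_pt => //; rewrite xE cE dE.
apply: (@polyvec_par _ _ (p * q' * r')).
  rewrite !mulf_neq0 //; [apply: contraNneq qx => e|apply: contraNneq rx => e].
    by rewrite xE qE e horner0.
  by rewrite xE rE e horner0.
move=> s; rewrite !hornerM !mulf_eq0 !negb_or -andbA => /and3P[/fg[fgs y0] qs rs].
rewrite -cE -dE !evmx_line; rewrite -qE evmx_line in qs; rewrite -rE evmx_line in rs.
have [_ f1] := FE _ y0 qs; have [_ f2] := GE _ y0 rs.
by apply/same_pt_par/(same_pt_trans (same_pt_sym f1))/(same_pt_trans (fgs y0)).
Qed.

Lemma mor_eq f g : pmor f -> pmor g ->
  generic (fun y => y != 0 -> same_pt (f y) (g y)) -> forall x, x != 0 -> same_pt (f x) (g x).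
Proof. by move=> [_ _ hf] [_ _ hg] fg x x0; apply: lrep_eq => //; [apply: hf|apply: hg]. Qed.

Lemma generic_mor f g (P : 'cV[K]_3 -> Prop) : pmor f -> pmor g ->
  (forall x, x != 0 -> same_pt (f (g x)) x) ->
  (forall x y, P x -> same_pt x y -> P y) ->
  generic P -> generic (fun x => x != 0 -> P (f x)).
Proof.
move=> [_ fs fl] [g0 _ _] fg Pinv [q hq [[y qy] qP]].
have [y' [y'0 qy']] := generic_ex (genericI (@generic_neq0 K) (generic_pfun hq (ex_intro _ y qy))).
have gy0 := g0 _ y'0; have [F [r [hF hr rx FE]]] := fl _ gy0.
have [_ fF] := FE _ gy0 rx.
have [c c0 yE] := same_pt_trans (same_pt_sym fF) (fg _ y'0).
exists (fun x => q (c *: F x) * r x).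
  by apply: pfunM => //; apply: (pfun_comp (pmapZ c hF) hq).
split; first by exists (g y'); rewrite -yE mulf_neq0.
move=> x; rewrite mulf_eq0 negb_or => /andP[/qP Pc rx'] x0.
have [_ fFx] := FE _ x0 rx'; apply: Pinv Pc _; apply: same_pt_sym.
exact: same_pt_trans fFx (same_ptZ _ c0).
Qed.

Lemma lrep_sig x : sig x != 0 -> lrep plane (@sig K) x.
Proof.
move=> /neq0_coord[i si]; exists (@sig K), (fun x => sig x i 0); split=> //.
- exact: pmap_sig.
- exact: pmap_sig.
move=> y _ yi; split; last exact: same_pt_refl.
by apply: contraNneq yi => ->; rewrite mxE.
Qed.

Lemma mor_mul (M : 'M[K]_3) : M \in unitmx -> pmor (fun x => M *m x).
Proof.
move=> uM; split=> [x|x y _|x x0]; first by rewrite /Defs.plane mulmx_eq0.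
  exact: same_pt_mul.
have [i xi] : exists i, (M *m x) i 0 != 0 by apply: neq0_coord; rewrite mulmx_eq0.
exists (fun x => M *m x), (fun x => (M *m x) i 0); split=> //; try exact: pmap_mul.
by move=> y y0 _; split; [rewrite mulmx_eq0|apply: same_pt_refl].
Qed.

End PlaneMorphisms.

(** * Automorphisms of the plane compatible with the quadratic map *)

Section Rigidity.

Variable K : closedFieldType.
Implicit Types (x y z v : 'cV[K]_3) (i j l : 'I_3).

Notation plane := (@plane K).
Notation pmor f := (mor plane plane f).
Notation ei := (ei K).

Definition pinv (f g : 'cV[K]_3 -> 'cV[K]_3) :=
  [/\ pmor f, pmor g, forall x, x != 0 -> same_pt (g (f x)) x &
      forall x, x != 0 -> same_pt (f (g x)) x].

Lemma pinv_sym f g : pinv f g -> pinv g f.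
Proof. by case. Qed.

Lemma pinv_inj f g x y : pinv f g -> x != 0 -> y != 0 -> same_pt (f x) (f y) -> same_pt x y.
Proof.
move=> [[f0 _ _] [_ gs _] gf _] x0 y0 xy.
apply: same_pt_trans (same_pt_sym (gf x x0)) _; apply: same_pt_trans (gf y y0).
by apply: gs xy; apply: f0.
Qed.

Definition quadratic_rel (al be : 'cV[K]_3 -> 'cV[K]_3) := generic (fun x =>
  [/\ pi3 x != 0, pi3 (be x) != 0 & same_pt (sig x) (al (sig (be x)))]).

Lemma sig_neq0 x : pi3 x != 0 -> sig x != 0.
Proof. by rewrite -pi3_sig => /pi3_neq0. Qed.

Lemma same_pt_sig_inv x y : pi3 x != 0 -> pi3 y != 0 -> same_pt (sig x) (sig y) -> same_pt x y.
Proof.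
move=> px py /same_pt_sig; rewrite !sigK => xy.
apply: same_pt_trans (same_ptZ x px) _; apply: same_pt_trans xy _.
exact/same_pt_sym/same_ptZ.
Qed.

Lemma line_neq0 i t : ei (i + 1) + t *: ei (i + 2) != 0.
Proof.
apply/eqP => /colP/(_ (i + 1)); rewrite !mxE eqxx !andbT.
rewrite (_ : i + 1 == i + 2 = false); last by move: i; apply: ord3P; rewrite ?ord3_add.
by rewrite mulr0 addr0 => /eqP; rewrite oner_eq0.
Qed.

Lemma line_neq0' i t : ei (i + 2) + t *: ei (i + 1) != 0.
Proof.
apply/eqP => /colP/(_ (i + 2)); rewrite !mxE eqxx !andbT.
rewrite (_ : i + 2 == i + 1 = false); last by move: i; apply: ord3P; rewrite ?ord3_add.
by rewrite mulr0 addr0 => /eqP; rewrite oner_eq0.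
Qed.

Lemma sig_line i t : sig (ei (i + 1) + t *: ei (i + 2)) = t *: ei i.
Proof.
apply/colP => j; rewrite !mxE.
by move: i j; apply: ord3P; apply: ord3P; rewrite !ord3_add /= ?(mul0r, mulr0, addr0, add0r, mulr1, mul1r).
Qed.

Lemma side_line x i : x i 0 = 0 -> x = x (i + 1) 0 *: ei (i + 1) + x (i + 2) 0 *: ei (i + 2).
Proof.
move=> xi; apply/colP => j; rewrite !mxE.
by move: i j xi; apply: ord3P; apply: ord3P; rewrite !ord3_add /= => xi;
  rewrite ?(mul0r, mulr0, addr0, add0r, mulr1, mul1r) ?xi.
Qed.

Lemma poly_nonroot2 (p : {poly K}) : p != 0 ->
  exists t1 t2, [/\ t1 != 0, t2 != 0, t1 != t2, p.[t1] != 0 & p.[t2] != 0].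
Proof.
move=> p0; have [|t1] := @poly_nonroot K (p * 'X); first by rewrite mulf_neq0 ?polyX_eq0.
rewrite hornerM hornerX mulf_eq0 negb_or => /andP[p1 t1n].
have [|t2] := @poly_nonroot K (p * ('X * ('X - t1%:P))).
  by rewrite !mulf_neq0 ?polyX_eq0 ?polyXsubC_eq0.
rewrite !hornerM hornerX hornerXsubC !mulf_eq0 !negb_or subr_eq0 => /and3P[p2 t2n t12].
by exists t1, t2; split; rewrite // eq_sym.
Qed.

Section Triangle.

Variables (al al' be be' : 'cV[K]_3 -> 'cV[K]_3).
Hypothesis al_inv : pinv al al'.
Hypothesis be_inv : pinv be be'.
Hypothesis rel : quadratic_rel al be.

Let al_mor : pmor al. Proof. by case: al_inv. Qed.
Let be_mor : pmor be. Proof. by case: be_inv. Qed.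
Let be0 x : x != 0 -> be x != 0. Proof. by case: be_mor => + _ _; apply. Qed.
Let bes x y : x != 0 -> same_pt x y -> same_pt (be x) (be y).
Proof. by case: be_mor => _ + _; apply. Qed.

(** Both sides of the quadratic relation have local formulas at this point of a side of the
    triangle, so the relation extends to it, and there [sig] takes the value [e_i]. *)
Lemma side_full i t : t != 0 -> pi3 (be (ei (i + 1) + t *: ei (i + 2))) != 0 ->
  same_pt (ei i) (al (sig (be (ei (i + 1) + t *: ei (i + 2))))).
Proof.
set x := _ + _ => t0 bx; have x0 : x != 0 := line_neq0 i t.
have sx : sig x = t *: ei i by apply: sig_line.
apply: same_pt_trans (same_ptZ _ t0) _; rewrite -sx.
have [al0 als all] := al_mor; have [_ _ bel] := be_mor.
have bxs : sig (be x) != 0 := sig_neq0 bx.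
apply: (lrep_eq (g := al \o (@sig K \o be)) x0).
- by apply: lrep_sig; rewrite sx scaler_eq0 (negPf t0) ei_neq0.
- apply: (@lrep_comp _ _ _ _ _ plane) => //; last exact: all.
  apply: (@lrep_comp _ _ _ _ _ plane) => //; [exact: bel| |exact: lrep_sig].
  by move=> y z _; apply: same_pt_sig.
by apply: genericW rel => y [].
Qed.

(* If [be] mapped a point of the line [x_i = 0] off the coordinate triangle, it would do so for
   infinitely many, and the injective map [al o sig o be] would send all of them to [e_i]. *)
Lemma side_image i : exists l, forall x, x != 0 -> x i 0 = 0 -> be x l 0 = 0.
Proof.
have [c cE] := line_rep be_mor (line_neq0 i).
have pc : pi3 c = 0.
  apply/eqP; apply: contraT => /poly_nonroot2[t1 [t2 [t10 t20 t12 p1 p2]]].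
  have full t : (pi3 c).[t] != 0 -> pi3 (be (ei (i + 1) + t *: ei (i + 2))) != 0.
    move=> pt; have [_ /same_pt_pi3 <-] := cE t.
    by move: pt; rewrite /pi3 !mxE !hornerM.
  have f1 := full _ p1; have f2 := full _ p2.
  have := same_pt_trans (same_pt_sym (side_full t10 f1)) (side_full t20 f2).
  move/(pinv_inj al_inv (sig_neq0 f1) (sig_neq0 f2))/(same_pt_sig_inv f1 f2).
  move/(pinv_inj be_inv (line_neq0 i t1) (line_neq0 i t2)) => [a a0 e].
  have := congr1 (fun v : 'cV_3 => v (i + 1) 0) e; have := congr1 (fun v : 'cV_3 => v (i + 2) 0) e.
  have ne : (i + 1 == i + 2) = false by move: (i); apply: ord3P; rewrite ?ord3_add.
  rewrite !mxE !eqxx !andbT ne [i + 2 == _]eq_sym ne.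
  rewrite !(mulr0, mulr1, addr0, add0r) => t2E a1.
  by move: t12; rewrite t2E -a1 mul1r eqxx.
have [l cl] : exists l, c l 0 = 0.
  move/eqP: pc; rewrite /pi3 !mulf_eq0 => /orP[/orP[]|] /eqP cl.
  - by exists 0.
  - by exists 1.
  - by exists 2.
have line0 t : be (ei (i + 1) + t *: ei (i + 2)) l 0 = 0.
  have [_ /same_pt_sym[a _ ->]] := cE t.
  by rewrite !mxE cl /horner_eval horner0 mulr0.
(* A second chart of the line, to reach its point [e_(i+2)]. *)
have [d dE] := line_rep be_mor (line_neq0' i).
have dl : d l 0 = 0.
  apply: (mulIf (negbT (polyX_eq0 K))); rewrite mul0r; apply: poly_fun0 => t.
  rewrite hornerM hornerX; have [->|t0] := eqVneq t 0; first by rewrite mulr0.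
  have [_ /(same_pt_trans _) fE] := dE t.
  have [a _] : same_pt (be (ei (i + 1) + t^-1 *: ei (i + 2))) (evmx t d).
    apply: fE; apply: bes; first exact: line_neq0.
    by exists t => //; rewrite scalerDr scalerA mulfV // scale1r addrC.
  by move=> /colP/(_ l); rewrite !mxE line0 mulr0 /horner_eval => ->; rewrite mul0r.
exists l => x x0 /side_line xE.
have [x2|x2] := eqVneq (x (i + 1) 0) 0.
  have [a _ ->] : same_pt (evmx 0 d) (be x).
    apply: same_pt_trans (same_pt_sym (dE 0).2) _; apply: bes; first exact: line_neq0'.
    exists (x (i + 2) 0); last by rewrite {1}xE x2 !scale0r add0r addr0.
    by apply: contraNneq x0 => x3; rewrite xE x2 x3 !scale0r addr0.
  by rewrite !mxE dl /horner_eval horner0 mulr0.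
have [a _ ->] : same_pt (be (ei (i + 1) + (x (i + 2) 0 / x (i + 1) 0) *: ei (i + 2))) (be x).
  apply: bes; first exact: line_neq0.
  exists (x (i + 1) 0) => //; rewrite scalerDr scalerA mulrCA mulfV // mulr1; exact: xE.
by rewrite mxE line0 mulr0.
Qed.

Lemma quadratic_rel_inv : quadratic_rel al' be'.
Proof.
have [_ be'_mor be'be bebe'] := be_inv; have [_ al'_mor al'al _] := al_inv.
pose P x := x != 0 /\ [/\ pi3 x != 0, pi3 (be x) != 0 & same_pt (sig x) (al (sig (be x)))].
have Pinv x y : P x -> same_pt x y -> P y.
  move=> [x0 [px pbx sx]] xy; have bxy := bes x0 xy; split; first by rewrite (same_pt_neq0 xy).
  rewrite (same_pt_pi3 xy) (same_pt_pi3 bxy); split=> //.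
  apply: same_pt_trans (same_pt_sym (same_pt_sig xy)) (same_pt_trans sx _).
  have [_ als _] := al_mor; apply: als; [exact: sig_neq0|exact: same_pt_sig].
have gP : generic P by apply: genericI rel; apply: generic_neq0.
have := generic_mor be'_mor be_mor be'be Pinv gP.
move=> /(genericI (@generic_pi3 K)); apply: genericW => x [px] /(_ (pi3_neq0 px)) [b0 [pb pbb sb]].
split=> //; apply: same_pt_sym; have x0 := pi3_neq0 px.
have sb' : same_pt (sig (be' x)) (al (sig x)).
  apply: same_pt_trans sb _; have [_ als _] := al_mor; apply: als; first exact: sig_neq0.
  exact/same_pt_sig/bebe'.
have [_ al's _] := al'_mor; apply: same_pt_trans (al's _ _ _ sb') (al'al _ _); exact: sig_neq0.
Qed.

End Triangle.

Section Monomial.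

Variables (al al' be be' : 'cV[K]_3 -> 'cV[K]_3).
Hypothesis al_inv : pinv al al'.
Hypothesis be_inv : pinv be be'.
Hypothesis rel : quadratic_rel al be.

Let be_mor : pmor be. Proof. by case: be_inv. Qed.
Let be0 x : x != 0 -> be x != 0. Proof. by case: be_mor => + _ _; apply. Qed.
Let bes x y : x != 0 -> same_pt x y -> same_pt (be x) (be y).
Proof. by case: be_mor => _ + _; apply. Qed.

(** The inverse maps satisfy the same kind of relation, so [side_image] also applies to [be'], and
    this makes the map on sides injective. *)
Lemma side_perm : exists p : {perm 'I_3},
  forall i x, x != 0 -> (be x (p i) 0 == 0) = (x i 0 == 0).
Proof.
have /boolp.choice[f fP] := side_image al_inv be_inv rel.
have rel' := quadratic_rel_inv al_inv be_inv rel.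
have /boolp.choice[g gP] := side_image (pinv_sym al_inv) (pinv_sym be_inv) rel'.
have [_ _ be'be _] := be_inv.
have back i x : x != 0 -> be x (f i) 0 = 0 -> x (g (f i)) 0 = 0.
  by move=> x0 bx; have [a _ ->] := be'be x x0; rewrite mxE (gP _ _ (be0 x0) bx) mulr0.
have gf : cancel f g.
  move=> i; have x0 := line_neq0 i 1.
  have xi : (ei (i + 1) + 1 *: ei (i + 2)) i 0 = 0.
    by rewrite !mxE; move: (i); apply: ord3P; rewrite !ord3_add /= mulr0 addr0.
  have := back _ _ x0 (fP _ _ x0 xi); rewrite !mxE !andbT mul1r.
  by move: (g _) => j; move: i j {x0 xi}; apply: ord3P; apply: ord3P; rewrite !ord3_add //= => /eqP;
    rewrite ?addr0 ?add0r oner_eq0.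
exists (perm (can_inj gf)) => i x x0; rewrite permE; apply/eqP/eqP; last exact: fP.
by move/(back _ _ x0); rewrite gf.
Qed.

Definition scl i t x : 'cV[K]_3 := \col_j ((if j == i then t else 1) * x j 0).

Lemma poly_const (p : {poly K}) : (forall t, p.[t] != 0) -> exists2 a, a != 0 & p = a%:P.
Proof.
move=> p0; have /size_poly1P[a a0 ->] : size p == 1%N.
  by apply/negPn/negP => /closed_rootP[t]; apply/negP/p0.
by exists a.
Qed.

(* On the line through [x] and [e_i], the coordinates of [be] other than [p i] have no zero, so
   they are constant; the last one has a polynomial inverse, so it is linear. *)
Lemma scl_image (p : {perm 'I_3}) :
  (forall i x, x != 0 -> (be x (p i) 0 == 0) = (x i 0 == 0)) ->
  forall i x t, pi3 x != 0 -> t != 0 -> same_pt (be (scl i t x)) (scl (p i) t (be x)).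
Proof.
move=> pP i x t /pi3P px t0.
pose z : 'cV[K]_3 := \col_j (if j == i then 0 else x j 0).
have zE s j : (z + s *: ei i) j 0 = if j == i then s else x j 0.
  by rewrite !mxE andbT; case: eqP; rewrite ?mulr1 ?mulr0 ?add0r ?addr0.
have z0 s : z + s *: ei i != 0.
  have [j ji] : exists j, j != i.
    by exists (i + 1); move: (i); apply: ord3P; rewrite ?ord3_add.
  by apply: contraNneq (px j) => /colP/(_ j); rewrite zE (negPf ji) mxE => ->.
have [c cE] := line_rep be_mor z0.
have c_zero j s : (c (p j) 0).[s] == 0 = ((if j == i then s else x j 0) == 0).
  rewrite -zE -pP //; have [_ [a a0 /colP/(_ (p j))]] := cE s.
  by rewrite !mxE /horner_eval => ->; rewrite mulf_eq0 (negPf a0).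
have c_const j : j != i -> exists2 a, a != 0 & c (p j) 0 = a%:P.
  by move=> ji; apply: poly_const => s; rewrite c_zero (negPf ji) px.
pose w : 'cV[K]_3 := evmx 0 c.
have wi : w (p i) 0 = 0 by apply/eqP; rewrite !mxE /horner_eval c_zero eqxx.
have cw s : evmx s c = w + (c (p i) 0).[s] *: ei (p i).
  apply/colP => j; rewrite -[j](permKV p); move: (p^-1%g j) => l.
  rewrite [LHS]mxE [RHS]mxE; have [->|li] := eqVneq l i.
    by rewrite wi !mxE eqxx mulr1 add0r.
  have [a _ cl] := c_const l li.
  by rewrite !mxE (inj_eq perm_inj) (negPf li) mulr0 addr0 /horner_eval cl !hornerC.
have w0 s : w + s *: ei (p i) != 0.
  have [j ji] : exists j, j != i.
    by exists (i + 1); move: (i); apply: ord3P; rewrite ?ord3_add.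
  have [a a0 cj] := c_const j ji.
  apply: contraNneq a0 => /colP/(_ (p j)).
  by rewrite !mxE (inj_eq perm_inj) (negPf ji) mulr0 addr0 /horner_eval cj hornerC => ->.
have be_line s : same_pt (be (z + s *: ei i)) (w + (c (p i) 0).[s] *: ei (p i)).
  by rewrite -cw; have [] := cE s.
have [_ be'_mor be'be _] := be_inv.
have [d dE] := line_rep be'_mor w0.
have [j ji] : exists j, j != i.
  by exists (i + 1); move: (i); apply: ord3P; rewrite ?ord3_add.
have back s : same_pt (evmx (c (p i) 0).[s] d) (z + s *: ei i).
  have [_ fd] := dE (c (p i) 0).[s].
  have [_ be's _] := be'_mor.
  apply: same_pt_trans (same_pt_sym fd) (same_pt_trans (same_pt_sym _) (be'be _ (z0 s))).
  by apply: be's (be_line s); apply: be0.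
have ci_root s : (c (p i) 0).[s] == 0 = (s == 0) by rewrite c_zero eqxx.
have lin : (d i 0 \Po c (p i) 0) * (x j 0)%:P = 'X * (d j 0 \Po c (p i) 0).
  apply/eqP; rewrite -subr_eq0; apply/eqP/poly_fun0 => s.
  rewrite hornerD hornerN !hornerM !horner_comp hornerC hornerX; apply/eqP; rewrite subr_eq0.
  have /same_pt_par/(_ i j) := back s; rewrite !zE eqxx (negPf ji) !mxE /horner_eval => ->.
  by rewrite mulrC.
have [b b0 dj] : exists2 b, b != 0 & d j 0 = b%:P.
  apply: poly_const => s; have [_ _ _ bebe'] := be_inv.
  have [_ [a a0 /colP/(_ j)]] := dE s; rewrite !mxE /horner_eval => ->.
  have [be'0 _ _] := be'_mor; rewrite mulf_neq0 //; rewrite -pP; last exact/be'0/w0.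
  have [e e0 wE] := same_pt_sym (bebe' _ (w0 s)).
  have [a' a'0 cj] := c_const j ji; rewrite wE !mxE (inj_eq perm_inj) (negPf ji) mulr0 addr0.
  by rewrite /horner_eval cj hornerC mulf_neq0.
have size_c : size (c (p i) 0) = 2%N.
  have : size (d i 0 \Po c (p i) 0) = 2%N.
    have /(congr1 (size \o val)) := lin; rewrite /= dj comp_polyC mulrC !mul_polyC mulrC mul_polyC.
    by rewrite !size_scale // size_polyX.
  move=> sz; have := size_comp_poly (d i 0) (c (p i) 0); rewrite sz /= => /esym/eqP.
  by rewrite muln_eq1 => /andP[_]; case: (size (c (p i) 0)) => [|[|[|n]]].
have [ka ka0 ciE] : exists2 ka, ka != 0 & c (p i) 0 = ka *: 'X.
  have /factor_theorem[q] : root (c (p i) 0) 0 by rewrite rootE ci_root.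
  rewrite subr0 => ciE; have q0 : q != 0.
    by apply/eqP => q0; move: size_c; rewrite ciE q0 mul0r size_poly0.
  move: size_c; rewrite {1}ciE size_mulX // => -[] sq.
  have [a a0 qE] := size_poly1P q (introT eqP sq).
  by exists a; rewrite // ciE qE mul_polyC.
have [a a0 bxE] : same_pt (w + (ka * x i 0) *: ei (p i)) (be x).
  have xE : x = z + x i 0 *: ei i.
    by apply/colP => l; rewrite zE; case: eqP => // ->.
  rewrite {2}xE; apply/same_pt_sym; have := be_line (x i 0).
  by rewrite ciE hornerZ hornerX.
have sE : scl i t x = z + (t * x i 0) *: ei i.
  by apply/colP => l; rewrite zE mxE; case: eqP => [->|_]; rewrite ?mul1r.
rewrite sE; apply: same_pt_trans (be_line _) _; exists a => //.
apply/colP => l; rewrite bxE ciE !mxE !andbT /horner_eval hornerZ hornerX.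
case: eqP => [->|_] /=; last by rewrite !mulr0 !mul1r.
have -> : (c (p i) 0).[0] = 0 by apply/eqP; rewrite ci_root.
by ring.
Qed.

Lemma scl_same i t x y : same_pt x y -> same_pt (scl i t x) (scl i t y).
Proof. by case=> c c0 ->; exists c => //; apply/colP => j; rewrite !mxE mulrCA. Qed.

(** Each point off the triangle is obtained from [(1 : 1 : 1)] by scaling the three coordinates, so
    [scl_image] recovers [be] from a single value. *)
Lemma monomial_ex : exists p t, (forall i, t i != 0) /\
  forall x, x != 0 -> same_pt (be x) (mnm p t *m x).
Proof.
have [p pP] := side_perm; have sclP := scl_image pP.
pose o : 'cV[K]_3 := const_mx 1.
have po : pi3 o != 0 by apply/pi3P => i; rewrite mxE oner_neq0.
pose t i := be o (p i) 0.
have t0 i : t i != 0 by rewrite pP ?mxE ?oner_neq0 // pi3_neq0.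
have uM : mnm p t \in unitmx by apply: unitmx_mnm.
exists p, t; split=> // x x0.
apply: (mor_eq be_mor (mor_mul uM)) x0.
apply: genericW (@generic_pi3 K) => y /pi3P y0 _.
have scl0 i s z : s != 0 -> pi3 z != 0 -> pi3 (scl i s z) != 0.
  move=> s0 /pi3P z0; apply/pi3P => j; rewrite mxE mulf_neq0 //.
  by case: ifP => _; rewrite ?oner_neq0.
have yE : y = scl 2 (y 2 0) (scl 1 (y 1 0) (scl 0 (y 0 0) o)).
  by apply/colP => j; rewrite !mxE; move: j; apply: ord3P; rewrite /= ?(mul1r, mulr1).
have -> : mnm p t *m y = scl (p 2) (y 2 0) (scl (p 1) (y 1 0) (scl (p 0) (y 0 0) (be o))).
  apply/colP => j; rewrite -[j](permKV p); move: (p^-1%g j) => i.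
  rewrite mnm_mull mulrC !mxE !(inj_eq perm_inj) -/(t i).
  by move: i; apply: ord3P; rewrite /= ?mul1r.
rewrite {1}yE; have p1 := scl0 0 _ _ (y0 0) po; have p2 := scl0 1 _ _ (y0 1) p1.
apply: same_pt_trans (sclP _ _ _ p2 (y0 2)) (scl_same _ _ _).
apply: same_pt_trans (sclP _ _ _ p1 (y0 1)) (scl_same _ _ _).
exact: sclP.
Qed.

(** Once [be] is monomial, [sig be sig] is given by a monomial matrix [M], and the relation says
    that [M] is inverse to [al]. *)
Lemma linear_ex : exists A B : 'M[K]_3, [/\ A \in unitmx, B \in unitmx,
  forall x, x != 0 -> same_pt (al x) (A *m x) & forall x, x != 0 -> same_pt (be x) (B *m x)].
Proof.
have [p [t [t0 beE]]] := monomial_ex.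
pose u i := \prod_(l | l != i) t l.
have u0 i : u i != 0 by apply/prodf_neq0.
have uM := unitmx_mnm p u0; set M := mnm p u in uM.
exists (invmx M), (mnm p t); rewrite unitmx_inv uM unitmx_mnm //; split=> // x x0.
have [[al0 als all] al'_mor al'al alal'] := al_inv; have [_ al's _] := al'_mor.
have al'E y : y != 0 -> same_pt (al' y) (M *m y).
  apply: (mor_eq al'_mor (mor_mul uM)).
  have := genericI (generic_sig rel) (@generic_pi3 K).
  apply: genericW => z [[pz pbz]]; rewrite sigK => alz pz' z0.
  have pz1 : sig z != 0 by apply: sig_neq0.
  have bez : same_pt (sig (be (sig z))) (M *m z).
    apply: same_pt_trans (same_pt_sym (same_ptZ (M *m z) pz')).
    by rewrite scalemxAr -sigK -sig_mnm; apply/same_pt_sig/beE.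
  have Mz : M *m z != 0 by rewrite mulmx_eq0.
  have zE : same_pt z (al (M *m z)).
    apply: same_pt_trans (same_ptZ z pz') (same_pt_trans alz _).
    by apply: (als _ _ _ bez); rewrite /Defs.plane -(same_pt_neq0 bez).
  exact: same_pt_trans (al's _ _ z0 zE) (al'al _ Mz).
have Mx0 : invmx M *m x != 0 by rewrite mulmx_eq0 ?unitmx_inv.
have := al'E _ Mx0; rewrite mulKVmx // => xE.
apply: same_pt_trans (alal' _ Mx0); apply: als => //.
exact: same_pt_sym.
Qed.

End Monomial.
End Rigidity.

(** * Galois action on links *)

Section Galois.

Variables (k : fieldType) (K : closedFieldType) (iota : {rmorphism k -> K}).
Implicit Types (S T : sb_surface iota) (h : {rmorphism K -> K}).

(** Being injective, [h] permutes the finite set of roots of a polynomial over [k]. *)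
Lemma fixes_base_surj h : is_alg_closure iota -> fixes_base iota h ->
  forall y, exists x, h x = y.
Proof.
move=> K_alg hk y; have [p mp py] := K_alg y.
have [rs pE] := closed_field_poly_normal (map_poly iota p).
have lead1 : lead_coef (map_poly iota p) = 1 by rewrite lead_coef_map (monicP mp) rmorph1.
rewrite lead1 scale1r in pE.
have sub : {subset map h (undup rs) <= undup rs}.
  move=> _ /mapP[x + ->]; rewrite !mem_undup -!root_prod_XsubC -!pE => xr.
  have <- : map_poly h (map_poly iota p) = map_poly iota p.
    by rewrite -map_poly_comp; apply: eq_map_poly => c /=.
  by rewrite fmorph_root.
have [||_ /(_ y)] := uniq_min_size _ sub.
- by rewrite map_inj_uniq ?undup_uniq //; apply: fmorph_inj.
- by rewrite size_map.
have -> : y \in undup rs by rewrite mem_undup -root_prod_XsubC -pE.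
by move=> /mapP[x _ ->]; exists x.
Qed.

Lemma gal_ex S (s : splitting S) h : fixes_base iota h ->
  exists2 g, g \in 'Gal({:sp_field s} / 1)%g & forall z, h (sp_emb s z) = sp_emb s (g z).
Proof.
move=> hk; set L := sp_field s; set e := sp_emb s.
have eA (c : k) : e c%:A = iota c by apply: sp_embE.
have he (p : {poly L}) : p \is a polyOver 1%VS -> map_poly h (map_poly e p) = map_poly e p.
  move=> /polyOverP p1; apply/polyP => i; rewrite !coef_map /=.
  by have /vlineP[c ->] := p1 i; rewrite eA hk.
have /boolp.choice[f fE] : forall z : L, exists w, e w = h (e z).
  move=> z; have [rs /eqP mE] := splitting_field_normal 1%AS z.
  have : root (map_poly e (minPoly 1%AS z)) (h (e z)).
    rewrite -he ?minPolyOver // fmorph_root fmorph_root; exact: root_minPoly.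
  rewrite mE rmorph_prod /= (eq_bigr (fun a => 'X - (e a)%:P)); last first.
    by move=> a _; rewrite rmorphB /= map_polyX map_polyC.
  rewrite -(big_map e xpredT (fun a => 'X - a%:P)) root_prod_XsubC.
  by move=> /mapP[w _ ->]; exists w.
have e_inj := fmorph_inj e.
have f_sub : {morph f : x y / x - y}.
  by move=> x y; apply: e_inj; rewrite rmorphB !fE !rmorphB.
have f_mul : {morph f : x y / x * y}.
  by move=> x y; apply: e_inj; rewrite rmorphM !fE !rmorphM.
have f1 : f 1 = 1 by apply: e_inj; rewrite fE !rmorph1.
have fA c : f c%:A = c%:A by apply: e_inj; rewrite fE eA hk.
have f_lin : linear f.
  move=> c x y; apply: e_inj; rewrite -[c *: x]mulr_algl -[c *: f x]mulr_algl.
  by rewrite fE !rmorphD !rmorphM -!fE fA.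
pose F : {linear L -> L} := HB.pack f (GRing.isLinear.Build k L L *:%R f f_lin).
have FE z : linfun F z = f z by rewrite lfunE.
have homF : kHom 1 {:L} (linfun F).
  by apply/kHomP; split=> [x y _ _|x /vlineP[c ->]]; rewrite !FE.
have [|g gal gE] := kHom_to_gal _ (normalFieldf 1%AS) homF.
  by rewrite sub1v subvf.
by exists g => // z; rewrite -fE -FE gE ?memvf.
Qed.

End Galois.

(** * Coordinates on a Severi-Brauer surface *)

Section Surfaces.

Variables (k : fieldType) (K : closedFieldType) (iota : {rmorphism k -> K}).
Implicit Types (S T : sb_surface iota) (h : {rmorphism K -> K}).

Notation plane := (@plane K).
Notation pmor f := (mor plane plane f).

Section Splitting.

Variables (S : sb_surface iota) (s : splitting S).
Notation phi := (sp_phi s).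
Notation psi := (sp_psi s).

Lemma sb_cone : cone S.
Proof. exact: cone_closed (@sb_closed _ _ _ S). Qed.

Lemma phi_mor : mor S plane phi.
Proof. by have [+ _ _ _] := sp_iso s; apply: morphism_mor sb_cone. Qed.

Lemma psi_mor : mor plane S psi.
Proof. by have [_ + _ _] := sp_iso s; apply: morphism_mor; apply: cone_plane. Qed.

Lemma phiK x : S x -> same_pt (psi (phi x)) x.
Proof. by have [_ _ + _] := sp_iso s; apply. Qed.

Lemma psiK y : y != 0 -> same_pt (phi (psi y)) y.
Proof. by have [_ _ _ +] := sp_iso s; apply. Qed.

Lemma phi0 x : S x -> phi x != 0.
Proof. by have [+ _ _] := phi_mor; apply. Qed.

Lemma phi_same x y : S x -> same_pt x y -> same_pt (phi x) (phi y).
Proof. by have [_ + _] := phi_mor; apply. Qed.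

Lemma phi_inj x y : S x -> S y -> same_pt (phi x) (phi y) -> same_pt x y.
Proof.
move=> Sx Sy xy; apply: same_pt_trans (same_pt_sym (phiK Sx)) _.
apply: same_pt_trans (phiK Sy); have [_ + _] := psi_mor; apply=> //; exact: phi0.
Qed.

Lemma psiS y : y != 0 -> S (psi y).
Proof. by have [+ _ _] := psi_mor; apply. Qed.

Lemma phi_psi x y : S x -> same_pt (phi x) y -> same_pt x (psi y).
Proof.
move=> Sx xy; have y0 : y != 0 by rewrite (same_pt_neq0 xy) phi0.
apply: phi_inj => //; first exact: psiS.
exact: same_pt_trans xy (same_pt_sym (psiK y0)).
Qed.

Lemma S_map h x : fixes_base iota h -> S x -> S (map_mx h x).
Proof. by move=> hk; apply: (closed_map hk); apply: sb_closed. Qed.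

Definition galois_mx h (A : 'M[K]_3) :=
  [/\ A \in unitmx,
      forall x, S x -> same_pt (phi (map_mx h x)) (A *m map_mx h (phi x)) &
      forall M, twist_fixed M ->
        map_mx h (map_mx (sp_emb s) M) = invmx A *m map_mx (sp_emb s) M *m A].

Lemma galois_mx_ex h : fixes_base iota h -> exists A, galois_mx h A.
Proof.
move=> hk; have [g gal gE] := gal_ex s hk; exists (map_mx (sp_emb s) (sp_mx g)); split.
- by rewrite map_unitmx sp_mx_unit.
- move=> x Sx; apply: same_pt_trans (sp_mxE gal hk gE (phi0 Sx)).
  apply: phi_same; first exact: S_map.
  exact/same_pt_map/same_pt_sym/phiK.
move=> M /(_ g gal) Mg; rewrite -map_invmx -!map_mxM -Mg -!map_mx_comp.
by apply/matrixP => i j; rewrite !mxE /= gE.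
Qed.

Definition lin_rep (f : 'cV[K]_(sb_ambient S).+1 -> 'cV[K]_(sb_ambient S).+1) (a : 'M[K]_3) :=
  a \in unitmx /\ forall x, S x -> same_pt (phi (f x)) (a *m phi x).

Lemma map_mx_surj h m n : (forall y, exists x, h x = y) ->
  forall M : 'M[K]_(m, n), exists M', map_mx h M' = M.
Proof.
move=> hs M; have /boolp.choice[u uE] := fun ij => hs (M ij.1 ij.2).
by exists (\matrix_(i, j) u (i, j)); apply/matrixP => i j; rewrite !mxE uE.
Qed.

Lemma proportional_mx (U V : 'M[K]_3) : U \in unitmx -> V \in unitmx ->
  (forall v, v != 0 -> same_pt (U *m v) (V *m v)) -> exists2 c, c != 0 & U = c *: V.
Proof.
move=> uU uV UV; have [x|c cE] := @scalar_par K (invmx V *m U).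
  have [->|x0] := eqVneq x 0; first by rewrite mulmx0; apply: par_refl.
  by have /same_pt_par/(par_mul (invmx V)) := UV x x0; rewrite mulKmx // mulmxA.
have UE : U = c *: V by rewrite -[U](mulKVmx uV) cE -scalemx1 -scalemxAr mulmx1.
exists c => //; apply: contraTneq uU => c0.
by rewrite UE c0 scale0r unitmxE det0 unitr0.
Qed.

Hypothesis K_alg : is_alg_closure iota.

(** [f] is defined over [k], hence commutes with [h] on points; surjectivity of [h] gives the
    identity of projective maps at every point. The scalar [c] stays because [a] is an arbitrary
    representative. *)
Lemma lin_rep_galois h A f a : fixes_base iota h -> galois_mx h A -> is_aut S f -> lin_rep f a ->
  exists2 c, c != 0 & map_mx h a = c *: (invmx A *m a *m A).
Proof.
move=> hk [uA AE _] [g [fmor _ _ _]] [ua aE].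
have fS x : S x -> S (f x) by case/fmor.
apply: proportional_mx; rewrite ?unitmx_mul ?unitmx_inv ?map_unitmx ?uA ?ua // => v v0.
have [u uE] := map_mx_surj (fixes_base_surj K_alg hk) v.
have u0 : u != 0 by move: v0; rewrite -uE map_mx_eq0.
have Su := psiS u0; set x := psi u in Su; have Shu := S_map hk Su.
have xu : same_pt (phi x) u := psiK u0.
rewrite -uE -!mulmxA; suff : same_pt (A *m (map_mx h a *m map_mx h u)) (a *m (A *m map_mx h u)).
  by move=> /(same_pt_mul (invmx A)); rewrite mulKmx.
have E1 : same_pt (phi (map_mx h (f x))) (A *m (map_mx h a *m map_mx h u)).
  apply: same_pt_trans (AE _ (fS _ Su)) _; rewrite -map_mxM; apply/same_pt_mul/same_pt_map.
  exact: same_pt_trans (aE _ Su) (same_pt_mul _ xu).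
apply: same_pt_trans (same_pt_sym E1) _.
apply: same_pt_trans (phi_same _ (morphism_map hk (@sb_closed _ _ _ S) fmor Su)) _.
  exact/S_map/fS.
apply: same_pt_trans (aE _ Shu) _; apply: same_pt_mul.
exact: same_pt_trans (AE _ Su) (same_pt_mul _ (same_pt_map h xu)).
Qed.

End Splitting.

End Surfaces.

(** * Links in coordinates *)

Section Links.

Variables (k : fieldType) (K : closedFieldType) (iota : {rmorphism k -> K}).
Variables (S T : sb_surface iota) (s : splitting S) (t : splitting T).
Implicit Types (f : birat S T) (P Q : 'M[K]_3).

Notation plane := (@plane K).
Notation pmor f := (mor plane plane f).
Notation "f ^~>" := (teval iota (bi_fwd f)) (at level 2, format "f ^~>").
Notation ei := (ei K).

Definition quad_at f P Q := [/\ P \in unitmx, Q \in unitmx &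
  forall x a, S x -> f^~> x != 0 -> pi3 a != 0 -> same_pt (sp_phi s x) (P *m a) ->
    same_pt (sp_phi t (f^~> x)) (Q *m sig a)].

Lemma fwd_in f x : S x -> f^~> x != 0 -> T (f^~> x).
Proof. exact: bi_fwd_in. Qed.

Lemma fwd_same f x y : same_pt x y -> same_pt (f^~> x) (f^~> y).
Proof. exact: teval_same (bi_fwd_homog f). Qed.

Lemma incident_sig (a : 'cV[K]_3) : pi3 a != 0 -> incident a (sig a).
Proof.
move=> pa; split; [exact: pi3_neq0|exact: sig_neq0|].
have e i : a i 0 * sig a i 0 = pi3 a.
  by rewrite mxE /pi3; move: i; apply: ord3P; rewrite !ord3_add; ring.
by move=> i j; rewrite !e.
Qed.

(** Over a point [a] off the triangle, [dP6] has the point [(a, sig a)] by [incident_sig]; so the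
    passage from the first projection to the second is [sig]. *)
Lemma link_quad_at f p : link_at s t f p ->
  exists P Q, quad_at f P Q /\ forall i, same_pt (sp_phi s (p i)) (col i P).
Proof.
case=> _ [N [X [pi [pi' [_ piS pi'T gr [th [th' [[_ thX _ thK] [P [Q [uP uQ pP thP]]]]]]]]]]].
exists P, Q; split=> //; split=> // x a Sx fx pa xa.
have inc := incident_sig pa.
have dP : dP6 (segre a (sig a)) by exists a, (sig a); split=> //; exact: same_pt_refl.
have [Xz _] := thX _ dP; set z := th' _ in Xz.
have [za zb] := thP z a (sig a) Xz inc (thK _ dP).
have [Sz _] := piS z Xz.
have xz : same_pt x (pi z).
  by apply: (phi_inj (s := s)) => //; apply: same_pt_trans xa (same_pt_sym za).
have fxz := fwd_same f xz.
have gz : graph f (pi z) (f^~> x).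
  by split=> //; [rewrite (same_pt_neq0 fxz)|apply: same_pt_sym].
apply: same_pt_trans zb; apply: phi_same; first exact: fwd_in.
exact/same_pt_sym/gr.
Qed.

Definition in_dom f (y : 'cV[K]_3) := y != 0 /\ f^~> (sp_psi s y) != 0.

Lemma in_dom_same f x y : in_dom f x -> same_pt x y -> in_dom f y.
Proof.
move=> [x0 fx] xy; split; first by rewrite (same_pt_neq0 xy).
have [_ /(_ x y x0 xy) psi_xy _] := psi_mor s.
by rewrite (same_pt_neq0 (fwd_same f psi_xy)).
Qed.

Lemma generic_dom f : generic (in_dom f).
Proof.
have [[x0 Sx [_ fx]] _] := bi_fwdK f; have y0 := phi0 s Sx.
have [_ _ /(_ _ y0)[F [q [hF hq qy FE]]]] := psi_mor s.
have [_ psiF] := FE _ y0 qy.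
have fF : f^~> (F (sp_phi s x0)) != 0.
  have := same_pt_trans (same_pt_sym psiF) (phiK s Sx).
  by move=> /(fwd_same f)/same_pt_neq0 <-.
have [i fi] := neq0_coord fF.
have gq : generic (fun y => q y != 0) by apply: generic_pfun => //; exists (sp_phi s x0).
have gf : generic (fun y => f^~> (F y) i 0 != 0).
  apply: generic_pfun; last by exists (sp_phi s x0).
  exact: (pfun_comp hF (pmap_teval iota (bi_fwd f) i)).
apply: genericW (genericI gq (genericI (@generic_neq0 K) gf)) => y [qy' [y0' /= fy]]; split=> //.
have [_ psiFy] := FE _ y0' qy'; rewrite -(same_pt_neq0 (fwd_same f psiFy)).
by apply: contraNneq fy => ->; rewrite mxE.
Qed.

End Links.

Section Inverses.

Variable K : closedFieldType.
Notation plane := (@plane K).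

Lemma pinv_comp f f' g g' : @pinv K f f' -> pinv g g' -> pinv (g \o f) (f' \o g').
Proof.
move=> [mf mf' f'f ff'] [mg mg' g'g gg'].
have [f0 fs _] := mf; have [f'0 f's _] := mf'; have [g0 gs _] := mg; have [g'0 g's _] := mg'.
split; [exact: mor_comp (@cone_plane K) mf mg|exact: mor_comp (@cone_plane K) mg' mf'| |].
  move=> x x0; apply: same_pt_trans (f'f _ x0); apply/same_pt_sym/f's; first exact: f0.
  exact/same_pt_sym/g'g/f0.
move=> x x0; apply: same_pt_trans (gg' _ x0); apply/same_pt_sym/gs; first exact: g'0.
exact/same_pt_sym/ff'/g'0.
Qed.

Lemma pinv_mul (M : 'M[K]_3) : M \in unitmx -> pinv (fun x => M *m x) (fun x => invmx M *m x).
Proof.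
move=> uM; split; try by apply: mor_mul; rewrite ?unitmx_inv.
  by move=> x _; rewrite mulKmx //; apply: same_pt_refl.
by move=> x _; rewrite mulKVmx //; apply: same_pt_refl.
Qed.

End Inverses.

Section Automorphisms.

Variables (k : fieldType) (K : closedFieldType) (iota : {rmorphism k -> K}).
Variables (S : sb_surface iota) (s : splitting S).
Notation plane := (@plane K).
Notation surface_map := ('cV[K]_(sb_ambient S).+1 -> 'cV[K]_(sb_ambient S).+1).

Lemma aut_mor (f : surface_map) : is_aut S f -> mor S S f.
Proof. by case=> g [+ _ _ _]; apply: morphism_mor; apply: sb_cone. Qed.

Lemma aut_pinv (f : surface_map) : is_aut S f ->
  exists g, pinv (sp_phi s \o f \o sp_psi s) g.
Proof.
case=> g [fmor gmor gf fg]; have cS := sb_cone (S := S).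
have mf := morphism_mor cS fmor; have mg := morphism_mor cS gmor.
exists (sp_phi s \o g \o sp_psi s).
have conj_inv (f1 f2 : surface_map) : mor S S f1 -> mor S S f2 ->
    (forall x, S x -> same_pt (f2 (f1 x)) x) -> forall x, x != 0 ->
    same_pt ((sp_phi s \o f2 \o sp_psi s) ((sp_phi s \o f1 \o sp_psi s) x)) x.
  move=> [f1S f1s _] [f2S f2s _] f21 x x0 /=; have Sx := psiS s x0.
  apply: same_pt_trans (psiK s x0); apply: phi_same.
    by apply/f2S/psiS/phi0/f1S.
  apply: same_pt_trans (f21 _ Sx); apply: f2s; last exact/phiK/f1S.
  exact/psiS/phi0/f1S.
split; try exact: conj_inv.
  exact: mor_comp cS (psi_mor s) (mor_comp cS mf (phi_mor s)).
exact: mor_comp cS (psi_mor s) (mor_comp cS mg (phi_mor s)).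
Qed.

Lemma lin_repP (f : surface_map) a : is_aut S f -> a \in unitmx ->
  (forall x, x != 0 -> same_pt (sp_phi s (f (sp_psi s x))) (a *m x)) -> lin_rep s f a.
Proof.
move=> /aut_mor[fS fs _] ua aE; split=> // x Sx; have x0 := phi0 s Sx.
apply: same_pt_trans (aE _ x0); apply: phi_same; first exact: fS.
by apply: fs => //; apply: same_pt_sym; apply: phiK.
Qed.

Lemma lin_rep_comp (f g : surface_map) a M : is_aut S g -> lin_rep s f a -> M \in unitmx ->
  (forall x, x != 0 -> same_pt (sp_phi s (f (g (sp_psi s x)))) (M *m x)) ->
  lin_rep s g (invmx a *m M).
Proof.
move=> aut_g [ua aE] uM ME; have [gS _ _] := aut_mor aut_g.
apply: lin_repP => //; first by rewrite unitmx_mul unitmx_inv ua.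
move=> x x0; have := aE _ (gS _ (psiS s x0)).
move=> /same_pt_sym/same_pt_trans/(_ (ME x x0))/(same_pt_mul (invmx a)).
by rewrite mulKmx // mulmxA.
Qed.

End Automorphisms.

(** * Linearity of the automorphisms between two links *)

Section LinkFactors.

Variables (k : fieldType) (K : closedFieldType) (iota : {rmorphism k -> K}).
Variables (S T : sb_surface iota) (s : splitting S) (t : splitting T).
Variables (f f1 : birat S T).
Variables (al : 'cV[K]_(sb_ambient T).+1 -> 'cV[K]_(sb_ambient T).+1)
          (be : 'cV[K]_(sb_ambient S).+1 -> 'cV[K]_(sb_ambient S).+1).
Hypothesis al_aut : is_aut T al.
Hypothesis be_aut : is_aut S be.
Hypothesis f1E : factors_as f1 f al be.
Notation "f ^~>" := (teval iota (bi_fwd f)) (at level 2, format "f ^~>").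

(** In the coordinates of the two links both become [sig], so the conjugates of [al] and [be]
    satisfy [quadratic_rel] and the rigidity lemma [linear_ex] applies. *)
Lemma factors_linear P Q P1 Q1 : quad_at s t f P Q -> quad_at s t f1 P1 Q1 ->
  exists a b, lin_rep t al a /\ lin_rep s be b.
Proof.
move=> [uP uQ fE] [uP1 uQ1 f1Q].
have [al' al_inv] := aut_pinv t al_aut; have [be' be_inv] := aut_pinv s be_aut.
have [alT als _] := aut_mor al_aut; have [beS bes _] := aut_mor be_aut.
have uQ1' : invmx Q1 \in unitmx by rewrite unitmx_inv.
have uP' : invmx P \in unitmx by rewrite unitmx_inv.
have al2_inv := pinv_comp (pinv_mul uQ) (pinv_comp al_inv (pinv_mul uQ1')).
have be1_inv := pinv_comp (pinv_mul uP1) be_inv.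
have be2_inv := pinv_comp be1_inv (pinv_mul uP').
have rel : quadratic_rel ((fun x => invmx Q1 *m x) \o (sp_phi t \o al \o sp_psi t) \o (fun x => Q *m x))
    ((fun x => invmx P *m x) \o ((sp_phi s \o be \o sp_psi s) \o (fun x => P1 *m x))).
  have [mbe1 mbe1' _ be1K] := be1_inv.
  have gd : generic (fun y => in_dom s f y /\ pi3 (invmx P *m y) != 0).
    by apply: genericI (generic_dom s f) (generic_mul uP' generic_pi3).
  have inv_d x y : in_dom s f x /\ pi3 (invmx P *m x) != 0 -> same_pt x y ->
      in_dom s f y /\ pi3 (invmx P *m y) != 0.
    move=> [dx px] xy; split; first exact: in_dom_same xy.
    by rewrite (same_pt_pi3 (same_pt_mul _ xy)).
  have := genericI (generic_mul uP1 (generic_dom s f1))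
    (genericI generic_pi3 (generic_mor mbe1 mbe1' be1K inv_d gd)).
  apply: genericW => x [[Px0 f1x] [px /(_ (pi3_neq0 px)) [[bx0 fbx] pbx]]].
  rewrite /= in bx0 fbx pbx *; set y := sp_psi s _ in f1x bx0 fbx pbx *.
  have Sy : S y by apply: psiS.
  split=> //; set z := invmx P *m _ in pbx *.
  have Sby := beS _ Sy.
  have byE := phiK s Sby.
  have fby : f^~> (be y) != 0 by rewrite (same_pt_neq0 (fwd_same f byE)).
  have E1 : same_pt (sp_phi t (f1^~> y)) (Q1 *m sig x) := f1Q _ _ Sy f1x px (psiK s Px0).
  have E2 : same_pt (sp_phi t (f^~> (be y))) (Q *m sig z).
    by apply: fE => //; rewrite /z mulKVmx //; apply: same_pt_refl.
  have gr1 : graph f1 y (f1^~> y) by split=> //; exact: same_pt_refl.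
  have gr2 : graph f (be y) (f^~> (be y)) by split=> //; exact: same_pt_refl.
  have E3 := f1E gr1 gr2; have Tf := fwd_in Sby fby.
  rewrite -[sig x](mulKmx uQ1); apply: same_pt_mul.
  apply: same_pt_trans (same_pt_sym E1) _.
  apply: same_pt_trans (phi_same t (fwd_in Sy f1x) E3) _.
  apply: phi_same; first exact: alT.
  by apply: als => //; apply: phi_psi.
have [A [B [uA uB AE BE]]] := linear_ex al2_inv be2_inv rel.
exists (Q1 *m A *m invmx Q), (P *m B *m invmx P1); split; apply: lin_repP => //.
- by rewrite !unitmx_mul unitmx_inv uQ1 uA.
- move=> x x0; have x0' : invmx Q *m x != 0 by rewrite mulmx_eq0 ?unitmx_inv.
  by have := same_pt_mul Q1 (AE _ x0'); rewrite /= !mulKVmx // !mulmxA.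
- by rewrite !unitmx_mul unitmx_inv uP uB.
move=> x x0; have x0' : invmx P1 *m x != 0 by rewrite mulmx_eq0 ?unitmx_inv.
by have := same_pt_mul P (BE _ x0'); rewrite /= !mulKVmx // !mulmxA.
Qed.

Definition step (a b P Q : 'M[K]_3) y : 'cV[K]_3 := a *m (Q *m sig (invmx P *m (b *m y))).

Lemma factors_step P Q a b : quad_at s t f P Q -> lin_rep t al a -> lin_rep s be b ->
  exists2 good, generic good & forall x y, S x -> same_pt (sp_phi s x) y -> good y ->
    f1^~> x != 0 /\ same_pt (sp_phi t (f1^~> x)) (step a b P Q y).
Proof.
move=> [uP uQ fE] [ua aE] [ub bE].
have uP' : invmx P \in unitmx by rewrite unitmx_inv.
have [alT als _] := aut_mor al_aut; have [beS bes _] := aut_mor be_aut.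
exists (fun y => in_dom s f1 y /\ in_dom s f (b *m y) /\ pi3 (invmx P *m (b *m y)) != 0).
  apply: genericI (generic_dom s f1) _.
  apply: (generic_mul ub (P := fun y => in_dom s f y /\ pi3 (invmx P *m y) != 0)).
  exact: genericI (generic_dom s f) (generic_mul uP' generic_pi3).
move=> x y Sx xy [[y0 f1y] [[by0 fby] pz]].
have xE := phi_psi Sx xy.
have f1x : f1^~> x != 0 by rewrite -(same_pt_neq0 (fwd_same f1 xE)).
split=> //; have Sbx := beS _ Sx.
have bx : same_pt (sp_phi s (be x)) (b *m y) := same_pt_trans (bE _ Sx) (same_pt_mul _ xy).
have fbx : f^~> (be x) != 0 by rewrite -(same_pt_neq0 (fwd_same f (phi_psi Sbx bx))).
have E2 : same_pt (sp_phi t (f^~> (be x))) (Q *m sig (invmx P *m (b *m y))).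
  by apply: fE => //; rewrite mulKVmx.
have gr1 : graph f1 x (f1^~> x) by split=> //; exact: same_pt_refl.
have gr2 : graph f (be x) (f^~> (be x)) by split=> //; exact: same_pt_refl.
have Tf := fwd_in Sbx fbx.
apply: same_pt_trans (phi_same t (fwd_in Sx f1x) (f1E gr1 gr2)) _.
exact: same_pt_trans (aE _ Tf) (same_pt_mul _ E2).
Qed.

End LinkFactors.

Lemma generic_step (K : closedFieldType) (a b P Q : 'M[K]_3) (R : 'cV[K]_3 -> Prop) :
  [/\ a \in unitmx, b \in unitmx, P \in unitmx & Q \in unitmx] ->
  generic R -> generic (fun y => R (step a b P Q y)).
Proof.
move=> [ua ub uP uQ] gR; have uP' : invmx P \in unitmx by rewrite unitmx_inv.
exact: (generic_mul ub (generic_mul uP' (generic_sig (generic_mul uQ (generic_mul ua gR))))).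
Qed.

(** * Galois action on the coordinates of a link *)

Section LinkGalois.

Variables (k : fieldType) (K : closedFieldType) (iota : {rmorphism k -> K}).
Hypothesis K_alg : is_alg_closure iota.
Variables (S T : sb_surface iota) (s : splitting S) (t : splitting T).
Variables (f : birat S T) (P Q : 'M[K]_3) (p : 'I_3 -> 'cV[K]_(sb_ambient S).+1).
Hypothesis fPQ : quad_at s t f P Q.
Hypothesis p3 : three_point p.
Hypothesis pP : forall i, same_pt (sp_phi s (p i)) (col i P).
Variables (h : {rmorphism K -> K}) (A A' : 'M[K]_3).
Hypothesis hk : fixes_base iota h.
Hypothesis hA : galois_mx s h A.
Hypothesis hA' : galois_mx t h A'.
Notation "f ^~>" := (teval iota (bi_fwd f)) (at level 2, format "f ^~>").
Notation ei := (ei K).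

(** [h] permutes the components of the base point, which are the columns of [P] up to scalars; so
    [invmx P *m A *m map_mx h P] sends coordinate points to coordinate points. *)
Lemma base_galois : exists (si : {perm 'I_3}) (w : 'I_3 -> K),
  [/\ forall i, w i != 0, map_mx h P = invmx A *m P *m mnm si w &
      forall i, same_pt (map_mx h (p i)) (p (si i))].
Proof.
have [uP uQ _] := fPQ; have [Sp _ hp _] := p3; have [uA AE _] := hA.
have /boolp.choice[g gE] : forall i, exists j, same_pt (map_mx h (p i)) (p j) by move=> i; apply: hp.
pose M := invmx P *m A *m map_mx h P.
have uM : M \in unitmx by rewrite !unitmx_mul unitmx_inv uP uA map_unitmx.
have ME i : same_pt (ei (g i)) (M *m ei i).
  rewrite -!mulmxA -{1}(mulKmx uP (ei (g i))); apply: same_pt_mul; rewrite -!colE -map_col.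
  apply: same_pt_trans (same_pt_sym (pP _)) _.
  apply: same_pt_trans (phi_same _ (Sp _) (same_pt_sym (gE i))) _.
  exact: same_pt_trans (AE _ (Sp i)) (same_pt_mul _ (same_pt_map h (pP i))).
have [|si [w [w0 MS]]] := mnmP uM.
  by move=> i; have [c _ ->] := ME i; rewrite sigZ sig_ei scaler0.
exists si, w; split=> //; first by rewrite -MS /M -!mulmxA (mulKVmx uP) mulKmx.
move=> i; suff -> : si i = g i by [].
apply: (@ei_par K); have := same_pt_par (ME i); rewrite MS mnm_ei => /parC/(parZl (w i)^-1).
by rewrite scalerA mulVf // scale1r.
Qed.

Lemma pi3_mnm (si : {perm 'I_3}) (w : 'I_3 -> K) x : (forall i, w i != 0) -> pi3 x != 0 ->
  pi3 (mnm si w *m x) != 0.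
Proof.
move=> w0 /pi3P px; apply/pi3P => j; rewrite -[j](permKV si); move: (si^-1%g j) => i.
by rewrite mnm_mull mulf_neq0.
Qed.

Lemma link_galois : exists (si : {perm 'I_3}) (w : 'I_3 -> K) (la : K),
  [/\ forall i, w i != 0, la != 0, map_mx h P = invmx A *m P *m mnm si w,
      map_mx h Q = la *: (invmx A' *m Q *m mnm si (fun i => (w i)^-1)) &
      forall i, same_pt (map_mx h (p i)) (p (si i))].
Proof.
have [si [w [w0 PE hp]]] := base_galois; have [uP uQ fE] := fPQ.
have [uA AE _] := hA; have [uA' AE' _] := hA'.
pose w' i := \prod_(l | l != i) w l.
have w'0 i : w' i != 0 by apply/prodf_neq0.
(* [U] and [V] are preimages under [h]: the comparison is obtained at [map_mx h a], and pulling it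
   back turns it into a generic statement about [a]. *)
have [U UE] := map_mx_surj (fixes_base_surj K_alg hk) (A' *m map_mx h Q).
have [V VE] := map_mx_surj (fixes_base_surj K_alg hk) (Q *m mnm si w').
have uU : U \in unitmx by rewrite -(map_unitmx h) UE unitmx_mul uA' map_unitmx.
have uV : V \in unitmx by rewrite -(map_unitmx h) VE unitmx_mul uQ unitmx_mnm.
have gUV : generic (fun a => same_pt (U *m sig a) (V *m sig a)).
  apply: genericW (genericI generic_pi3 (generic_mul uP (generic_dom s f))) => a [pa [Pa0 fx]].
  set x := sp_psi s _ in fx; have Sx : S x by apply: psiS.
  have Shx := S_map hk Sx; have xPa : same_pt (sp_phi s x) (P *m a) by apply: psiK.
  have hfx : map_mx h (f^~> x) = f^~> (map_mx h x) by apply: map_teval.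
  have pha : pi3 (map_mx h a) != 0.
    by apply/pi3P => i; rewrite mxE fmorph_eq0; apply/pi3P: i.
  have xh : same_pt (sp_phi s (map_mx h x)) (P *m (mnm si w *m map_mx h a)).
    apply: same_pt_trans (AE _ Sx) _.
    have := same_pt_mul A (same_pt_map h xPa); rewrite map_mxM PE !mulmxA mulmxV // mul1mx.
    by rewrite -mulmxA.
  have fhx : f^~> (map_mx h x) != 0 by rewrite -hfx map_mx_eq0.
  have E1 := fE _ _ Shx fhx (pi3_mnm si w0 pha) xh; rewrite sig_mnm -/w' in E1.
  have E2 := fE _ _ Sx fx pa xPa.
  have E3 := same_pt_trans (AE' _ (fwd_in Sx fx)) (same_pt_mul _ (same_pt_map h E2)).
  rewrite hfx map_mxM map_sig in E3.
  have E4 := same_pt_trans (same_pt_sym E3) E1.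
  have sa : sig a != 0 by apply: sig_neq0.
  apply: (@same_pt_map_inv _ h); rewrite ?mulmx_eq0 // !map_mxM map_sig UE VE -!mulmxA.
  exact: E4.
have UV v : v != 0 -> same_pt (U *m v) (V *m v).
  apply: (mor_eq (mor_mul uU) (mor_mul uV)).
  apply: genericW (genericI (generic_sig gUV) generic_pi3) => z [+ pz] _.
  rewrite sigK -!scalemxAr => zE.
  exact: same_pt_trans (same_ptZ _ pz) (same_pt_trans zE (same_pt_sym (same_ptZ _ pz))).
have [c c0 UcV] := proportional_mx uU uV UV.
have QE : map_mx h Q = h c *: (invmx A' *m Q *m mnm si w').
  by apply: (can_inj (mulKmx uA')); rewrite -UE UcV map_mxZ VE -scalemxAr -mulmxA mulKVmx.
pose pw := \prod_l w l.
have pw0 : pw != 0 by apply/prodf_neq0.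
have mE : mnm si w' = pw *: mnm si (fun i => (w i)^-1) by rewrite -hinv_mnm -mnm_codet.
exists si, w, (h c * pw); split=> //; first by rewrite mulf_neq0 ?fmorph_eq0.
by rewrite QE mE -scalemxAr scalerA.
Qed.

End LinkGalois.

(** * The invariant cube root *)

Section InvariantCube.

Variables (K : closedFieldType) (G : Type) (h : G -> {rmorphism K -> K}).
Variables (v1 v2 : vtx K G) (P Q P' Q' : 'M[K]_3) (a d N : 'I_3 -> 'M[K]_3).
Variables (A A' : G -> 'M[K]_3) (la mu : G -> K) (ca : G -> 'I_3 -> K).

(** The matrices [B g] cancel between the three factors; only the monomial matrices and the scalars
    survive. *)
Lemma eqv_conj (v w : vtx K G) (r r' : G -> K) (B : G -> 'M[K]_3) (L M R : 'M[K]_3) :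
  L \in unitmx -> (forall g, B g \in unitmx) ->
  (forall g, map_mx (h g) L = invmx (B g) *m L *m mnm (vs v g) (fun i => (va v g i)^-1)) ->
  (forall g, map_mx (h g) M = r g *: (invmx (B g) *m M *m B g)) ->
  (forall g, map_mx (h g) R = r' g *: (invmx (B g) *m R *m mnm (vs w g) (va w g))) ->
  eqv h v w (fun g => r g * r' g) (invmx L *m M *m R).
Proof.
move=> uL uB hL hM hR g i l; set X := invmx L *m M *m R.
have uhL : map_mx (h g) L \in unitmx by rewrite map_unitmx.
have mE : mnm (vs v g) (fun i => (va v g i)^-1) = invmx L *m B g *m map_mx (h g) L.
  by rewrite hL -!mulmxA mulKVmx // mulKmx.
have E : mnm (vs v g) (fun i => (va v g i)^-1) *m map_mx (h g) X =
    (r g * r' g) *: (X *m mnm (vs w g) (va w g)).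
  rewrite /X !map_mxM map_invmx mE hM hR !mulmxA mulmxK //.
  rewrite -!scalemxAr -!scalemxAl scalerA [_ * r g]mulrC !mulmxA; congr (_ *: _).
  by rewrite mulmxK // -!mulmxA mulKVmx.
have := congr1 (fun Y : 'M_3 => Y (vs v g i) l) E.
rewrite mnm_mull [map_mx _ _ _ _]mxE [RHS]mxE mnm_mulr => /(canRL (mulKf _)) ->; last first.
  by rewrite invr_eq0 va_neq0.
by rewrite invrK; ring.
Qed.

Hypotheses (uP : P \in unitmx) (uQ : Q \in unitmx) (uP' : P' \in unitmx) (uQ' : Q' \in unitmx).
Hypotheses (ua : forall i, a i \in unitmx) (ud : forall i, d i \in unitmx).
Hypothesis (uN : forall i, N i \in unitmx).
Hypotheses (uA : forall g, A g \in unitmx) (uA' : forall g, A' g \in unitmx).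
Hypotheses (la0 : forall g, la g != 0) (mu0 : forall g, mu g != 0) (ca0 : forall g i, ca g i != 0).
Hypothesis hP : forall g,
  map_mx (h g) P = invmx (A g) *m P *m mnm (vs v1 g) (fun i => (va v1 g i)^-1).
Hypothesis hQ : forall g,
  map_mx (h g) Q = la g *: (invmx (A' g) *m Q *m mnm (vs v1 g) (va v1 g)).
Hypothesis hP' : forall g,
  map_mx (h g) P' = invmx (A' g) *m P' *m mnm (vs v2 g) (fun i => (va v2 g i)^-1).
Hypothesis hQ' : forall g,
  map_mx (h g) Q' = mu g *: (invmx (A g) *m Q' *m mnm (vs v2 g) (va v2 g)).
Hypothesis ha : forall g i, map_mx (h g) (a i) = ca g i *: (invmx (A g) *m a i *m A g).
Hypothesis hd : forall g i, map_mx (h g) (d i) = (ca g i)^-1 *: (invmx (A g) *m d i *m A g).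
Hypothesis hN : forall g i, map_mx (h g) (N i) = invmx (A' g) *m N i *m A' g.
Hypothesis rel : rel_word
  [:: invmx P *m (d 0 *m a 2) *m Q'; invmx P' *m N 0 *m Q;
      invmx P *m (d 1 *m a 0) *m Q'; invmx P' *m N 1 *m Q;
      invmx P *m (d 2 *m a 1) *m Q'; invmx P' *m N 2 *m Q].

(** The two monomial matrices have inverse determinants. In the quotient of [det P det Q] by
    [det P' det Q'] the determinants of [A g] and [A' g] cancel, which leaves [la^3 / mu^3], the
    inverse of the weight of [nu] below. *)
Lemma theta_galois (v : vtx K G) (r : G -> K) (B B' : G -> 'M[K]_3) (L R : 'M[K]_3) g :
  map_mx (h g) L = invmx (B g) *m L *m mnm (vs v g) (fun i => (va v g i)^-1) ->
  map_mx (h g) R = r g *: (invmx (B' g) *m R *m mnm (vs v g) (va v g)) ->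
  h g (\det L * \det R) = r g ^+ 3 * (\det L * \det R) / (\det (B g) * \det (B' g)).
Proof.
move=> hL hR; rewrite rmorphM -!det_map_mx hL hR detZ !det_mulmx !det_inv.
have := det_hinv (vs v g) (va_neq0 v g); rewrite hinv_mnm; move: (\det (mnm _ _)) (\det (mnm _ _)) => x y xy.
rewrite invfM -[RHS]mul1r -xy; ring.
Qed.

(* The scalars [ca] cancel out in the product of the odd matrices, so the representatives [a i]
   need not be normalized. *)
Lemma invariant_cube : exists om : K,
  om ^+ 3 * \prod_i \det (N i) = \prod_i (\det (d i) * \det (a i)) /\
  forall g, h g om = om.
Proof.
have hda i j g : map_mx (h g) (d i *m a j) =
    (ca g j / ca g i) *: (invmx (A g) *m (d i *m a j) *m A g).
  rewrite map_mxM ha hd -scalemxAr -scalemxAl scalerA; congr (_ *: _).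
  by rewrite -!mulmxA (mulKVmx (uA g)).
have hN1 i g : map_mx (h g) (N i) = 1 *: (invmx (A' g) *m N i *m A' g) by rewrite scale1r hN.
have r_odd i j g : ca g j / ca g i * mu g != 0 by rewrite !mulf_neq0 ?invr_neq0.
have r_even g : 1 * la g != 0 by rewrite mul1r.
have [|nu nuE nug] := word6 (r_odd 0 2) r_even (r_odd 1 0) r_even (r_odd 2 1) r_even _
  (eqv_conj uP uA hP (hda 0 2) hQ') (eqv_conj uP' uA' hP' (hN1 0) hQ)
  (eqv_conj uP uA hP (hda 1 0) hQ') (eqv_conj uP' uA' hP' (hN1 1) hQ)
  (eqv_conj uP uA hP (hda 2 1) hQ') (eqv_conj uP' uA' hP' (hN1 2) hQ) rel.
  by rewrite /= !unitmx_mul !unitmx_inv uP uP' uQ uQ' !ua !ud !uN.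
have {}nug g : h g nu * la g ^+ 3 = mu g ^+ 3 * nu.
  have := nug g; have [c0 c1] := (ca0 g 0, ca0 g 1); have c2 := ca0 g 2.
  rewrite !mul1r => e; rewrite (_ : la g ^+ 3 = la g * la g * la g); last by ring.
  by rewrite e; field; rewrite c0 c1 c2.
exists (nu * (\det P * \det Q) / (\det P' * \det Q')); split=> [|g].
  move: nuE; rewrite !det_mulmx !det_inv !big_ord3 /=.
  have [pP pQ] := (unit_det_neq0 uP, unit_det_neq0 uQ).
  have [pP' pQ'] := (unit_det_neq0 uP', unit_det_neq0 uQ').
  have pa0 := unit_det_neq0 (ua 0); have pa1 := unit_det_neq0 (ua 1); have pa2 := unit_det_neq0 (ua 2).
  move: pP pQ pP' pQ' pa0 pa1 pa2.
  move: (\det P) (\det Q) (\det P') (\det Q') (\det (a 0)) (\det (a 1)) (\det (a 2)).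
  move: (\det (d 0)) (\det (d 1)) (\det (d 2)) (\det (N 0)) (\det (N 1)) (\det (N 2)).
  move=> d0 d1 d2 n0 n1 n2 x y x' y' a0 a1 a2 x0 y0 x'0 y'0 _ _ _ e.
  have {}e : nu ^+ 3 * (n0 * n1 * n2) = d0 * a2 * (d1 * a0) * (d2 * a1) * (y' * x') ^+ 3 / (x * y) ^+ 3.
    apply: (mulIf (_ : (y / x') ^+ 3 != 0)); first by rewrite expf_neq0 // mulf_neq0 ?invr_neq0.
    transitivity (nu ^+ 3 * (x'^-1 * n0 * y * (x'^-1 * n1 * y) * (x'^-1 * n2 * y))); first by ring.
    by rewrite e; field; rewrite x0 y0 x'0.
  transitivity (nu ^+ 3 * (n0 * n1 * n2) * ((x * y) / (x' * y')) ^+ 3).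
    by field; rewrite x'0 y'0.
  by rewrite e; field; rewrite x0 y0 x'0 y'0.
rewrite fmorph_div rmorphM (theta_galois (hP g) (hQ g)) (theta_galois (hP' g) (hQ' g)).
have [pP pQ] := (unit_det_neq0 uP, unit_det_neq0 uQ).
  have [pP' pQ'] := (unit_det_neq0 uP', unit_det_neq0 uQ').
have [pA pA'] := (unit_det_neq0 (uA g), unit_det_neq0 (uA' g)).
have l0 := la0 g; have m0 := mu0 g; have := nug g.
move: pP pQ pP' pQ' pA pA' l0 m0.
move: (\det P) (\det Q) (\det P') (\det Q') (\det (A g)) (\det (A' g)) (la g) (mu g) (h g nu).
move=> x y x' y' u u' l m hn x0 y0 x'0 y'0 u0 u'0 l0 m0 e.
transitivity (hn * l ^+ 3 * (x * y) / (m ^+ 3 * x' * y')).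
  by field; rewrite x'0 y'0 u0 u'0 m0.
by rewrite e; field; rewrite x'0 y'0 m0.
Qed.

End InvariantCube.

(** * The relation between links as a word, and the conclusion *)

Section Assembly.

Variables (k : fieldType) (K : closedFieldType) (iota : {rmorphism k -> K}).
Hypothesis K_alg : is_alg_closure iota.

Definition galois_group := {h : {rmorphism K -> K} | fixes_base iota h}.
Definition gal_fun (g : galois_group) : {rmorphism K -> K} := sval g.

Lemma link_vtx (S T : sb_surface iota) (s : splitting S) (t : splitting T) f P Q p
    (A A' : galois_group -> 'M[K]_3) :
  quad_at s t f P Q -> three_point p -> (forall i, same_pt (sp_phi s (p i)) (col i P)) ->
  (forall g, galois_mx s (gal_fun g) (A g)) -> (forall g, galois_mx t (gal_fun g) (A' g)) ->
  exists (v : vtx K galois_group) (la : galois_group -> K), [/\ forall g, la g != 0,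
    forall g, map_mx (gal_fun g) P =
      invmx (A g) *m P *m mnm (vs v g) (fun i => (va v g i)^-1) &
    forall g, map_mx (gal_fun g) Q = la g *: (invmx (A' g) *m Q *m mnm (vs v g) (va v g))].
Proof.
move=> fPQ p3 pP hA hA'.
have /boolp.choice[D DE] : forall g : galois_group, exists D : {perm 'I_3} * ('I_3 -> K) * K,
    [/\ forall i, D.1.2 i != 0, D.2 != 0,
      map_mx (gal_fun g) P = invmx (A g) *m P *m mnm D.1.1 D.1.2,
      map_mx (gal_fun g) Q = D.2 *: (invmx (A' g) *m Q *m mnm D.1.1 (fun i => (D.1.2 i)^-1)) &
      forall i, same_pt (map_mx (gal_fun g) (p i)) (p (D.1.1 i))].
  move=> g; have [si [w [la H]]] := link_galois K_alg fPQ p3 pP (svalP g) (hA g) (hA' g).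
  by exists (si, w, la).
have va0 g i : ((D g).1.2 i)^-1 != 0 by rewrite invr_eq0; case: (DE g).
have trans i j : exists g, (D g).1.1 i = j.
  have [_ distinct _ hp] := p3; have [h hk hE] := hp i j.
  exists (exist _ h hk); apply: distinct; apply: same_pt_trans (same_pt_sym _) hE.
  by have [_ _ _ _] := DE (exist _ h hk); apply.
exists (Vtx va0 trans), (fun g => (D g).2); split=> g /=; have [w0 l0 PE QE _] := DE g => //.
by rewrite PE; congr (_ *m mnm _ _); apply: boolp.funext => i; rewrite invrK.
Qed.

Lemma relation_word (S T : sb_surface iota) (s : splitting S) (t : splitting T)
    (chi : birat S T) (chi_ : 'I_3 -> birat S T) (tau : birat T S) (tau_ : 'I_3 -> birat T S)
    alpha beta gamma delta P Q P' Q' (a b c d : 'I_3 -> 'M[K]_3) :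
  (forall i, is_aut S (alpha i)) -> (forall i, is_aut S (delta i)) ->
  (forall i, is_aut T (beta i)) -> (forall i, is_aut T (gamma i)) ->
  (forall i, factors_as (tau_ i) tau (alpha i) (beta i)) ->
  (forall i, factors_as (chi_ i) chi (gamma i) (delta i)) ->
  quad_at s t chi P Q -> quad_at t s tau P' Q' ->
  (forall i, lin_rep s (alpha i) (a i)) -> (forall i, lin_rep t (beta i) (b i)) ->
  (forall i, lin_rep t (gamma i) (c i)) -> (forall i, lin_rep s (delta i) (d i)) ->
  (forall x0 x1 x2 x3 x4 x5 x6,
     graph (chi_ 0) x0 x1 -> graph (tau_ 0) x1 x2 -> graph (chi_ 1) x2 x3 ->
     graph (tau_ 1) x3 x4 -> graph (chi_ 2) x4 x5 -> graph (tau_ 2) x5 x6 ->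
     same_pt x6 x0) ->
  rel_word
  [:: invmx P *m (d 0 *m a 2) *m Q'; invmx P' *m (b 0 *m c 0) *m Q;
      invmx P *m (d 1 *m a 0) *m Q'; invmx P' *m (b 1 *m c 1) *m Q;
      invmx P *m (d 2 *m a 1) *m Q'; invmx P' *m (b 2 *m c 2) *m Q].
Proof.
move=> alA deA beA gaA tauE chiE chiPQ tauPQ aE bE cE dE rel.
have /boolp.choice[gc gcE] : forall i, exists good, generic good /\
    forall x y, S x -> same_pt (sp_phi s x) y -> good y ->
    teval iota (bi_fwd (chi_ i)) x != 0 /\
    same_pt (sp_phi t (teval iota (bi_fwd (chi_ i)) x)) (step (c i) (d i) P Q y).
  by move=> i; have [good] := factors_step (gaA i) (deA i) (chiE i) chiPQ (cE i) (dE i); exists good.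
have /boolp.choice[gt gtE] : forall i, exists good, generic good /\
    forall x y, T x -> same_pt (sp_phi t x) y -> good y ->
    teval iota (bi_fwd (tau_ i)) x != 0 /\
    same_pt (sp_phi s (teval iota (bi_fwd (tau_ i)) x)) (step (a i) (b i) P' Q' y).
  by move=> i; have [good] := factors_step (alA i) (beA i) (tauE i) tauPQ (aE i) (bE i); exists good.
have [uP uQ _] := chiPQ; have [uP' uQ' _] := tauPQ.
have uc i : [/\ c i \in unitmx, d i \in unitmx, P \in unitmx & Q \in unitmx].
  by split=> //; [case: (cE i)|case: (dE i)].
have ut i : [/\ a i \in unitmx, b i \in unitmx, P' \in unitmx & Q' \in unitmx].
  by split=> //; [case: (aE i)|case: (bE i)].
pose sc i := step (c i) (d i) P Q; pose st i := step (a i) (b i) P' Q'.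
have Gc i : generic (gc i) by case: (gcE i).
have Gt i : generic (gt i) by case: (gtE i).
have G5 := genericI (Gc 2) (generic_step (uc 2) (Gt 2)).
have G4 := genericI (Gt 1) (generic_step (ut 1) G5).
have G3 := genericI (Gc 1) (generic_step (uc 1) G4).
have G2 := genericI (Gt 0) (generic_step (ut 0) G3).
have G1 := genericI (Gc 0) (generic_step (uc 0) G2).
have [ua _ _ _] := ut 2; have uaQ : a 2 *m Q' \in unitmx by rewrite unitmx_mul ua.
apply: generic_par; [exact: pmap_fwd|by move=> i; apply: pfun_coord|].
(* The starting point is taken of the form [a 2 *m Q' *m v], so that the last factor [a 2 *m Q'] of
   the composition becomes part of the first letter. *)
apply: genericW (genericI (@generic_neq0 K) (generic_mul uaQ G1)) => v [v0].
set y0 := _ *m v; move=> [g1 [g2 [g3 [g4 [g5 g6]]]]].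
have y00 : y0 != 0 by rewrite mulmx_eq0.
pose x0 := sp_psi s y0.
have Sx0 : S x0 by apply: psiS.
have x0E : same_pt (sp_phi s x0) y0 by apply: psiK.
have grI (U V : sb_surface iota) (f : birat U V) x : U x -> teval iota (bi_fwd f) x != 0 ->
    graph f x (teval iota (bi_fwd f) x) by move=> Ux fx; split=> //; exact: same_pt_refl.
have [_ /(_ _ _ Sx0 x0E g1)[n1 x1E]] := gcE 0; have Tx1 := fwd_in Sx0 n1.
have [_ /(_ _ _ Tx1 x1E g2)[n2 x2E]] := gtE 0; have Sx2 := fwd_in Tx1 n2.
have [_ /(_ _ _ Sx2 x2E g3)[n3 x3E]] := gcE 1; have Tx3 := fwd_in Sx2 n3.
have [_ /(_ _ _ Tx3 x3E g4)[n4 x4E]] := gtE 1; have Sx4 := fwd_in Tx3 n4.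
have [_ /(_ _ _ Sx4 x4E g5)[n5 x5E]] := gcE 2; have Tx5 := fwd_in Sx4 n5.
have [_ /(_ _ _ Tx5 x5E g6)[n6 x6E]] := gtE 2; have Sx6 := fwd_in Tx5 n6.
have x60 := rel _ _ _ _ _ _ _ (grI _ _ _ _ Sx0 n1) (grI _ _ _ _ Tx1 n2) (grI _ _ _ _ Sx2 n3)
  (grI _ _ _ _ Tx3 n4) (grI _ _ _ _ Sx4 n5) (grI _ _ _ _ Tx5 n6).
have := same_pt_trans (same_pt_sym x6E) (same_pt_trans (phi_same s Sx6 x60) x0E).
move=> /same_pt_par/(par_mul (invmx (a 2 *m Q'))); rewrite /y0 mulKmx //.
rewrite {1}/step mulmxA mulKmx // /step /= -!mulmxA; apply.
Qed.

End Assembly.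

Theorem theorem1 (k : fieldType) (K : closedFieldType)
    (iota : {rmorphism k -> K})
    (k_perfect : perfect_field k) (K_closure : is_alg_closure iota)
    (S Sop : sb_surface iota) (s : splitting S) (sop : splitting Sop)
    (S_nontrivial : nontrivial S) (Sop_opposite : opposite s sop)
    (chi : birat S Sop) (chi_ : 'I_3 -> birat S Sop)
    (tau : birat Sop S) (tau_ : 'I_3 -> birat Sop S)
    (chi_link : three_link s sop chi)
    (chi_links : forall i, three_link s sop (chi_ i))
    (tau_link : three_link sop s tau)
    (tau_links : forall i, three_link sop s (tau_ i))
    (alpha delta : 'I_3 -> 'cV[K]_(sb_ambient S).+1 -> 'cV[K]_(sb_ambient S).+1)
    (beta gamma : 'I_3 -> 'cV[K]_(sb_ambient Sop).+1 -> 'cV[K]_(sb_ambient Sop).+1)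
    (alpha_aut : forall i, is_aut S (alpha i))
    (delta_aut : forall i, is_aut S (delta i))
    (beta_aut : forall i, is_aut Sop (beta i))
    (gamma_aut : forall i, is_aut Sop (gamma i))
    (tau_E : forall i, factors_as (tau_ i) tau (alpha i) (beta i))
    (chi_E : forall i, factors_as (chi_ i) chi (gamma i) (delta i))
    (general : exists p q,
       [/\ link_at sop s (birat_inv chi) p, link_at sop s tau q
         & general_position sop p q])
    (relation : forall x0 x1 x2 x3 x4 x5 x6,
       graph (chi_ (inord 0)) x0 x1 -> graph (tau_ (inord 0)) x1 x2 ->
       graph (chi_ (inord 1)) x2 x3 -> graph (tau_ (inord 1)) x3 x4 ->
       graph (chi_ (inord 2)) x4 x5 -> graph (tau_ (inord 2)) x5 x6 ->
       same_pt x6 x0)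
    (det_ad : 'I_3 -> k) (det_bg : 'I_3 -> k)
    (det_adE : forall i, is_det s (alpha i \o delta i) (det_ad i))
    (det_bgE : forall i, is_det sop (beta i \o gamma i) (det_bg i)) :
  eq_mod_cubes (\prod_(i < 3) (det_ad i * (det_bg i)^-1)) 1.
Proof.
have in0 : inord 0 = 0 :> 'I_3 by apply: val_inj; rewrite /= inordK.
have in1 : inord 1 = 1 :> 'I_3 by apply: val_inj; rewrite /= inordK.
have in2 : inord 2 = 2 :> 'I_3 by apply: val_inj; rewrite /= inordK.
rewrite in0 in1 in2 in relation.
have [p chi_p] := chi_link; have [P [Q [chiPQ pP]]] := link_quad_at chi_p; have [p3 _] := chi_p.
have [q tau_q] := tau_link; have [P' [Q' [tauPQ qP]]] := link_quad_at tau_q; have [q3 _] := tau_q.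
have /boolp.choice[ab abE] : forall i, exists ab : 'M[K]_3 * 'M[K]_3,
    lin_rep s (alpha i) ab.1 /\ lin_rep sop (beta i) ab.2.
  move=> i; have [qi tau_qi] := tau_links i; have [Pi [Qi [tauPQi _]]] := link_quad_at tau_qi.
  have [a [b abE]] := factors_linear (alpha_aut i) (beta_aut i) (tau_E i) tauPQ tauPQi.
  by exists (a, b).
pose a i := (ab i).1; pose b i := (ab i).2.
have aE i : lin_rep s (alpha i) (a i) by case: (abE i).
have bE i : lin_rep sop (beta i) (b i) by case: (abE i).
have /boolp.choice[M ME] := det_adE; have /boolp.choice[N NE] := det_bgE.
pose M' i := map_mx (sp_emb s) (M i); pose N' i := map_mx (sp_emb sop) (N i).
have uM i : M' i \in unitmx by rewrite map_unitmx; case: (ME i).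
have uN i : N' i \in unitmx by rewrite map_unitmx; case: (NE i).
(* The matrices of [delta] and [gamma] are derived from the representatives [M'] and [N'] that
   define the determinants. Hence the Galois scalars of [d i] and [a i] are inverse to each other,
   and [b i *m c i] has none. *)
pose d i := invmx (a i) *m M' i; pose c i := invmx (b i) *m N' i.
have dE i : lin_rep s (delta i) (d i).
  apply: lin_rep_comp (delta_aut i) (aE i) (uM i) _.
  by case: (ME i).
have cE i : lin_rep sop (gamma i) (c i).
  apply: lin_rep_comp (gamma_aut i) (bE i) (uN i) _.
  by case: (NE i).
have [ua ub] : (forall i, a i \in unitmx) /\ forall i, b i \in unitmx.
  by split=> i; [case: (aE i)|case: (bE i)].
have [uc ud] : (forall i, c i \in unitmx) /\ forall i, d i \in unitmx.
  by split=> i; [case: (cE i)|case: (dE i)].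
have [uP uQ _] := chiPQ; have [uP' uQ' _] := tauPQ.
have rel : rel_word
  [:: invmx P *m (d 0 *m a 2) *m Q'; invmx P' *m N' 0 *m Q;
      invmx P *m (d 1 *m a 0) *m Q'; invmx P' *m N' 1 *m Q;
      invmx P *m (d 2 *m a 1) *m Q'; invmx P' *m N' 2 *m Q].
  have bcE i : N' i = b i *m c i by rewrite mulKVmx.
  rewrite !bcE.
  exact: (relation_word alpha_aut delta_aut beta_aut gamma_aut tau_E chi_E chiPQ tauPQ aE bE cE dE).
have /boolp.choice[A hA] : forall g, exists A, galois_mx s (@gal_fun k K iota g) A.
  by move=> g; apply/galois_mx_ex/svalP.
have /boolp.choice[A' hA'] : forall g, exists A, galois_mx sop (@gal_fun k K iota g) A.
  by move=> g; apply/galois_mx_ex/svalP.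
have [v1 [la [la0 hP hQ]]] := link_vtx K_closure chiPQ p3 pP hA hA'.
have [v2 [mu [mu0 hP' hQ']]] := link_vtx K_closure tauPQ q3 qP hA' hA.
have /boolp.choice[ca caE] : forall g, exists ca : 'I_3 -> K, forall i, ca i != 0 /\
    map_mx (gal_fun g) (a i) = ca i *: (invmx (A g) *m a i *m A g).
  move=> g; have /boolp.choice[ca caE] : forall i, exists ca, ca != 0 /\
    map_mx (gal_fun g) (a i) = ca *: (invmx (A g) *m a i *m A g).
    move=> i; have [ca ca0 E] := lin_rep_galois K_closure (svalP g) (hA g) (alpha_aut i) (aE i).
    by exists ca.
  by exists ca.
have ha g i : map_mx (gal_fun g) (a i) = ca g i *: (invmx (A g) *m a i *m A g) by case: (caE g i).
have ca0 g i : ca g i != 0 by case: (caE g i).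
have uA g : A g \in unitmx by case: (hA g).
have uA' g : A' g \in unitmx by case: (hA' g).
have hN g i : map_mx (gal_fun g) (N' i) = invmx (A' g) *m N' i *m A' g.
  by have [_ _] := hA' g; apply; case: (NE i).
have hM g i : map_mx (gal_fun g) (M' i) = invmx (A g) *m M' i *m A g.
  by have [_ _] := hA g; apply; case: (ME i).
have hd g i : map_mx (gal_fun g) (d i) = (ca g i)^-1 *: (invmx (A g) *m d i *m A g).
  have uha : map_mx (gal_fun g) (a i) \in unitmx by rewrite map_unitmx.
  apply: (can_inj (mulKmx uha)); rewrite -map_mxM mulKVmx // hM ha.
  rewrite -scalemxAl -scalemxAr scalerA mulfV // scale1r !mulmxA mulmxK //.
  by rewrite -(mulmxA _ (a i)) mulmxV // mulmx1.
have [om [om3 om_fix]] := invariant_cube uP uQ uP' uQ' ua ud uN uA uA' la0 mu0 ca0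
  hP hQ hP' hQ' ha hd hN rel.
have [e eE] := fixed_in_base k_perfect K_closure (fun h hk => om_fix (exist _ h hk)).
have detN i : \det (N' i) = iota (det_bg i).
  by rewrite det_map_mx; have [_ _ _ ->] := NE i; rewrite sp_embE.
have detM i : \det (d i) * \det (a i) = iota (det_ad i).
  rewrite mulrC -det_mulmx mulKVmx // det_map_mx.
  by have [_ _ _ ->] := ME i; rewrite sp_embE.
have bg0 i : det_bg i != 0 by rewrite -(fmorph_eq0 iota) -detN -unitfE -unitmxE.
have ad0 i : det_ad i != 0.
  by rewrite -(fmorph_eq0 iota) -detM mulf_neq0 // -unitfE -unitmxE.
have E : e ^+ 3 * \prod_i det_bg i = \prod_i det_ad i.
  apply: (fmorph_inj iota); rewrite rmorphM rmorphXn -eE !rmorph_prod /=.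
  by rewrite -(eq_bigr _ (fun i _ => detN i)) om3; apply: eq_bigr.
have bgp : \prod_i det_bg i != 0 by apply/prodf_neq0.
have adp : \prod_i det_ad i != 0 by apply/prodf_neq0.
exists e; first by apply: contraNneq adp => e0; rewrite -E e0 expr0n mul0r.
by rewrite mulr1 big_split /= prodfV -E mulfK.
Qed.
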